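(* Let $\lambda_n^D$ denote the $n$-th Dirichlet eigenvalue, i.e. the $n$-th eigenvalue of $-(y^{[1]})'+sy^{[1]}+qy=\lambda ry$ on $(a,b)$ with $y(a)=y(b)=0$, and for a self-adjoint boundary condition with matrices $(A,B)$ let $\lambda_n(A,B)$ denote the $n$-th eigenvalue of the same equation with the boundary condition $AY(a)+BY(b)=0$. Then: (a) $\lambda_0(A,B)\le\lambda_0^D$ and $\lambda_1(A,B)\le\lambda_1^D$; (b) $\lambda_{n-2}^D<\lambda_n(A,B)\le\lambda_n^D$ for $n\ge2$.
   Context: Let $J=(a,b)$ with $-\infty<a<b<\infty$, and let $p,q,r,s$ be real-valued functions on $J$ with $1/p,q,r,s\in L^1(J,\mathbb R)$, $p>0$ and $r>0$ a.e. on $J$. Put $y^{[1]}=p(y'+sy)$ and $Y=(y,y^{[1]})^T$. Solutions of the equation are functions $y$ with $y,y^{[1]}$ absolutely continuous on $[a,b]$. A self-adjoint boundary condition is $AY(a)+BY(b)=0$ with complex $2\times2$ matrices $A,B$ such that the $2\times4$ matrix $(A|B)$ has rank $2$ and $AEA^*=BEB^*$, $E=\begin{pmatrix}0&-1\\1&0\end{pmatrix}$. An eigenvalue is a $\lambda$ for which there is a nontrivial solution satisfying the boundary condition; the eigenvalues are real and, counted with multiplicity, are ordered as a non-decreasing sequence indexed by $n\in\mathbb N_0=\{0,1,2,\ldots\}$ tending to $+\infty$. *)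

(* Defs.v *)
From HB Require Import structures.
From mathcomp Require Import all_boot all_order all_algebra.
From mathcomp Require Import complex.
From mathcomp Require Import all_classical all_reals all_analysis.

Set Implicit Arguments.
Unset Strict Implicit.
Unset Printing Implicit Defensive.

Import Order.TTheory GRing.Theory Num.Theory.
Import numFieldNormedType.Exports.

Local Open Scope classical_set_scope.
Local Open Scope ring_scope.
Local Open Scope complex_scope.

Section SturmLiouville.
Context {R : realType}.
Implicit Types (a b : R) (p q r s : R -> R).

(* [f] is (a representative of) an element of L^1(]a, b[).  The library's
   integrable functions are Borel measurable; allowing a modification on a null
   set covers all Lebesgue-measurable representatives. *)
Definition in_L1 a b (f : R -> R) : Prop :=
  exists2 g : R -> R,
    (@lebesgue_measure R).-integrable `]a, b[ (EFin \o g) &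
    {ae @lebesgue_measure R, forall x, x \in `]a, b[ -> f x = g x}.

Definition abs_continuous a b (f : R -> R) : Prop :=
  forall e : R, 0 < e -> exists2 d : R, 0 < d &
    forall (n : nat) (u v : 'I_n -> R),
      (forall i, [/\ a <= u i, u i <= v i & v i <= b]) ->
      trivIset setT (fun i => `]u i, v i[%classic) ->
      \sum_(i < n) (v i - u i) < d ->
      \sum_(i < n) `|f (v i) - f (u i)| < e.

Definition abs_continuousC a b (f : R -> R[i]) : Prop :=
  abs_continuous a b (fun x => complex.Re (f x)) /\
  abs_continuous a b (fun x => complex.Im (f x)).

(* Only meaningful at points where Re f and Im f are derivable, which is almost
   everywhere when f is absolutely continuous. *)
Definition cderiv (f : R -> R[i]) (x : R) : R[i] :=
  derive1 (fun t => complex.Re (f t)) x +i* derive1 (fun t => complex.Im (f t)) x.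

(* The quasi-derivative y^{[1]} = p (y' + s y) is a priori only defined almost
   everywhere; [y1] is its absolutely continuous representative, which gives a
   meaning to the boundary values y^{[1]}(a) and y^{[1]}(b). *)
Definition quasi_derivative a b p s (y y1 : R -> R[i]) : Prop :=
  abs_continuousC a b y1 /\
  {ae @lebesgue_measure R, forall x, x \in `]a, b[ ->
     y1 x = (p x)%:C * (cderiv y x + (s x)%:C * y x)}.

(* [y], with quasi-derivative [y1], solves
   - (y^{[1]})' + s y^{[1]} + q y = z r y  on ]a, b[. *)
Definition SL_solution a b p q r s (z : R[i]) (y y1 : R -> R[i]) : Prop :=
  [/\ abs_continuousC a b y,
      quasi_derivative a b p s y y1 &
      {ae @lebesgue_measure R, forall x, x \in `]a, b[ ->
         - cderiv y1 x + (s x)%:C * y1 x + (q x)%:C * y x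
         = z * (r x)%:C * y x}].

(* The vector Y = (y, y^{[1]})^T at x. *)
Definition bvec (y y1 : R -> R[i]) (x : R) : 'cV[R[i]]_2 :=
  \col_(i < 2) (if i == 0 then y x else y1 x).

(* A boundary condition is a relation between Y(a) and Y(b). *)
Definition boundary_condition := 'cV[R[i]]_2 -> 'cV[R[i]]_2 -> Prop.

Definition matrix_bc (A B : 'M[R[i]]_2) : boundary_condition :=
  fun Ya Yb => A *m Ya + B *m Yb = 0.

Definition dirichlet_bc : boundary_condition :=
  fun Ya Yb => Ya 0 0 = 0 /\ Yb 0 0 = 0.

Definition symplectic_E : 'M[R[i]]_2 :=
  \matrix_(i < 2, j < 2)
    (if (i < j)%N then -1 else if (j < i)%N then 1 else 0).

Definition adjoint_mx (A : 'M[R[i]]_2) : 'M[R[i]]_2 := (map_mx Num.conj A)^T.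

Definition self_adjoint_bc (A B : 'M[R[i]]_2) : Prop :=
  \rank (row_mx A B) = 2%N /\
  A *m symplectic_E *m adjoint_mx A = B *m symplectic_E *m adjoint_mx B.

Definition eigenspace_SL a b p q r s (bc : boundary_condition) (z : R[i]) :
    set (R -> R[i]) :=
  [set y | exists2 y1, SL_solution a b p q r s z y y1 &
                       bc (bvec y y1 a) (bvec y y1 b)].

Definition eigenvalue_SL a b p q r s (bc : boundary_condition) (z : R[i]) :
    Prop :=
  exists2 y, eigenspace_SL a b p q r s bc z y &
             exists2 x, x \in `[a, b] & y x != 0.

(* The restrictions to [a, b] of the elements of [V] form a space of dimension
   [m]: values outside [a, b] are irrelevant, so linear (in)dependence is
   tested on [a, b] only. *)
Definition has_dim_on a b (V : set (R -> R[i])) (m : nat) : Prop :=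
  exists f : 'I_m -> R -> R[i],
    [/\ forall i, V (f i),
        forall c : 'I_m -> R[i],
          (forall x, x \in `[a, b] -> \sum_(i < m) c i * f i x = 0) ->
          forall i, c i = 0 &
        forall y, V y -> exists c : 'I_m -> R[i],
          forall x, x \in `[a, b] -> y x = \sum_(i < m) c i * f i x].

(* [lam] lists all eigenvalues, each one as many times as its (geometric)
   multiplicity, in nondecreasing order; this determines [lam]. *)
Definition eigenvalue_sequence a b p q r s (bc : boundary_condition)
    (lam : nat -> R) : Prop :=
  [/\ nondecreasing_seq lam,
      lam n @[n --> \oo] --> +oo,
      forall z : R[i],
        eigenvalue_SL a b p q r s bc z <-> exists n, z = (lam n)%:C &
      forall n, exists2 m,
        has_dim_on a b (eigenspace_SL a b p q r s bc (lam n)%:C) m &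
        ([set k | lam k = lam n] #= `I_m)%card].

End SturmLiouville.

(* Main.v *)
(* Elements of the form domain of a self-adjoint boundary condition are pairs of
   real functions (real and imaginary parts), so that every dimension doubles.

   Counting principle: if the form [B] is at most [nu] times the weighted L^2 form
   [G] on a space of real dimension greater than [2 m], then [lam m <= nu].  Let
   [sigma] be the infimum of the [nu] admitting such a space.  On a fine mesh
   [B - sigma G] is coercive on the functions vanishing at the nodes, and the
   orthogonal complement of these consists of broken solutions, of finite
   dimension; diagonalizing there shows that the family at [sigma] splits into a
   negative part, which survives slightly below [sigma], and a kernel, which
   consists of eigenfunctions.  Induction on [m] concludes, without compactness.

   Elements vanishing at both ends belong to the form domain of every boundary
   condition (with zero boundary values of the quasi-derivative), whence
   [lam n <= lamD n].  For the strict bound suppose [lam (n + 2) <= lamD n = nu].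
   In the span of the first n + 3 eigenfunctions, of real dimension 2n + 6, four
   real conditions impose zero boundary values; adding the two real Dirichlet
   eigenfunctions at [nu] gives a Dirichlet space of dimension 2n + 4, so that
   [lamD (n + 1) <= nu], against the simplicity of Dirichlet eigenvalues.  If the
   sum is not direct, the Dirichlet eigenfunction is also an eigenfunction of the
   other problem; then the Lagrange identity determines the values at [a] from
   those at [b], two real conditions suffice, and the dimension is again 2n + 4. *)

Require Import Defs.
From HB Require Import structures.
From mathcomp Require Import all_boot all_order all_algebra.
From mathcomp Require Import complex.
From mathcomp Require Import all_classical all_reals all_analysis.
From mathcomp Require Import measurable_realfun zify ring lra.

Set Implicit Arguments.
Unset Strict Implicit.
Unset Printing Implicit Defensive.

Import Order.TTheory GRing.Theory Num.Theory.
Import numFieldNormedType.Exports.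

Local Open Scope classical_set_scope.
Local Open Scope ring_scope.
Local Open Scope complex_scope.

(** * Quadratic forms and eigenvalue counting *)

(** The eigenvalue sequences are given data and no completeness of eigenfunctions is available, so a
    min-max formula cannot be read off an expansion: an upper bound for [lam m] has to produce
    eigenfunctions, which is why the critical level [sigma] is examined. The coefficients are only
    integrable, so smallness always means a small integral over each cell of a mesh, obtained from
    the absolute continuity of the integral; there is no pointwise bound on [q] or [s]. The
    quasi-derivative of a form element is merely a bounded measurable function and has no boundary
    values, whereas the form contains a boundary term in them. Candidates for these values are
    therefore stored with the element and tied to the function values by the boundary condition.
    This treats Dirichlet, separated and coupled conditions by one form without case distinction:
    isotropy of the condition makes the form symmetric, and maximality shows that the kernel
    elements satisfy the condition with their true boundary values. *)

(** Completion to a basis: in the Gaussian factorization of [v] the left factor is a nonzero scalar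
    and is absorbed into the invertible right factor. *)
Lemma exists_unitmx_row0 (F : fieldType) n (v : 'rV[F]_n.+1) :
  v != 0 -> exists2 P : 'M[F]_n.+1, P \in unitmx & row 0 P = v.
Proof.
move=> v0.
have rv : \rank v = 1%N by rewrite rank_rV v0.
have := mulmx_ebase v; rewrite rv => Ev.
have Uc := col_ebase_unit v.
have c0 : col_ebase v 0 0 != 0.
  by move: Uc; rewrite unitmxE det_mx11 unitfE.
exists (col_ebase v 0 0 *: row_ebase v).
  by rewrite -mul_scalar_mx unitmx_mul row_ebase_unit unitmxE det_scalar unitfE expf_neq0.
rewrite -[RHS]Ev; apply/rowP => j.
rewrite [col_ebase v]mx11_scalar mul_scalar_mx -scalemxAl !mxE; congr (_ * _).
rewrite (bigD1 0)//= !mxE /= mul1r big1 ?addr0// => i i0.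
by rewrite mxE /= eq_sym -val_eqE /= in i0 *; rewrite (negbTE i0) mul0r.
Qed.

(** Lagrange's completion of squares: only a congruence is needed, so no eigenvalues of [S] enter. A
    vector of nonzero square is split off, and the induction continues on the Schur complement
    [C1]. *)
Lemma symmetric_mx_diag (F : numFieldType) n (S : 'M[F]_n) :
  S^T = S -> exists2 P : 'M[F]_n, P \in unitmx & is_diag_mx (P *m S *m P^T).
Proof.
elim: n S => [|n IH] S Ssym.
  by exists 1%:M; [exact: unitmx1|apply/is_diag_mxP => -[]].
have [[v vS]|S0] := pselect (exists v : 'rV_n.+1, (v *m S *m v^T) 0 0 != 0).
  have v0 : v != 0.
    by apply: contraNneq vS => ->; rewrite !mul0mx mxE.
  have [P0 UP0 Pv] := exists_unitmx_row0 v0.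
  have [S1 S1E] : {S1 : 'M[F]_(1 + n) | S1 = P0 *m S *m P0^T} by eexists.
  have S1sym : S1^T = S1 by rewrite S1E !trmx_mul trmxK Ssym mulmxA.
  have a0 : S1 0 0 != 0.
    have -> : S1 0 0 = (v *m S *m v^T) 0 0.
      rewrite S1E -Pv -!row_mul !mxE; apply: eq_bigr => i _; congr (_ * _).
      by rewrite !mxE.
    by [].
  pose a : F := S1 0 0.
  have ulE : ulsubmx S1 = a%:M.
    by rewrite [LHS]mx11_scalar; congr (_%:M); rewrite !mxE /a; congr (S1 _ _); apply/val_inj.
  pose b := ursubmx S1.
  have dlE : dlsubmx S1 = b^T by rewrite /b trmx_ursub S1sym.
  pose C := drsubmx S1.
  have Csym : C^T = C by rewrite /C trmx_drsub S1sym.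
  pose C1 := C - a^-1 *: (b^T *m b).
  have C1sym : C1^T = C1.
    by rewrite /C1 linearB linearZ /= trmx_mul trmxK Csym.
  have [P1 UP1 diag1] := IH C1 C1sym.
  (* [Q] clears the first row and column below the pivot [a]; [T] then diagonalizes the remaining
     block. *)
  pose Q : 'M[F]_(1 + n) := block_mx 1%:M 0 (- a^-1 *: b^T) 1%:M.
  pose T : 'M[F]_(1 + n) := block_mx 1%:M 0 0 P1.
  have QSQ : Q *m S1 *m Q^T = block_mx a%:M 0 0 C1.
    rewrite -[S1]submxK ulE -/b dlE -/C /Q tr_block_mx !mulmx_block.
    rewrite !trmx1 ?trmx0 !mul1mx ?mul0mx ?mulmx1 ?mulmx0 ?addr0 ?add0r.
    have -> : - a^-1 *: b^T *m a%:M + b^T = 0.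
      by rewrite mul_mx_scalar scalerA mulrN mulfV// scaleN1r addNr.
    have -> : a%:M *m (- a^-1 *: b^T)^T + b = 0.
      by rewrite linearZ /= trmxK mul_scalar_mx scalerA mulrN mulfV// scaleN1r addNr.
    by rewrite mul0mx add0r -scalemxAl scaleNr addrC.
  exists (T *m Q *m P0).
    have UQ : Q \in unitmx by rewrite unitmxE det_lblock !det1 mulr1 unitr1.
    have UT : T \in unitmx by rewrite unitmxE det_lblock det1 mul1r -unitmxE.
    have UTQ : T *m Q \in unitmx by rewrite unitmx_mul UT UQ.
    by rewrite unitmx_mul UP0 andbT; exact: UTQ.
  have -> : T *m Q *m P0 *m S *m (T *m Q *m P0)^T = T *m (Q *m S1 *m Q^T) *m T^T.
    by rewrite S1E !trmx_mul !mulmxA.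
  rewrite QSQ /T tr_block_mx !mulmx_block !trmx1 !trmx0.
  rewrite !mul1mx !mul0mx !mulmx1 !mulmx0 !addr0 !add0r ?mul0mx.
  move: (P1 *m C1 *m P1^T) diag1 => E /is_diag_mxP diagE.
  apply/is_diag_mxP => i j.
  rewrite !mxE; case: splitP => i' ->; rewrite !mxE; case: splitP => j' -> // ij; rewrite ?mxE //.
  - by move: ij; rewrite !ord1.
  - exact: diagE.
exists 1%:M; first exact: unitmx1.
rewrite mul1mx trmx1 mulmx1; suff -> : S = 0.
  by apply/is_diag_mxP => i j _; rewrite mxE.
(* If every vector has square zero, polarization gives [2 * S i j = 0], hence [S = 0]. *)
have form0 (v : 'rV_n.+1) : (v *m S *m v^T) 0 0 = 0.
  by apply/eqP; apply: contra_notT S0 => h; exists v.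
have bil (i j : 'I_n.+1) :
       ((delta_mx 0 i : 'rV[F]_n.+1) *m S *m (delta_mx 0 j : 'rV[F]_n.+1)^T) 0 0 = S i j.
  by rewrite -rowE trmx_delta -colE !mxE.
apply/matrixP => i j; rewrite [RHS]mxE.
have := form0 ((delta_mx 0 i : 'rV[F]_n.+1) + (delta_mx 0 j : 'rV[F]_n.+1)).
rewrite linearD /= !mulmxDl !mulmxDr.
have E (x y z t : 'M[F]_1) : (x + y + (z + t)) 0 0 = x 0 0 + y 0 0 + (z 0 0 + t 0 0).
  by rewrite !mxE.
rewrite E !bil.
have Sii k : S k k = 0 by rewrite -bil form0.
have Sji : S j i = S i j by rewrite -{1}Ssym mxE.
rewrite !Sii add0r addr0 Sji => /eqP.
by rewrite -mulr2n mulrn_eq0 /= => /eqP.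
Qed.

Lemma exists_lin_relation (F : fieldType) (I J : finType) (A : I -> J -> F)
    (P : pred J) : (#|P| < #|I|)%N ->
  exists2 c : I -> F, exists i, c i != 0 & forall j, P j -> \sum_i c i * A i j = 0.
Proof.
move=> PI.
pose M : 'M[F]_(#|I|, #|P|) := \matrix_(i, j) A (enum_val i) (enum_val j).
have : ~~ row_free M.
  by rewrite -row_leq_rank -ltnNge (leq_ltn_trans (rank_leq_col _)).
rewrite -kermx_eq0 => /rowV0Pn[u /sub_kermxP uM u0].
exists (fun i => u 0 (enum_rank i)).
  by have /rV0Pn[j uj] := u0; exists (enum_val j); rewrite enum_valK.
move=> j Pj; rewrite (reindex _ (onW_bij _ (@enum_val_bij I)))/=.
have /rowP/(_ (enum_rank_in Pj j)) := uM; rewrite !mxE => E; rewrite -[RHS]E.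
by apply: eq_bigr => i _; rewrite enum_valK !mxE enum_rankK_in.
Qed.

Lemma pos_lower_bound (F : realFieldType) (I : finType) (P : pred I) (b : I -> F) :
  (forall i, P i -> 0 < b i) -> exists2 x, 0 < x & forall i, P i -> x <= b i.
Proof.
(* The inverse of a sum of inverses lies below each [b i]; the added 1 covers the empty family. *)
move=> b0; exists (1 + \sum_(i | P i) (b i)^-1)^-1.
  by rewrite invr_gt0 ltr_pwDl// sumr_ge0// => i /b0/ltW; rewrite invr_ge0.
move=> i Pi; rewrite -[leRHS]invrK lef_pV2 ?posrE ?invr_gt0 ?b0//; last first.
  by rewrite ltr_pwDl// sumr_ge0// => j /b0/ltW; rewrite invr_ge0.
rewrite (bigD1 i)//= addrCA ler_wpDr// addr_ge0// sumr_ge0// => j /andP[/b0/ltW].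
by rewrite invr_ge0.
Qed.

Section Forms.
Context {R : realType} {V : lmodType R} (D : V -> Prop).
Hypothesis D0 : D 0.
Hypothesis DP : forall c f g, D f -> D g -> D (c *: f + g).

(** Linearity is required on [D] only, because the integral forms are additive only where the
    integrands are integrable. *)
Definition symmetric_form_on (B : V -> V -> R) : Prop :=
  (forall c f g h, D f -> D g -> D h -> B (c *: f + g) h = c * B f h + B g h) /\
  (forall f g, D f -> D g -> B f g = B g f).

Definition lin_comb (I : finType) (c : I -> R) (e : I -> V) : V :=
  \sum_i c i *: e i.

Lemma DD f g : D f -> D g -> D (f + g).
Proof. by move=> Df Dg; rewrite -[f]scale1r; exact: DP. Qed.

Lemma DZ c f : D f -> D (c *: f).
Proof. by move=> Df; rewrite -[c *: f]addr0; exact: DP. Qed.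

Lemma D_sum (I : Type) (r : seq I) (P : pred I) (e : I -> V) :
  (forall i, P i -> D (e i)) -> D (\sum_(i <- r | P i) e i).
Proof. by move=> De; elim/big_ind : _ => //; exact: DD. Qed.

Lemma D_lin_comb (I : finType) (c : I -> R) (e : I -> V) :
  (forall i, D (e i)) -> D (lin_comb c e).
Proof. by move=> De; apply: D_sum => i _; exact: DZ. Qed.

Lemma shift_form B G sigma : symmetric_form_on B -> symmetric_form_on G ->
  symmetric_form_on (fun f g => B f g - sigma * G f g).
Proof.
move=> [B1 B2] [G1 G2]; split => [c f g h Df Dg Dh|f g Df Dg].
  by rewrite B1// G1//; ring.
by rewrite B2// G2.
Qed.

Section OneForm.
Variable B : V -> V -> R.
Hypothesis sB : symmetric_form_on B.

Lemma form0l h : D h -> B 0 h = 0.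
Proof.
move=> Dh; have := sB.1 1 0 0 h D0 D0 Dh; rewrite scaler0 addr0 mul1r.
by move/eqP; rewrite -subr_eq0 opprD addNKr oppr_eq0 => /eqP.
Qed.

Lemma formDl f g h : D f -> D g -> D h -> B (f + g) h = B f h + B g h.
Proof. by move=> Df Dg Dh; rewrite -{1}[f]scale1r sB.1// mul1r. Qed.

Lemma formZl c f h : D f -> D h -> B (c *: f) h = c * B f h.
Proof. by move=> Df Dh; rewrite -[c *: f]addr0 sB.1// form0l// addr0. Qed.

Lemma form_suml (I : Type) (r : seq I) (P : pred I) (e : I -> V) h :
  (forall i, P i -> D (e i)) -> D h ->
  B (\sum_(i <- r | P i) e i) h = \sum_(i <- r | P i) B (e i) h.
Proof.
move=> De Dh; elim: r => [|i r IH]; first by rewrite !big_nil form0l.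
rewrite !big_cons; case: ifPn => // Pi; rewrite formDl ?IH//; first exact: De.
exact: D_sum.
Qed.

Lemma form_lcl (I : finType) (c : I -> R) (e : I -> V) h :
  (forall i, D (e i)) -> D h -> B (lin_comb c e) h = \sum_i c i * B (e i) h.
Proof.
move=> De Dh; rewrite form_suml//; last by move=> i _; exact: DZ.
by apply: eq_bigr => i _; rewrite formZl.
Qed.

Lemma form_lcr (I : finType) (c : I -> R) (e : I -> V) h :
  (forall i, D (e i)) -> D h -> B h (lin_comb c e) = \sum_i c i * B h (e i).
Proof.
move=> De Dh; rewrite sB.2// ?form_lcl//; last exact: D_lin_comb.
by apply: eq_bigr => i _; rewrite sB.2.
Qed.

Lemma form_lc2 (I J : finType) (c : I -> R) (d : J -> R) (e : I -> V) (e' : J -> V) :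
  (forall i, D (e i)) -> (forall i, D (e' i)) ->
  B (lin_comb c e) (lin_comb d e') = \sum_i \sum_j c i * d j * B (e i) (e' j).
Proof.
move=> De De'; rewrite form_lcl//; last exact: D_lin_comb.
apply: eq_bigr => i _; rewrite form_lcr// mulr_sumr.
by apply: eq_bigr => j _; rewrite mulrA.
Qed.

Lemma form_lc_diag (I : finType) (c : I -> R) (e : I -> V) :
  (forall i, D (e i)) -> (forall i j, i != j -> B (e i) (e j) = 0) ->
  B (lin_comb c e) (lin_comb c e) = \sum_i c i ^+ 2 * B (e i) (e i).
Proof.
move=> De ort; rewrite form_lc2//; apply: eq_bigr => i _.
rewrite (bigD1 i)//= big1 ?addr0 ?expr2// => j ji.
by rewrite ort ?mulr0// eq_sym.
Qed.

Lemma form_lc_bound (I : finType) (e : I -> V) : (forall i, D (e i)) ->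
  exists2 K, 0 < K & forall c : I -> R,
    B (lin_comb c e) (lin_comb c e) <= K * \sum_i c i ^+ 2.
Proof.
move=> De; exists (1 + \sum_i \sum_j `|B (e i) (e j)|).
  by rewrite ltr_pwDl// sumr_ge0// => i _; rewrite sumr_ge0.
move=> c; rewrite form_lc2// mulrDl mul1r ler_wpDl ?sumr_ge0// => [i _|].
  exact: sqr_ge0.
rewrite mulr_suml ler_sum// => i _; rewrite mulr_suml ler_sum// => j _.
have c2 k : c k ^+ 2 <= \sum_i c i ^+ 2.
  by rewrite (bigD1 k)//= ler_wpDr// sumr_ge0// => l _; exact: sqr_ge0.
rewrite (le_trans (ler_norm _))// normrM mulrC ler_wpM2l//.
have : `|c i * c j| <= (c i ^+ 2 + c j ^+ 2) / 2.
  rewrite ler_norml; apply/andP; split.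
    by have := sqr_ge0 (c i + c j); nra.
  by have := sqr_ge0 (c i - c j); nra.
by have := c2 i; have := c2 j; lra.
Qed.

Lemma form_sqrD f g : D f -> D g ->
  B (f + g) (f + g) = B f f + B g g + 2 * B f g.
Proof.
move=> Df Dg; rewrite formDl//; last exact: DD.
rewrite !(sB.2 _ (f + g))//; try exact: DD.
by rewrite !formDl// (sB.2 g f)//; ring.
Qed.

Lemma form_sqrN f : D f -> B (- f) (- f) = B f f.
Proof.
move=> Df; rewrite -scaleN1r formZl//; last exact: DZ.
by rewrite sB.2 ?formZl//; [ring|exact: DZ].
Qed.

(** Nonnegativity at [f - g] bounds the cross term. *)
Lemma form_sqrD_le f g : (forall h, D h -> 0 <= B h h) -> D f -> D g ->
  B (f + g) (f + g) <= 2 * (B f f + B g g).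
Proof.
move=> B0 Df Dg; rewrite form_sqrD//.
have DNg : D (- g) by rewrite -scaleN1r; exact: DZ.
have := B0 _ (DD Df DNg); rewrite form_sqrD// form_sqrN//.
rewrite (sB.2 f (- g))// -scaleN1r formZl// (sB.2 g f)//.
lra.
Qed.

End OneForm.

Section Splitting.
Variables B G : V -> V -> R.
Hypotheses (sB : symmetric_form_on B) (sG : symmetric_form_on G).
Hypothesis G_ge0 : forall f, D f -> 0 <= G f f.

(** Strict positivity of [G] on nontrivial combinations makes the family independent even modulo the
    null vectors of [G], so [#|I|] is the dimension of a space on which [B] is at most [nu G]. *)
Definition nonpos_family (nu : R) (I : finType) (e : I -> V) : Prop :=
  (forall i, D (e i)) /\
  forall c : I -> R, (exists i, c i != 0) ->
    0 < G (lin_comb c e) (lin_comb c e) /\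
    B (lin_comb c e) (lin_comb c e) <= nu * G (lin_comb c e) (lin_comb c e).

(* Finite negative index and nullity of [B - sigma G], stated without any
   compactness: [nod] will collect the values at the nodes of a fine mesh. *)
Definition finite_index_at (sigma : R) : Prop :=
  exists M (nod : V -> 'rV[R]_M) (k : R),
  [/\ 0 < k, forall c f g, nod (c *: f + g) = c *: nod f + nod g,
    forall g, D g -> nod g = 0 -> k * G g g <= B g g - sigma * G g g,
    forall x, D x -> G x x = 0 -> nod x = 0 &
    forall f, D f -> exists x, [/\ D x, nod x = nod f &
      forall g, D g -> nod g = 0 -> B x g - sigma * G x g = 0]].

(** [D] is the sum of a finite-dimensional part, in which the [e i] diagonalize [B - sigma G], and
    of a space [Z] orthogonal to it for this form, on which the form is coercive. *)
Definition splitting_at (sigma : R) n (e : 'I_n -> V) (Z : V -> Prop) (k : R) : Prop :=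
  [/\ forall i, D (e i),
    forall a, G (lin_comb a e) (lin_comb a e) = 0 -> forall i, a i = 0,
    forall i j, i != j -> B (e i) (e j) - sigma * G (e i) (e j) = 0,
    Z 0 /\ forall c f g, Z f -> Z g -> Z (c *: f + g) &
    (forall g, Z g -> [/\ D g, forall i, B (e i) g - sigma * G (e i) g = 0 &
      k * G g g <= B g g - sigma * G g g]) /\
    forall f, D f -> exists a g, Z g /\ f = lin_comb a e + g].

(** [Z] is the kernel of [nod] in [D], and the [e i] come from its orthogonal complement [X]. By the
    projection hypothesis each [f] agrees at the nodes with some element of [X], so it suffices to
    diagonalize the Gram matrix of finitely many elements of [X]. *)
Lemma splitting_exists sigma : finite_index_at sigma ->
  exists n (e : 'I_n -> V) Z k, 0 < k /\ splitting_at sigma e Z k.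
Proof.
move=> [M [nod [k [k0 nodP coer Gnull proj]]]].
have sBs := shift_form sigma sB sG.
set Bs := fun f g => _ in sBs.
have nod0 : nod 0 = 0.
  by have := nodP 1 0 0; rewrite !scale1r addr0 => /eqP; rewrite -subr_eq0 opprD addNKr oppr_eq0 => /eqP.
have nodZ c f : nod (c *: f) = c *: nod f by rewrite -[c *: f]addr0 nodP nod0 addr0.
have nodD f g : nod (f + g) = nod f + nod g by rewrite -{1}[f]scale1r nodP scale1r.
have nodL (I : finType) a (x : I -> V) : nod (lin_comb a x) = \sum_i a i *: nod (x i).
  rewrite /lin_comb (big_morph nod nodD nod0); apply: eq_bigr => i _; exact: nodZ.
pose X x := D x /\ forall g, D g -> nod g = 0 -> Bs x g = 0.
have X0 : X 0 by split => // g Dg _; rewrite (form0l sBs).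
have XP c f g : X f -> X g -> X (c *: f + g).
  move=> [Df Xf] [Dg Xg]; split; first exact: DP.
  by move=> h Dh h0; rewrite sBs.1// Xf// Xg// mulr0 addr0.
have XL (I : finType) a (x : I -> V) : (forall i, X (x i)) -> X (lin_comb a x).
  move=> Xx; rewrite /lin_comb; elim/big_ind : _ => // [f g Xf Xg|i _].
    by rewrite -[f]scale1r; exact: XP.
  by rewrite -[_ *: _]addr0; exact: XP.
pose Q m (x : 'I_m -> V) := (forall i, X (x i)) /\
  forall a : 'I_m -> R, \sum_i a i *: nod (x i) = 0 -> forall i, a i = 0.
have exQ : exists m, `[< exists x : 'I_m -> V, Q m x >].
  exists 0%N; apply/asboolP; exists (fun _ => 0); split => [[]//|a _ []//].
have ubQ m : `[< exists x : 'I_m -> V, Q m x >] -> (m <= M)%N.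
  move=> /asboolP[x [Xx indx]]; rewrite leqNgt; apply/negP => Mm.
  have [|c [i ci] c0] := @exists_lin_relation R 'I_m 'I_M (fun i j => nod (x i) 0 j) predT.
    by rewrite -[#|_|]/(#|'I_M|) !card_ord.
  suff : c i = 0 by move/eqP; rewrite (negbTE ci).
  apply: indx; apply/rowP => j; rewrite summxE [RHS]mxE -[RHS](c0 j)//.
  by apply: eq_bigr => l _; rewrite mxE.
(* A family in [X] of maximal size with independent nodal values; its size is bounded by the number
   [M] of nodal coordinates. *)
case: (ex_maxnP exQ ubQ) => m /asboolP[x [Xx indx]] maxm.
have Dx i : D (x i) by have [] := Xx i.
have spanx f : X f -> exists a, nod f = nod (lin_comb a x).
  move=> Xf; apply/not_existsP => nf.
  have : (m.+1 <= m)%N; last by rewrite ltnn.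
  apply: maxm; apply/asboolP.
  exists (fun i : 'I_m.+1 => oapp x f (insub (val i))); split.
    by move=> i; case: insub.
  move=> a; rewrite big_ord_recr /= insubF ?ltnn//=.
  under eq_bigr do rewrite valK /=.
  have [am0 |am] := eqVneq (a ord_max) 0.
    rewrite am0 scale0r addr0 => /indx a0 i.
    have [im|im] := ltnP i m.
      by have := a0 (Ordinal im); congr (a _ = 0); exact/val_inj.
    have -> : i = ord_max by apply/val_inj/eqP; rewrite /= eqn_leq im -ltnS ltn_ord.
    exact: am0.
  move=> /eqP; rewrite addr_eq0 => /eqP E.
  exfalso; apply: (nf (fun i => - (a ord_max)^-1 * a (widen_ord (leqnSn m) i))).
  rewrite nodL; under eq_bigr do rewrite -scalerA.
  rewrite -scaler_sumr E scalerN scaleNr opprK scalerA mulVf ?scale1r//.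
pose S : 'M[R]_m := \matrix_(i, j) Bs (x i) (x j).
have Ssym : S^T = S by apply/matrixP => i j; rewrite !mxE sBs.2.
have [P UP /is_diag_mxP Pdiag] := symmetric_mx_diag Ssym.
pose e i := lin_comb (P i) x.
have Xe i : X (e i) by exact: XL.
have De i : D (e i) by have [] := Xe i.
have eE a : lin_comb a e = lin_comb (fun j => \sum_i a i * P i j) x.
  rewrite /lin_comb; under eq_bigr do rewrite scaler_sumr.
  rewrite exchange_big; apply: eq_bigr => j _; rewrite scaler_suml.
  by apply: eq_bigr => i _; rewrite scalerA.
have Bse i j : Bs (e i) (e j) = (P *m S *m P^T) i j.
  rewrite /e (form_lc2 sBs)// mxE exchange_big; apply: eq_bigr => l _.
  rewrite mxE mulr_suml; apply: eq_bigr => l' _; rewrite !mxE; ring.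
exists m, e, (fun g => D g /\ nod g = 0), k; split => //; split => //.
- move=> a Ga.
  have := Gnull _ (D_lin_comb _ De) Ga; rewrite eE nodL => /indx aP.
  have : (\row_i a i) *m P = 0 by apply/rowP => j; rewrite !mxE -[RHS](aP j); apply: eq_bigr => i
    _; rewrite mxE.
  move=> /(congr1 (mulmx^~ (invmx P))); rewrite mul0mx mulmxK// => /rowP + i => /(_ i).
  by rewrite !mxE.
- by move=> i j ij; rewrite -[LHS]/(Bs (e i) (e j)) Bse Pdiag.
- by split=> // c f g [Df f0] [Dg g0]; split; [exact: DP|rewrite nodP f0 g0 scaler0 addr0].
- split=> [g [Dg g0]|f Df].
    by split => // [i|]; [have [_] := Xe i; apply|exact: coer].
  have [y [Dy ny yort]] := proj f Df.
  have [a ya] := spanx y (conj Dy yort).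
  pose a' i := \sum_j a j * invmx P j i.
  have aE : lin_comb a' e = lin_comb a x.
    rewrite eE; apply: eq_bigr => j _; congr (_ *: _).
    rewrite /a'; under eq_bigr do rewrite mulr_suml.
    rewrite exchange_big /=.
    under eq_bigr => l _ do under eq_bigr => l' _ do rewrite -mulrA.
    under eq_bigr => l _ do rewrite -mulr_sumr.
    have E l : \sum_i invmx P l i * P i j = (l == j)%:R.
      by have /matrixP/(_ l j) := mulVmx UP; rewrite !mxE.
    under eq_bigr do rewrite E.
    by rewrite (bigD1 j)//= eqxx mulr1 big1 ?addr0// => l /negbTE ->; rewrite mulr0.
  exists a', (f - lin_comb a' e).
  have Dg : D (f - lin_comb a' e).
    by rewrite -scaleN1r addrC; apply: DP => //; exact: D_lin_comb.
  have ng : nod (f - lin_comb a' e) = 0.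
    by rewrite addrC -scaleN1r nodP scaleN1r aE -ya ny addNr.
  by split=> //; rewrite addrC subrK.
Qed.

Lemma lin_comb_lin_comb (I J : finType) (d : I -> R) (a : I -> J -> R) (e : J -> V)
    (g : I -> V) :
  lin_comb d (fun i => lin_comb (a i) e + g i) =
  lin_comb (fun j => \sum_i d i * a i j) e + lin_comb d g.
Proof.
rewrite /lin_comb; under eq_bigr do rewrite scalerDr scaler_sumr.
rewrite big_split /= exchange_big; congr (_ + _); apply: eq_bigr => j _.
by rewrite scaler_suml; apply: eq_bigr => i _; rewrite scalerA.
Qed.

Lemma lin_comb_sub (I : finType) (P : pred I) (c : {i | P i} -> R) (e : I -> V) :
  lin_comb c (fun i => e (val i)) = lin_comb (fun i => oapp c 0 (insub i)) e.
Proof.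
rewrite /lin_comb [RHS](bigID P)/= [X in _ = _ + X]big1 ?addr0; last first.
  by move=> i Pi; rewrite insubN//= scale0r.
rewrite (reindex_omap (val : {i | P i} -> I) insub); last first.
  by move=> i Pi; rewrite insubT.
apply: eq_big => [i|i _]; first by rewrite valK eqxx andbT (valP i).
by rewrite valK.
Qed.

Section AtSplitting.
Variables (sigma : R) (n : nat) (e : 'I_n -> V) (Z : V -> Prop) (k : R).
Hypotheses (k0 : 0 < k) (spl : splitting_at sigma e Z k).

Let Bs f g := B f g - sigma * G f g.
Let sBs : symmetric_form_on Bs := shift_form sigma sB sG.
Let b i := Bs (e i) (e i).

(* The span of the [e i] with [b i > 0] together with [Z] is a
   complement on which [Bs] is coercive, so it meets no nonpositive family. *)
Lemma nonpos_family_right : exists2 d, 0 < d &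
  forall nu (I : finType) (f : I -> V), nu < sigma + d -> nonpos_family nu f ->
    (#|I| <= #|[pred i | (b i <= 0)%R]|)%N.
Proof.
have [De ind ort [Z0 ZP] [Zg dec]] := spl.
have ZL (I : finType) (c : I -> R) g : (forall i, Z (g i)) -> Z (lin_comb c g).
  move=> Zgi; rewrite /lin_comb; elim/big_ind : _ => // [u v Zu Zv|i _].
    by rewrite -[u]scale1r; exact: ZP.
  by rewrite -[_ *: _]addr0; exact: ZP.
have [be be0 beP] := @pos_lower_bound R 'I_n (fun i => 0 < b i) b (fun _ => id).
have [K K0 KP] := form_lc_bound sG De.
have [d d0 [d1 d2]] : exists2 d, 0 < d & 2 * K * d <= be /\ 2 * d <= k.
  (* With this [d], [d * G (x + g') (x + g')] is at most twice [d * (G x x + G g' g')], which is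
     dominated by the lower bounds [be] on the positive directions and [k] on [Z]. *)
  exists (Num.min (be / (2 * K)) (k / 2)).
    by rewrite lt_min !divr_gt0// mulr_gt0.
  split; last by rewrite mulrC -ler_pdivlMr// ge_min lexx orbT.
  by rewrite mulrC -ler_pdivlMr ?mulr_gt0// ge_min lexx.
exists d => // nu I f nusig [Df fnp]; rewrite leqNgt; apply/negP => card.
have /choice[a /choice[g fag]] := fun i => dec (f i) (Df i).
(* There are more members than nonpositive directions, so some nontrivial combination has no
   component along the latter. *)
have [c c0 cP] := @exists_lin_relation R I 'I_n a [pred i | b i <= 0] card.
have [Gpos Ble] := fnp c c0.
have fE : lin_comb c f = lin_comb (fun j => \sum_i c i * a i j) e + lin_comb c g.
  by rewrite -lin_comb_lin_comb; apply: eq_bigr => i _; have [_ <-] := fag i.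
have /Zg[Dg' eg coer] : Z (lin_comb c g) by apply: ZL => i; have [] := fag i.
set al := fun j => _ in fE; set x := lin_comb al e in fE; set g' := lin_comb c g in fE Dg' eg coer.
have Dx : D x by exact: D_lin_comb.
have Bxg : Bs x g' = 0.
  by rewrite /x (form_lcl sBs)// big1// => i _; rewrite /Bs eg mulr0.
have Bxx : be * (\sum_i al i ^+ 2) <= Bs x x.
  rewrite /x (form_lc_diag sBs)// mulr_sumr; apply: ler_sum => i _.
  have [bi|bi] := leP (b i) 0.
    by rewrite /al cP// expr0n /= mulr0 mul0r.
  by rewrite mulrC ler_wpM2l ?sqr_ge0// beP.
have Gxg : G (x + g') (x + g') <= 2 * (G x x + G g' g') by exact: form_sqrD_le.
have Bxg' : Bs (x + g') (x + g') = Bs x x + Bs g' g'.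
  by rewrite (form_sqrD sBs)// Bxg mulr0 addr0.
rewrite fE in Gpos Ble.
have S0 : 0 <= \sum_i al i ^+ 2 by rewrite sumr_ge0// => i _; exact: sqr_ge0.
have GK := KP al; rewrite -/x in GK.
have Gg0 := G_ge0 Dg'; have Gx0 := G_ge0 Dx.
move: Bxg' coer Bxx; rewrite /Bs -/g' => Bxg' coer Bxx.
move: (\sum_i al i ^+ 2) S0 GK Bxx => S S0 GK Bxx.
move: (G _ _) (B _ _) Gpos Ble Gxg Bxg' => P Q Gpos Ble Gxg Bxg'.
have h1 : d * P <= d * (2 * (G x x + G g' g')) by rewrite ler_pM2l.
have h2 : d * (2 * G x x) <= d * (2 * (K * S)) by rewrite !ler_pM2l.
have h3 : 2 * K * d * S <= be * S by rewrite ler_wpM2r.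
have h4 : 2 * d * G g' g' <= k * G g' g' by rewrite ler_wpM2r.
have h5 : (nu - sigma) * P < d * P by rewrite ltr_pM2r// ltrBlDl.
lra.
Qed.

(** On the negative directions the shifted form is at most [- be] times the sum of squares of the
    coefficients, while [G] is at most [K] times that sum: the inequality has room to lower [sigma]
    by [be / K]. *)
Lemma nonpos_family_left : exists2 d, 0 < d &
  forall nu, sigma - d < nu ->
    nonpos_family nu (fun i : {i | b i < 0} => e (val i)).
Proof.
have [De ind ort _ _] := spl.
have [be be0 beP] := @pos_lower_bound R {i | b i < 0} predT
  (fun i => - b (val i)) (fun i _ => ltac:(by rewrite oppr_gt0; exact: (valP i))).
pose e' (i : {i | b i < 0}) := e (val i).
have De' i : D (e' i) by exact: De.
have [K K0 KP] := form_lc_bound sG De'.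
exists (be / K); first by rewrite divr_gt0.
move=> nu nusig; split => // c [i0 ci0].
have S0 : 0 <= \sum_i c i ^+ 2 by rewrite sumr_ge0// => i _; exact: sqr_ge0.
have Bcc : Bs (lin_comb c e') (lin_comb c e') <= - be * \sum_i c i ^+ 2.
  rewrite (form_lc_diag sBs)//; last by move=> i j ij; exact: ort.
  rewrite mulr_sumr; apply: ler_sum => i _.
  by rewrite mulrC ler_wpM2r ?sqr_ge0// lerNr; exact: beP.
have GK := KP c.
have G0 : 0 < G (lin_comb c e') (lin_comb c e').
  rewrite lt_neqAle G_ge0 ?andbT; last exact: D_lin_comb.
  apply/eqP => /esym G0.
  rewrite lin_comb_sub in G0; have /(_ (val i0)) := ind _ G0.
  by rewrite valK /= => /eqP; rewrite (negbTE ci0).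
split; first exact: G0.
rewrite -/e'; move: Bcc GK G0; rewrite /Bs.
move: (lin_comb c e') (\sum_i _) S0 => x S S0 Bcc GK Gx0.
have h1 : be * G x x <= be * (K * S) by rewrite ler_pM2l.
have h2 : (sigma - be / K) * G x x <= nu * G x x by rewrite ler_wpM2r// ltW.
have h3 : (be / K) * G x x <= be * S.
  by rewrite mulrAC ler_pdivrMr//; lra.
lra.
Qed.

(** Such an [e i] is orthogonal to all [e j], itself included, and to [Z]; together these span
    [D]. *)
Lemma splitting_null i : b i = 0 -> forall f, D f -> Bs (e i) f = 0.
Proof.
have [De ind ort _ [Zg dec]] := spl.
move=> bi f /dec[a [g [Zg' ->]]].
have [Dg eg _] := Zg _ Zg'.
have [B2 B1] := sBs.
rewrite B1//; last by apply: DD => //; exact: D_lin_comb.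
rewrite (formDl sBs) ?(form_lcl sBs)//; last exact: D_lin_comb.
rewrite [X in _ + X]B1// [X in _ + X]eg addr0 big1// => j _.
have [->|ji] := eqVneq j i; first by rewrite [X in _ * X]bi mulr0.
by rewrite [X in _ * X]ort ?mulr0.
Qed.

End AtSplitting.

Lemma nonpos_family_eigenvalue (lam : nat -> R) :
  {homo lam : m n / (m <= n)%N >-> m <= n} ->
  (exists C, forall f, D f -> - C * G f f <= B f f) ->
  (forall sigma, finite_index_at sigma) ->
  (forall sigma n (e : 'I_n -> V), (forall i, D (e i)) ->
    (forall i f, D f -> B (e i) f - sigma * G (e i) f = 0) ->
    (forall a, G (lin_comb a e) (lin_comb a e) = 0 -> forall i, a i = 0) ->
    exists ks : seq nat, [/\ uniq ks, forall k, k \in ks -> lam k = sigma &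
      (n <= 2 * size ks)%N]) ->
  forall m nu (I : finType) (e : I -> V), nonpos_family nu e ->
    (2 * m < #|I|)%N -> lam m <= nu.
Proof.
move=> lam_nd [C lowB] fin mult m.
elim/ltn_ind: m => m IH nu I e np mI; rewrite leNgt; apply/negP => nulam.
pose S := [set nu' | exists (I' : finType) (e' : I' -> V),
  (2 * m < #|I'|)%N /\ nonpos_family nu' e'].
have lbS : lbound S (- C).
  move=> nu' [I' [e' [mI' [De' np']]]].
  have /card_gt0P[i0 _] : (0 < #|I'|)%N by exact: leq_ltn_trans mI'.
  have [|G0] := np' (fun=> 1); first by exists i0; exact: oner_neq0.
  move=> /(le_trans (lowB _ (D_lin_comb _ De'))).
  by rewrite ler_pM2r.
have Snu : S nu by exists I, e.
have infS : has_inf S by split; [exists nu | exists (- C)].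
have sig_nu : inf S <= nu by apply: ge_inf => //; exists (- C).
move: (inf S) (@ge_inf _ S) (fun d => @inf_adherent _ S d) sig_nu => sigma geS adhS sig_nu.
have [n [e1 [Z [k [k0 spl]]]]] := splitting_exists (fin sigma).
have [d d0 right] := nonpos_family_right k0 spl.
have [d' d'0 left] := nonpos_family_left spl.
set b := fun i => B (e1 i) (e1 i) - sigma * G (e1 i) (e1 i) in right left.
have [nu1 [I1 [e2 [mI1 np1]]] nu1d] := adhS _ d0 infS.
have := leq_trans mI1 (right _ _ _ nu1d np1).
pose J0 := [pred i | b i == 0].
have -> : #|[pred i | (b i <= 0)%R]| = (#|{: {i | (b i < 0)%R}}| + #|J0|)%N.
  rewrite card_sig -cardUI [X in (_ + X)%N]eq_card0 ?addn0; last first.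
    by move=> i; rewrite !inE; case: ltgtP.
  by apply: eq_card => i; rewrite !inE le_eqVlt orbC.
have [De1 ind _ _ _] := spl.
have [||a|ks [uks ksE nks]] := mult sigma #|J0| (fun i => e1 (enum_val i)).
- by move=> i; exact: De1.
- by move=> i f Df; apply: (splitting_null spl) => //; apply/eqP; exact: (enum_valP i).
- pose c i := \sum_(j < #|J0| | enum_val j == i) a j.
  have -> : lin_comb a (fun i => e1 (enum_val i)) = lin_comb c e1.
    rewrite /lin_comb /c; under [RHS]eq_bigr do rewrite scaler_suml.
    rewrite (exchange_big_dep predT)//=; apply: eq_bigr => j _.
    by rewrite (big_pred1 (enum_val j)).
  move=> /ind c0 i; have := c0 (enum_val i); rewrite /c (big_pred1 i)// => j.
  by apply/eqP/eqP => [/enum_val_inj|->].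
(* Let [j] be the least index with [sigma <= lam j]. The indices at which [lam] equals [sigma] lie
   between [j] and [m - 1], so the kernel has dimension at most [2 (m - j)] and more than [2 j]
   negative directions remain. These persist slightly below [sigma]: for [j = m] this contradicts
   the infimum, and for [j < m] the induction hypothesis yields [lam j < sigma]. *)
have exj : exists j, sigma <= lam j by exists m; rewrite (le_trans sig_nu)// ltW.
case: (ex_minnP exj) => j sj jmin.
have jm : (j <= m)%N by apply: jmin; rewrite (le_trans sig_nu)// ltW.
have : (size ks <= m - j)%N.
  rewrite -[leqRHS](size_iota j); apply: uniq_leq_size => // l lks.
  rewrite mem_iota subnKC// jmin ?ksE//=.
  rewrite ltnNge; apply/negP => /lam_nd.
  by rewrite (ksE l lks) leNgt (le_lt_trans sig_nu).
move=> ksmj card.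
have jI : (2 * j < #|{: {i | (b i < 0)%R}}|)%N by lia.
have npl : nonpos_family (sigma - d' / 2) (fun i : {i | b i < 0} => e1 (val i)).
  by apply: left; rewrite ltrD2l ltrN2 ltr_pdivrMr// ltr_pMr// ltr1n.
have sd : sigma - d' / 2 < sigma by rewrite ltrBlDr ltrDl divr_gt0.
move: jm; rewrite leq_eqVlt => /orP[/eqP jmE|jm].
  have := geS (ex_intro _ (- C) lbS) (sigma - d' / 2).
  rewrite leNgt sd => /(_ _)/negP; apply => //.
  by exists {i | b i < 0}, (fun i => e1 (val i)); rewrite -jmE.
by have := IH j jm _ _ _ npl jI; rewrite leNgt (lt_le_trans sd sj).
Qed.

End Splitting.
End Forms.

(** * Absolutely continuous functions as primitives *)

Section AbsolutelyContinuous.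
Context {R : realType}.
Implicit Types (a b : R) (f : R -> R) (s : seq (R * R)).

Definition nonoverlapping (x y : R * R) := (x.2 <= y.1) || (y.2 <= x.1).

(** Sequences rather than indexed families, because intervals get replaced by partitions of
    themselves; see [subintervals_steps]. *)
Definition subintervals a b s :=
  all (fun x => [&& a <= x.1, x.1 <= x.2 & x.2 <= b]) s && pairwise nonoverlapping s.

Lemma abs_continuous_seq a b f : abs_continuous a b f ->
  forall e, 0 < e -> exists2 d, 0 < d & forall s, subintervals a b s ->
    \sum_(x <- s) (x.2 - x.1) < d -> \sum_(x <- s) `|f x.2 - f x.1| < e.
Proof.
move=> acf e /acf[d d0 df]; exists d => // s /andP[/allP sab pw] sd.
have := df (size s) (fun i => (nth (0, 0) s i).1) (fun i => (nth (0, 0) s i).2).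
rewrite (big_nth (0, 0)) big_mkord in sd; rewrite (big_nth (0, 0)) big_mkord.
apply => //.
- by move=> i; have /and3P[] := sab _ (mem_nth (0, 0) (ltn_ord i)).
- have H (i j : 'I_(size s)) : (i < j)%N ->
      `](nth (0, 0) s i).1, (nth (0, 0) s i).2[ `&`
      `](nth (0, 0) s j).1, (nth (0, 0) s j).2[ = set0 :> set R.
    move=> ij; have /pairwiseP/(_ i j (ltn_ord i) (ltn_ord j) ij) := pw.
    move/(_ (0, 0)) => no.
    rewrite -subset0 => x []/=; rewrite !in_itv/= => /andP[ix xi] /andP[jx xj].
    by case/orP: no => h; lra.
  move=> i j _ _ ne; apply/val_inj; case: (ltngtP i j) => // ij; exfalso.
    by case: ne => x; rewrite H.
  by case: ne => x; rewrite setIC H.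
Qed.

Fixpoint steps a (l : seq R) :=
  if l is x :: l' then (a, x) :: steps x l' else [::].

Lemma stepsP a l : path <%O a l ->
  all (fun x => [&& a <= x.1, x.1 <= x.2 & x.2 <= last a l]) (steps a l) /\
  pairwise nonoverlapping (steps a l).
Proof.
elim: l a => //= x l IH a /andP[ax xl].
have [/allP h1 h2] := IH x xl.
have lx : x <= last x l.
  elim: l x xl {IH h1 h2 ax} => //= y l IH x /andP[xy /IH]; apply: le_trans.
  exact: ltW.
rewrite lexx (ltW ax) lx h2 !andbT /=; split; apply/allP => y /h1 /and3P[xy yy yl].
  by rewrite yy yl (le_trans _ xy)// ltW.
by rewrite /nonoverlapping /= xy.
Qed.

Lemma sum_steps a l : \sum_(x <- steps a l) (x.2 - x.1) = last a l - a.
Proof.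
elim: l a => [|x l IH] a /=; first by rewrite big_nil subrr.
by rewrite big_cons IH /=; ring.
Qed.

Lemma variation_steps a b f l : itv_partition a b l ->
  variation a b f l = \sum_(x <- steps a l) `|f x.2 - f x.1|.
Proof.
move=> /variation_zip ->; elim: l a => [|x l IH] a /=; first by rewrite !big_nil.
by rewrite !big_cons IH.
Qed.

Lemma subintervals_steps a b s t c d l : itv_partition c d l ->
  subintervals a b (s ++ (c, d) :: t) -> subintervals a b (s ++ steps c l ++ t).
Proof.
move=> [pl /eqP ld]; have [/allP h1 h2] := stepsP pl; rewrite ld in h1.
rewrite /subintervals !all_cat !pairwise_cat /= allrel_consr allrel_catr.
move=> /andP[/and3P[-> /and3P[ac cd db] ->]].
move=> /and4P[/andP[sc ->] -> ct ->]; rewrite h2 !andbT /=.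
apply/and3P; split.
- by apply/allP => x /h1 /and3P[cx -> xd]; rewrite (le_trans ac)//= (le_trans xd).
- apply/allrelP => x y xs /h1/and3P[cy _ yd].
  move/allP : sc => /(_ x xs); rewrite /nonoverlapping /= => /orP[xc|dx].
    by rewrite (le_trans xc).
  by rewrite (le_trans yd)// orbT.
- apply/allrelP => y x /h1/and3P[cy _ yd] xs.
  move/allP : ct => /(_ x xs); rewrite /nonoverlapping /= => /orP[xc|dx].
    by rewrite (le_trans yd).
  by rewrite (le_trans dx)// orbT.
Qed.

(** Replacing an interval by a partition of it keeps the total length, so the same [d] works for all
    refinements, and the total variations are suprema over these. The strict inequality becomes a
    large one in the supremum. *)
Lemma abs_continuous_total_variation a b f : abs_continuous a b f ->
  forall e, 0 < e -> exists2 d, 0 < d & forall s, subintervals a b s ->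
    \sum_(x <- s) (x.2 - x.1) < d ->
    (\sum_(x <- s) total_variation x.1 x.2 f <= e%:E)%E.
Proof.
move=> acf e /(abs_continuous_seq acf)[d d0 df]; exists d => // s.
(* [t] holds the intervals already refined, counted by their increments; the induction moves
   intervals from [s] to [t]. *)
suff H t : subintervals a b (t ++ s) -> \sum_(x <- t ++ s) (x.2 - x.1) < d ->
    ((\sum_(x <- t) `|f x.2 - f x.1|)%:E +
     \sum_(x <- s) total_variation x.1 x.2 f <= e%:E)%E.
  by move=> ? ?; have := H [::]; rewrite big_nil add0e; apply.
elim: s t => [|[u v] s IH] t.
  by rewrite cats0 big_nil adde0 => /df h /h; rewrite lee_fin => /ltW.
move=> tuv; rewrite big_cat big_cons /= => td.
have [/allP ab _] := andP tuv.
have /and3P[/= au uv vb] := ab (u, v) (ltac:(by rewrite mem_cat inE eqxx orbT)).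
have key l : itv_partition u v l ->
    ((\sum_(x <- t) `|f x.2 - f x.1|)%:E + ((variation u v f l)%:E +
     \sum_(x <- s) total_variation x.1 x.2 f) <= e%:E)%E.
  move=> uvl; rewrite (variation_steps f uvl) addeA -EFinD -big_cat; apply: IH.
    by rewrite -catA; exact: subintervals_steps tuv.
  have [_ /eqP lv] := uvl.
  by rewrite !big_cat /= sum_steps lv -addrA.
rewrite big_cons /=.
have c0 : (0 <= \sum_(x <- s) total_variation x.1 x.2 f)%E.
  rewrite big_seq; apply: sume_ge0 => x xs; apply: total_variation_ge0.
  by have /and3P[] := ab x (ltac:(by rewrite mem_cat inE xs !orbT)).
set T := (\sum_(x <- s) _)%E in c0 key *.
(* Finiteness is needed to move [T] across the inequality before taking the supremum over partitions
   of [[u, v]]. *)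
have cfin : T \is a fin_num.
  rewrite ge0_fin_numE//.
  have [l uvl] : exists l, itv_partition u v l.
    move: uv; rewrite le_eqVlt => /orP[/eqP ->|uv].
      by exists [::]; split => //=.
    by exists [:: v]; exact: itv_partition1.
  have := key l uvl; rewrite addeA -EFinD.
  by clearbody T; case: T c0 {key} => [r| |] //=; rewrite ltry.
have -> : ((\sum_(x <- t) `|f x.2 - f x.1|)%:E + (total_variation u v f + T) =
   total_variation u v f + ((\sum_(x <- t) `|f x.2 - f x.1|)%:E + T))%E.
  by rewrite addeCA.
have rfin : ((\sum_(x <- t) `|f x.2 - f x.1|)%:E + T)%E \is a fin_num.
  by rewrite fin_numD cfin.
rewrite -leeBrDr//; apply: ge_ereal_sup => _ [_ [l uvl <-] <-].
by rewrite leeBrDr// addeCA; exact: key.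
Qed.

End AbsolutelyContinuous.

(** * Stieltjes measures of absolutely continuous monotone functions *)

Section MonotoneAC.
Context {R : realType}.
Implicit Types (a b : R) (f : R -> R) (s : seq (R * R)).
Notation mu := (@lebesgue_measure R).

Definition seq_abs_continuous a b f := forall e, 0 < e -> exists2 d, 0 < d &
  forall s, subintervals a b s -> \sum_(x <- s) (x.2 - x.1) < d ->
    \sum_(x <- s) `|f x.2 - f x.1| < e.

(** Composition with [clamp] extends a function on [[a, b]] to the whole line by constants, as
    required by the measure-theoretic constructions. *)
Definition clamp a b x := Num.max a (Num.min b x).

Lemma clamp_itv a b x : a <= b -> a <= clamp a b x <= b.
Proof. by move=> ab; rewrite le_max lexx ge_max ab ge_min lexx. Qed.

Lemma clamp_id a b x : a <= x <= b -> clamp a b x = x.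
Proof. by move=> /andP[ax xb]; rewrite /clamp (min_idPr xb) (max_idPr ax). Qed.

Lemma clamp_le a b x y : x <= y -> clamp a b x <= clamp a b y.
Proof.
move=> xy; rewrite /clamp /Num.max /Num.min.
case: (ltP b y) => h1; case: (ltP b x) => h2; repeat (case: ltP => ?); lra.
Qed.

Lemma clamp_dist a b x y : x <= y -> clamp a b y - clamp a b x <= y - x.
Proof.
move=> xy; rewrite /clamp /Num.max /Num.min.
case: (ltP b y) => h1; case: (ltP b x) => h2; repeat (case: ltP => ?); lra.
Qed.

Lemma seq_abs_continuous_continuous a b f : a <= b -> seq_abs_continuous a b f ->
  continuous (f \o clamp a b).
Proof.
move=> ab acf x; apply/cvgrPdist_lt => e /acf[d d0 df].
have key y z : y <= z -> z - y < d -> `|f (clamp a b z) - f (clamp a b y)| < e.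
  move=> yz zy; have := df [:: (clamp a b y, clamp a b z)].
  rewrite !big_cons !big_nil /= !addr0; apply.
    rewrite /subintervals/= clamp_le//.
    by have /andP[-> _] := clamp_itv y ab; have /andP[_ ->] := clamp_itv z ab.
  exact: le_lt_trans (clamp_dist _ _ yz) _.
near=> t.
have : `|x - t| < d by near: t; apply: cvgr_dist_lt => //; exact: cvg_id.
rewrite ltr_norml => /andP[h1 h2] /=; have [tx|xt] := leP t x.
  by apply: key => //; lra.
by rewrite distrC; apply: key; lra.
Unshelve. all: by end_near. Qed.

(** A null set is covered by an open set of measure less than [d]. Absolute continuity bounds the
    increments of [F] over any finitely many of its component intervals, and countable additivity
    gives the bound for the whole cover. *)
Lemma null_seq_abs_continuous a b (F : cumulative R R) : a <= b ->
  seq_abs_continuous a b F -> forall N : set R, measurable N -> N `<=` `]a, b[ ->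
  mu N = 0%E -> lebesgue_stieltjes_measure F N = 0%E.
Proof.
move=> ab acF N mN Nab N0.
apply/eqP; rewrite eq_le measure_ge0 andbT; apply/lee_addgt0Pr => e e0; rewrite add0e.
have [d d0 df] := acF e e0.
have muN : (mu N < +oo)%E by rewrite N0 ltry.
have [U [oU NU Ud]] := lebesgue_regularity_outer mN muN d0.
pose W := U `&` `]a, b[%classic.
have oW : open W by apply: openI => //; exact: interval_open.
have muW : (mu W < d%:E)%E.
  have -> : mu W = (mu (W `\` N) + mu (W `&` N))%E by apply: measureDI => //; exact: open_measurable.
  have -> : mu (W `&` N) = 0%E.
    apply/eqP; rewrite eq_le measure_ge0 andbT -N0 le_measure ?inE//.
      by apply: measurableI => //; exact: open_measurable.
  rewrite adde0; apply: le_lt_trans Ud; rewrite le_measure ?inE//.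
  - by apply: measurableD => //; exact: open_measurable.
  - by apply: measurableD => //; exact: open_measurable.
  - by apply: setSD; exact: subIsetl.
pose I := open_disjoint_itv oW.
have WE : W = \bigcup_q I q := open_disjoint_itv_bigcup oW.
have mI q : measurable (I q) by apply: open_measurable; exact: open_disjoint_itv_open.
have tI : trivIset setT I := @open_disjoint_itv_trivIset _ _ oW.
have Iab q : I q `<=` `]a, b[.
  move=> x Ix; have : W x by rewrite WE; exists q.
  by case.
have /choice[p pP] : forall q, exists p : R * R, [/\ a <= p.1, p.1 <= p.2, p.2 <= b,
    I q `<=` `]p.1, p.2] & `]p.1, p.2[ `<=` I q] /\ (I q = set0 -> p.2 = a) /\ (I q !=set0 -> p.1 < p.2).
  move=> q; have [I0|/set0P[x0 Ix0]] := eqVneq (I q) set0.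
    (* An empty component receives a degenerate interval at [a], which overlaps no other and adds
       nothing to the sums. *)
    exists (a, a); split; last by split => // -[x]; rewrite I0.
    by split => //=; rewrite ?I0; [exact: sub0set|rewrite set_itv_ge// bnd_simp ltxx].
  have lb x : I q x -> a <= x by move=> /Iab /=; rewrite in_itv/= => /andP[/ltW].
  have ub x : I q x -> x <= b by move=> /Iab /=; rewrite in_itv/= => /andP[_ /ltW].
  have hi : has_inf (I q) by split; [exists x0|exists a => x /lb].
  have hs : has_sup (I q) by split; [exists x0|exists b => x /ub].
  have oI : open (I q) by exact: open_disjoint_itv_open.
  have nb x : I q x -> inf (I q) < x /\ x < sup (I q).
    move=> Ix; have /nbhs_ballP[r /= r0 xr] : nbhs x (I q) by apply: open_nbhs_nbhs.
    split.
    - apply: (@le_lt_trans _ _ (x - r / 2)); last by rewrite ltrBlDr ltrDl divr_gt0.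
      apply: ge_inf; [by case: hi|apply: xr]; rewrite /ball/= opprB addrC subrK gtr0_norm ?divr_gt0//.
      by rewrite ltr_pdivrMr// ltr_pMr// ltr1n.
    - apply: (@lt_le_trans _ _ (x + r / 2)); first by rewrite ltrDl divr_gt0.
      apply: ub_le_sup; [by case: hs|apply: xr]; rewrite /ball/= opprD addNKr normrN gtr0_norm ?divr_gt0//.
      by rewrite ltr_pdivrMr// ltr_pMr// ltr1n.
  have [x01 x02] := nb _ Ix0.
  exists (inf (I q), sup (I q)) => /=; split; last first.
    by split => [I0|_]; [move: Ix0; rewrite I0|exact: lt_trans x02].
  split.
  - by apply: lb_le_inf; [exists x0|move=> x /lb].
  - by apply: ltW; exact: lt_trans x02.
  - by apply: ge_sup; [exists x0|move=> x /ub].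
  - by move=> x /nb[h1 h2] /=; rewrite in_itv/= h1 ltW.
  - move=> x /=; rewrite in_itv/= => /andP[ix xs].
    have [y Iy yx] := inf_lt hi.1 ix; have [z Iz zx] := sup_gt hs.1 xs.
    have := @open_disjoint_itv_is_interval _ _ oW q y z Iy Iz x; apply.
    by rewrite !ltW.
(* Two nonempty components whose intervals overlapped would share the midpoint of the overlap. *)
have nov : subrel (fun q q' : nat => q != q') (relpre p nonoverlapping).
  move=> q q' qq' /=; have [[h1 h2 h3 h4 h5] [h6 h7]] := pP q.
  have [[g1 g2 g3 g4 g5] [g6 g7]] := pP q'.
  have [/h6 E|/set0P/h7 lt1] := eqVneq (I q) set0.
    by rewrite /nonoverlapping E g1.
  have [/g6 E|/set0P/g7 lt2] := eqVneq (I q') set0.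
    by rewrite /nonoverlapping E h1 orbT.
  apply/negPn/negP; rewrite /nonoverlapping negb_or -!ltNge => /andP[k1 k2].
  pose u := Num.max (p q).1 (p q').1; pose v := Num.min (p q).2 (p q').2.
  have uv : u < v by rewrite gt_max !lt_min lt1 lt2 k1 k2.
  have mid : I q ((u + v) / 2) /\ I q' ((u + v) / 2).
    have u1 : (p q).1 <= u by rewrite le_max lexx.
    have u2 : (p q').1 <= u by rewrite le_max lexx orbT.
    have v1 : v <= (p q).2 by rewrite ge_min lexx.
    have v2 : v <= (p q').2 by rewrite ge_min lexx orbT.
    by split; [apply: h5|apply: g5]; rewrite /= in_itv/=; apply/andP; split; lra.
  by move/eqP : qq'; apply; apply: tI => //; exists ((u + v) / 2).
have sub n : subintervals a b [seq p q | q <- iota 0 n].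
  apply/andP; split.
    by apply/allP => _ /mapP[q _ ->]; have [[-> -> ->]] := pP q.
  rewrite pairwise_map; apply: (sub_pairwise nov).
  by have := iota_uniq 0 n; rewrite uniq_pairwise.
have len n : \sum_(x <- [seq p q | q <- iota 0 n]) (x.2 - x.1) < d.
  rewrite -lte_fin; apply: le_lt_trans muW; rewrite big_map -sumEFin.
  rewrite -[X in iota 0 X](subn0 n) -/(index_iota 0 n) big_mkord.
  apply: (@le_trans _ _ (mu (\big[setU/set0]_(q < n) I q))).
    rewrite measure_bigsetU//.
    apply: lee_sum => q _.
    have [[h1 h2 h3 h4 h5] _] := pP q.
    apply: (@le_trans _ _ (mu `](p q).1, (p q).2[%classic)); last first.
      by apply: le_measure; rewrite ?inE//; exact: mI.
    rewrite lebesgue_measure_itv/= lte_fin; case: ifPn => //.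
    by rewrite -leNgt EFinB lee_fin subr_le0.
  apply: le_measure; rewrite ?inE; [by apply: bigsetU_measurable => i _; exact: mI|exact: open_measurable|].
  by rewrite WE; exact: bigsetU_bigcup.
have muF q : (lebesgue_stieltjes_measure F (I q) <= (F (p q).2 - F (p q).1)%:E)%E.
  have [[h1 h2 h3 h4 h5] _] := pP q.
  apply: (@le_trans _ _ (lebesgue_stieltjes_measure F `](p q).1, (p q).2]%classic)).
    by apply: le_measure; rewrite ?inE//; exact: mI.
  rewrite /lebesgue_stieltjes_measure/= /measure_extension measurable_mu_extE/= ?wlength_itv_bnd//.
  exact: is_ocitv.
apply: (@le_trans _ _ (lebesgue_stieltjes_measure F W)).
  apply: le_measure; rewrite ?inE//; first exact: open_measurable.
  by move=> x Nx; split; [exact: NU|exact: Nab].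
rewrite WE measure_bigcup//=; last by move=> i _; exact: mI.
apply: lime_le; first by apply: is_cvg_nneseries.
near=> n; rewrite big_mkcond /=.
apply: (@le_trans _ _ (\sum_(0 <= q < n) (F (p q).2 - F (p q).1)%:E)%E).
  by apply: lee_sum => q _; rewrite mem_setT.
rewrite sumEFin lee_fin.
have := df _ (sub n) (len n); rewrite big_map /index_iota subn0 => /ltW; apply: le_trans.
by apply: ler_sum => q _; exact: ler_norm.
Unshelve. all: by end_near. Qed.
End MonotoneAC.

(** * Densities of absolutely continuous functions *)

Section Density.
Context {R : realType}.
Implicit Types (a b : R) (f : R -> R) (s : seq (R * R)).
Notation mu := (@lebesgue_measure R).

Lemma seq_abs_continuous_clamp a b a' b' f : a <= b -> seq_abs_continuous a b f ->
  seq_abs_continuous a' b' (f \o clamp a b).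
Proof.
move=> ab acf e /acf[d d0 df]; exists d => // s /andP[/allP s1 s2] sd.
pose c (p : R * R) := (clamp a b p.1, clamp a b p.2).
have := df [seq c p | p <- s]; rewrite !big_map; apply.
  apply/andP; split.
    apply/allP => _ /mapP[p /s1 /and3P[_ p12 _] ->] /=.
    by rewrite clamp_le//; have /andP[-> _] := clamp_itv p.1 ab; have /andP[_ ->] := clamp_itv p.2 ab.
  rewrite pairwise_map; apply: sub_pairwise s2 => x y /=.
  by rewrite /nonoverlapping => /orP[/(@clamp_le _ a b)|/(@clamp_le _ a b)] h; rewrite /= h ?orbT.
apply: le_lt_trans sd; rewrite !big_seq; apply: ler_sum => p /s1 /and3P[_ p12 _] /=.
exact: clamp_dist.
Qed.

Lemma seq_abs_continuousB a b f g : seq_abs_continuous a b f ->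
  seq_abs_continuous a b g -> seq_abs_continuous a b (f \- g).
Proof.
move=> acf acg e e0.
have [d1 d10 df] := acf _ (divr_gt0 e0 (ltr0n R 2)).
have [d2 d20 dg] := acg _ (divr_gt0 e0 (ltr0n R 2)).
exists (Num.min d1 d2); first by rewrite lt_min d10.
move=> s ss; rewrite lt_min => /andP[/(df _ ss) h1 /(dg _ ss) h2].
have : \sum_(x <- s) `|(f \- g) x.2 - (f \- g) x.1| <=
    \sum_(x <- s) `|f x.2 - f x.1| + \sum_(x <- s) `|g x.2 - g x.1|.
  rewrite -big_split/=; apply: ler_sum => x _.
  have -> : (f \- g) x.2 - (f \- g) x.1 = (f x.2 - f x.1) - (g x.2 - g x.1) by rewrite /=; ring.
  exact: ler_normB.
move=> /le_lt_trans; apply; lra.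
Qed.

(** The density is the Radon-Nikodym derivative of the Stieltjes measure of the clamped function,
    restricted to []a, b]]. *)
Lemma monotone_density a b f : a <= b -> seq_abs_continuous a b f ->
  (forall x y, a <= x -> x <= y -> y <= b -> f x <= f y) ->
  exists2 h : R -> R, mu.-integrable setT (EFin \o h) &
    forall x y, a <= x -> x <= y -> y <= b -> f y - f x = \int[mu]_(t in `]x, y]) h t.
Proof.
move=> ab acf fnd.
pose F0 := f \o clamp a b.
have F0nd : nondecreasing F0.
  move=> x y xy; rewrite /F0/=.
  by apply: fnd; [have /andP[] := clamp_itv x ab|exact: clamp_le|have /andP[] := clamp_itv y ab].
have F0c : right_continuous F0.
  by apply/right_continuousW; exact: seq_abs_continuous_continuous.
pose F : cumulative R R := HB.pack F0 (isCumulative.Build _ _ _ F0 F0nd F0c).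
have muFE x y : x <= y -> lebesgue_stieltjes_measure F `]x, y]%classic = (F0 y - F0 x)%:E.
  move=> xy; rewrite /lebesgue_stieltjes_measure/= /measure_extension.
  by rewrite measurable_mu_extE/= ?wlength_itv_bnd//; exact: is_ocitv.
have mD : @measurable _ (measurableTypeR R) `]a, b]%classic by exact: measurable_itv.
have Dfin : (lebesgue_stieltjes_measure F `]a, b]%classic < +oo)%E.
  by rewrite muFE// ltry.
pose nu : {finite_measure set (measurableTypeR R) -> \bar R} := mfrestr mD Dfin.
have numu : nu `<< mu.
  move=> A A0 B mB BA.
  have B0 := A0 B mB BA.
  rewrite /nu /mfrestr/= /mrestr.
  (* The restricted measure charges sets containing [b], while the lemma concerns an open interval;
     the clamped function is absolutely continuous on the larger interval too. *)
  apply: (@null_seq_abs_continuous _ a (b + 1)).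
  - by rewrite (le_trans ab)// lerDl.
  - exact: seq_abs_continuous_clamp.
  - exact: measurableI.
  - move=> x [_] /=; rewrite !in_itv/= => /andP[-> xb].
    by rewrite (le_lt_trans xb)// ltrDl.
  - apply/eqP; rewrite eq_le measure_ge0 andbT -B0.
    apply: le_measure; rewrite ?inE; [exact: measurableI|by []|exact: subIsetl].
have [g [g0 gfin gint gE]] := radon_nikodym_sigma_finite numu.
exists (fine \o g).
  by apply: eq_integrable gint => // x _; rewrite /= fineK.
move=> x y ax xy yb.
have nuE : nu `]x, y]%classic = (f y - f x)%:E.
  rewrite -[LHS]/(lebesgue_stieltjes_measure F (`]x, y]%classic `&` `]a, b]%classic)).
  rewrite (_ : _ `&` _ = `]x, y]%classic); last first.
    apply/seteqP; split => t /=; rewrite !in_itv/=; first by case.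
    by move=> /andP[xt ty]; rewrite xt ty (le_lt_trans ax)// (le_trans ty).
  by rewrite muFE// /F0/= !clamp_id ?ax ?yb ?(le_trans ax)// ?(le_trans xy).
have := gE `]x, y]%classic (measurable_itv _).
rewrite nuE.
move=> E; rewrite /Rintegral; under eq_integral do rewrite /= fineK//.
by rewrite -E.
Qed.

Lemma abs_continuous_bounded_variation a b f : abs_continuous a b f -> a <= b ->
  bounded_variation a b f.
Proof.
move=> acf ab; apply/bounded_variationP => //.
have [d d0 df] := abs_continuous_total_variation acf ltr01.
have small x y : a <= x -> x <= y -> y <= b -> y - x < d -> (total_variation x y f <= 1%:E)%E.
  move=> ax xy yb xyd; have := df [:: (x, y)]; rewrite !big_cons !big_nil /= addr0 adde0; apply => //.
  by rewrite /subintervals/= ax xy yb.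
(* A grid of step [d / 2], stopped at [b]: the variation is at most 1 on each cell. *)
pose c (k : nat) := Num.min b (a + k%:R * (d / 2)).
have ac k : a <= c k by rewrite le_min ab lerDl mulr_ge0// divr_ge0// ltW.
have cb k : c k <= b by rewrite ge_min lexx.
have cc k : c k <= c k.+1 by rewrite le_min cb /= ge_min lerD2l ler_wpM2r ?orbT ?ler_nat// divr_ge0// ltW.
have TVk k : (total_variation a (c k) f <= (k%:R)%:E)%E.
  elim: k => [|k IH].
    by rewrite /c mul0r addr0 (min_idPr ab) total_variationxx.
  rewrite (total_variationD f (ac k) (cc k)) -natr1 EFinD; apply: leeD => //.
  apply: small; [exact: ac|exact: cc|exact: cb|].
  have d2 : d / 2 < d by rewrite ltr_pdivrMr// ltr_pMr// ltr1n.
  rewrite /c -natr1 mulrDl mul1r addrA.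
  by rewrite /Order.min; case: (ltP b _) => h1; case: (ltP b _) => h2; lra.
have [k bk] : exists k : nat, b <= a + k%:R * (d / 2).
  exists (Num.bound ((b - a) / (d / 2))).
  rewrite -lerBlDl -ler_pdivrMr ?divr_gt0// ltW//.
  by apply: archi_boundP; rewrite divr_ge0 ?subr_ge0// divr_ge0// ltW.
have := TVk k; rewrite /c (min_idPl bk) => h.
by rewrite ge0_fin_numE ?total_variation_ge0// (le_lt_trans h)// ltry.
Qed.

(** Jordan decomposition: [f = g - (g - f)] with [g] the total variation from [a]. Both terms are
    nondecreasing and absolutely continuous. *)
Lemma abs_continuous_density a b f : a <= b -> abs_continuous a b f ->
  exists2 h : R -> R, mu.-integrable setT (EFin \o h) &
    forall x y, a <= x -> x <= y -> y <= b -> f y - f x = \int[mu]_(t in `]x, y]) h t.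
Proof.
move=> ab acf.
have bv := abs_continuous_bounded_variation acf ab.
pose g x := fine (total_variation a x f).
have TVfin x : a <= x -> x <= b -> total_variation a x f \is a fin_num.
  by move=> ax xb; apply/bounded_variationP => //; exact: bounded_variationl xb bv.
have gD x y : a <= x -> x <= y -> y <= b -> (g y - g x)%:E = total_variation x y f.
  move=> ax xy yb.
  have ay := le_trans ax xy; have xb := le_trans xy yb.
  have := total_variationD f ax xy; rewrite EFinB /g !fineK ?TVfin// => ->.
  by rewrite addeAC subee ?add0e// TVfin.
have gac : seq_abs_continuous a b g.
  move=> e e0; have [d d0 df] := abs_continuous_total_variation acf (divr_gt0 e0 (ltr0n R 2)).
  exists d => // s ss sd; have := df s ss sd.
  have /andP[/allP s1 _] := ss.
  have -> : (\sum_(x <- s) total_variation x.1 x.2 f)%E = (\sum_(x <- s) `|g x.2 - g x.1|)%:E.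
    rewrite -sumEFin !big_seq; apply: eq_bigr => x /s1 /and3P[ax xy yb].
    by rewrite ger0_norm ?gD// -lee_fin gD// total_variation_ge0.
  by rewrite lee_fin => /le_lt_trans; apply; rewrite ltr_pdivrMr// ltr_pMr// ltr1n.
have fac := abs_continuous_seq acf.
have [h1 h1i h1E] := monotone_density ab gac (fun x y ax xy yb =>
  ltac:(by rewrite -subr_ge0 -lee_fin gD// total_variation_ge0)).
have gfac := seq_abs_continuousB gac fac.
have [|h2 h2i h2E] := monotone_density ab gfac.
  move=> x y ax xy yb /=; rewrite lerBrDr addrAC -lerBrDr.
  have := total_variation_ge f xy; rewrite -gD// lee_fin => /(le_trans (ler_norm _)).
  lra.
exists (h1 \- h2).
  have := integrableB measurableT h1i h2i; apply: eq_integrable => //.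
move=> x y ax xy yb; rewrite RintegralB//.
- by rewrite -h1E// -h2E//=; ring.
- exact: integrableS h1i.
- exact: integrableS h2i.
Qed.
End Density.

(** * Integrals over half-open intervals and primitives *)

Section Integrals.
Context {R : realType}.
Implicit Types (a b x y z : R) (f g h k u v : R -> R).
Notation mu := (@lebesgue_measure R).

Lemma aeS (P Q : R -> Prop) : (forall x, P x -> Q x) ->
  {ae mu, forall x, P x} -> {ae mu, forall x, Q x}.
Proof.
by move=> PQ; apply: filterS => //; exact: (ae_filter_ringOfSetsType mu).
Qed.

Lemma aeS2 (P Q S : R -> Prop) : (forall x, P x -> Q x -> S x) ->
  {ae mu, forall x, P x} -> {ae mu, forall x, Q x} -> {ae mu, forall x, S x}.
Proof.
by move=> PQ; apply: filterS2 => //; exact: (ae_filter_ringOfSetsType mu).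
Qed.

Definition L1 h := mu.-integrable setT (EFin \o h).
(** Half-open intervals, so that the cells of a mesh tile []a, b]] and values at the left end of a
    cell do not matter. *)
Definition oint x y h := \int[mu]_(t in `]x, y]) h t.
Definition bfun u := measurable_fun setT u /\ exists M, forall x, `|u x| <= M.

Lemma L1S h D : measurable D -> L1 h -> mu.-integrable D (EFin \o h).
Proof. by move=> mD hi; apply: integrableS hi. Qed.

Lemma L1D h k : L1 h -> L1 k -> L1 (fun t => h t + k t).
Proof. by move=> hi ki; have := integrableD measurableT hi ki. Qed.

Lemma L1B h k : L1 h -> L1 k -> L1 (fun t => h t - k t).
Proof. by move=> hi ki; have := integrableB measurableT hi ki. Qed.

Lemma L1Z c h : L1 h -> L1 (fun t => c * h t).
Proof. by move=> hi; have := integrableZl measurableT c hi. Qed.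

Lemma L1N h : L1 h -> L1 (fun t => - h t).
Proof. by move=> hi; have := integrableN hi. Qed.

Lemma L1M h u : L1 h -> bfun u -> L1 (fun t => h t * u t).
Proof.
move=> hi [mu_ [M uM]]; have := integrableMl measurableT hi mu_.
apply; exists M; split; first exact: num_real.
by move=> x Mx t _; apply: le_trans (uM t) _; exact: ltW.
Qed.

Lemma L1_norm h : L1 h -> L1 (fun t => `|h t|).
Proof. exact: integrable_norm. Qed.

Lemma bfunM u v : bfun u -> bfun v -> bfun (fun t => u t * v t).
Proof.
move=> [mu_ [M uM]] [mv [N vN]]; split; first exact: measurable_funM.
exists (M * N) => x; rewrite normrM ler_pM//.
Qed.

Lemma bfunP c u v : bfun u -> bfun v -> bfun (fun t => c * u t + v t).
Proof.
move=> [mu_ [M uM]] [mv [N vN]]; split.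
  by apply: measurable_funD => //; apply: measurable_funM.
exists (`|c| * M + N) => x; rewrite (le_trans (ler_normD _ _))// lerD// normrM.
by rewrite ler_wpM2l.
Qed.

Lemma bfun_cst c : bfun (fun _ => c).
Proof. by split; [exact: measurable_cst|exists `|c|]. Qed.

Lemma ointD x y h k : L1 h -> L1 k -> oint x y (fun t => h t + k t) = oint x y h + oint x y k.
Proof. by move=> hi ki; rewrite /oint RintegralD//; exact: L1S. Qed.

Lemma ointB x y h k : L1 h -> L1 k -> oint x y (fun t => h t - k t) = oint x y h - oint x y k.
Proof. by move=> hi ki; rewrite /oint RintegralB//; exact: L1S. Qed.

Lemma ointZ x y c h : L1 h -> oint x y (fun t => c * h t) = c * oint x y h.
Proof. by move=> hi; rewrite /oint RintegralZl//; exact: L1S. Qed.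

Lemma eq_oint x y h k : (forall t, x < t -> t <= y -> h t = k t) -> oint x y h = oint x y k.
Proof.
move=> hk; apply: eq_Rintegral => t; rewrite inE/= in_itv/= => /andP[xt ty].
exact: hk.
Qed.

Lemma oint_split x y z h : x <= y -> y <= z -> L1 h -> oint x z h = oint x y h + oint y z h.
Proof.
move=> xy yz hi; apply/eqP; rewrite addrC -subr_eq; apply/eqP.
by apply: Rintegral_itvB; rewrite ?bnd_simp//; exact: L1S.
Qed.

Lemma oint_le x y h k : L1 h -> L1 k ->
  (forall t, x < t -> t <= y -> h t <= k t) -> oint x y h <= oint x y k.
Proof.
move=> hi ki hk; apply: le_Rintegral => //; [exact: L1S|exact: L1S|].
by move=> t /=; rewrite in_itv/= => /andP[xt ty]; exact: hk.
Qed.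

Lemma oint_ge0 x y h : (forall t, x < t -> t <= y -> 0 <= h t) -> 0 <= oint x y h.
Proof.
move=> h0; apply: Rintegral_ge0 => t /=; rewrite in_itv/= => /andP[xt ty].
exact: h0.
Qed.

Lemma oint_norm x y h : L1 h -> `|oint x y h| <= oint x y (fun t => `|h t|).
Proof. by move=> hi; apply: le_normr_Rintegral => //; exact: L1S. Qed.

Lemma ointxx x h : oint x x h = 0.
Proof. by rewrite /oint set_itv_ge ?bnd_simp ?ltxx// Rintegral_set0. Qed.

Lemma oint_sub x y x' y' h : x <= x' -> x' <= y' -> y' <= y -> L1 h ->
  (forall t, 0 <= h t) -> oint x' y' h <= oint x y h.
Proof.
move=> xx xy yy hi h0.
rewrite (@oint_split x x' y)// ?(@oint_split x' y' y)// ?(le_trans xy)//.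
have := @oint_ge0 x x' h (fun t _ _ => h0 t).
have := @oint_ge0 y' y h (fun t _ _ => h0 t); lra.
Qed.

Lemma ae_eq_oint x y h k : L1 h -> L1 k ->
  {ae mu, forall t, t \in `]x, y[ -> h t = k t} -> oint x y h = oint x y k.
Proof.
move=> hi ki hk.
rewrite /oint -!Rintegral_itv_bndo_bndc; try exact: L1S.
congr fine; apply: ae_eq_integral => //.
- by apply: measurable_int; exact: L1S hi.
- by apply: measurable_int; exact: L1S ki.
- by move: hk; apply: aeS => t ht /= txy; rewrite ht.
Qed.

Lemma L1_abs_continuous h : L1 h -> forall e, 0 < e -> exists2 d, 0 < d &
  forall A, measurable A -> (mu A < d%:E)%E -> \int[mu]_(x in A) `|h x| < e.
Proof. by move=> hi e /(integral_normr_continuous hi)[d [d0 dP]]; exists d. Qed.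

Definition prim_on a b h f := forall x y, a <= x -> x <= y -> y <= b -> f y - f x = oint x y h.

Lemma prim_on_abs_continuous a b h f : L1 h -> prim_on a b h f -> abs_continuous a b f.
Proof.
move=> hi fh e /(L1_abs_continuous hi)[d d0 dP]; exists d => // n u v uv tuv sd.
pose A := \big[setU/set0]_(i < n) `]u i, v i[%classic.
have mA : measurable A by apply: bigsetU_measurable => i _; exact: measurable_itv.
have muA : (mu A < d%:E)%E.
  rewrite /A measure_bigsetU_ord//.
  apply: (@le_lt_trans _ _ (\sum_(i < n) (v i - u i)%:E)%E); last by rewrite sumEFin lte_fin.
  apply: lee_sum => i _; apply: (@le_trans _ _ (mu `]u i, v i[%classic)) => //.
  rewrite lebesgue_measure_itv/= lte_fin.
  by case: ifPn => // _; have [_ uvi _] := uv i; rewrite lee_fin subr_ge0.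
apply: le_lt_trans (dP A mA muA).
have hn : L1 (fun t => `|h t|) by exact: L1_norm.
have -> : \int[mu]_(x in A) `|h x| = \sum_(i < n) \int[mu]_(x in `]u i, v i[) `|h x|.
  rewrite /Rintegral integral_bigsetU_EFin//=.
  - rewrite -sum_fine// => i _; apply: integrable_fin_num => //; exact: L1S hn.
  - exact: index_enum_uniq.
  - exact: sub_trivIset tuv.
  - by apply: measurable_int; exact: L1S hn.
apply: ler_sum => i _; have [aui uvi vb] := uv i.
rewrite fh// (le_trans (oint_norm _ _ hi))//.
by rewrite Rintegral_itv_bndo_bndc//; exact: L1S.
Qed.

Lemma prim_on_derivable a b h f : L1 h -> prim_on a b h f ->
  {ae mu, forall x, x \in `]a, b[ -> derivable f x 1 /\ derive1 f x = h x}.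
Proof.
move=> hi fh.
have loc : locally_integrable setT h by apply: open_integrable_locally => //; exact: openT.
have := @FTC1 R h (BRight a) (fun y => L1S (measurable_itv _) hi) loc.
apply: aeS => x hx; rewrite in_itv/= => /andP[ax xb].
have [|dx ex] := hx; first exact: ax.
(* Differentiation of the integral applies to [F], which differs from [f] by a constant near [x]. *)
pose F y := oint a y h.
have E : \forall t \near x, (F + cst (f a)) t = f t.
  have xab : x \in `]a, b[ by rewrite in_itv/= ax.
  have := near_in_itvoo xab; apply: filterS => t; rewrite in_itv/= => /andP[atx tb].
  by rewrite /F /= -[RHS](subrK (f a)) /cst/= fh// ltW.
have {}dx : derivable F x 1 := dx.
have {}ex : derive1 F x = h x := ex.
clearbody F.
have dF : derivable (F + cst (f a)) x 1 by apply: derivableD.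
split; first exact: near_eq_derivable dF.
rewrite derive1E -(near_eq_derive _ E) deriveD//.
by rewrite derive_cst addr0 -derive1E.
Qed.

(** The density of [f] equals its derivative almost everywhere, hence equals [g] almost everywhere,
    so the two integrals agree. *)
Lemma abs_continuous_prim a b g f : a <= b -> abs_continuous a b f -> L1 g ->
  {ae mu, forall x, x \in `]a, b[ -> derive1 f x = g x} -> prim_on a b g f.
Proof.
move=> ab acf gi fg.
have [h hi hP] := abs_continuous_density ab acf.
have dh := prim_on_derivable hi hP.
move=> x y ax xy yb; rewrite hP//; apply: ae_eq_oint => //.
move: fg dh; apply: aeS2 => t fgt dht txy.
have tab : t \in `]a, b[.
  by move: txy; rewrite !in_itv/= => /andP[xt ty]; rewrite (le_lt_trans ax)// (lt_le_trans ty).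
by have [_ <-] := dht tab; rewrite fgt.
Qed.

Lemma abs_continuousM a b u v : abs_continuous a b u -> abs_continuous a b v ->
  (exists M, forall x, a <= x <= b -> `|u x| <= M) ->
  (exists M, forall x, a <= x <= b -> `|v x| <= M) ->
  abs_continuous a b (u \* v).
Proof.
move=> acu acv [M1 uM1] [M2 vM2] e e0.
pose M := 1 + `|M1| + `|M2|.
have M0 : 0 < M by rewrite /M -addrA ltr_pwDl.
have uM x : a <= x <= b -> `|u x| <= M.
  by move/uM1; have := ler_norm M1; have := normr_ge0 M2; rewrite /M; lra.
have vM x : a <= x <= b -> `|v x| <= M.
  by move/vM2; have := ler_norm M2; have := normr_ge0 M1; rewrite /M; lra.
have e2 : 0 < e / (2 * M) by rewrite divr_gt0// mulr_gt0.
have [d1 d10 du] := acu _ e2; have [d2 d20 dv] := acv _ e2.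
exists (Num.min d1 d2); first by rewrite lt_min d10.
move=> n x y xy txy; rewrite lt_min => /andP[/(du _ _ _ xy txy) h1 /(dv _ _ _ xy txy) h2].
have : \sum_(i < n) `|(u \* v) (y i) - (u \* v) (x i)| <=
    M * (\sum_(i < n) `|u (y i) - u (x i)| + \sum_(i < n) `|v (y i) - v (x i)|).
  rewrite -big_split/= mulr_sumr; apply: ler_sum => i _.
  have [ax xyi yb] := xy i.
  have -> : u (y i) * v (y i) - u (x i) * v (x i) =
    v (y i) * (u (y i) - u (x i)) + u (x i) * (v (y i) - v (x i)) by ring.
  rewrite (le_trans (ler_normD _ _))// !normrM mulrDr lerD// ler_wpM2r//.
    by rewrite vM// yb (le_trans ax).
  by rewrite uM// ax (le_trans xyi).
move=> /le_lt_trans; apply.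
have : M * (\sum_(i < n) `|u (y i) - u (x i)| + \sum_(i < n) `|v (y i) - v (x i)|) <
  M * (e / (2 * M) + e / (2 * M)) by rewrite ltr_pM2l// ltrD.
move=> /lt_le_trans; apply.
rewrite le_eqVlt; apply/orP; left; apply/eqP; field.
by rewrite gt_eqF.
Qed.

(** Integration by parts: the product is absolutely continuous, and the product rule holds at almost
    every point. *)
Lemma prim_onM a b h k u v : a <= b -> L1 h -> L1 k -> bfun u -> bfun v ->
  prim_on a b h u -> prim_on a b k v ->
  prim_on a b (fun t => h t * v t + k t * u t) (u \* v).
Proof.
move=> ab hi ki bu bv uh vk.
apply: abs_continuous_prim => //.
- apply: abs_continuousM; [exact: prim_on_abs_continuous uh|exact: prim_on_abs_continuous vk|..].
    by have [_ [M uM]] := bu; exists M => x _.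
  by have [_ [M vM]] := bv; exists M => x _.
- by apply: L1D; exact: L1M.
have := prim_on_derivable hi uh; have := prim_on_derivable ki vk.
apply: aeS2 => x /[swap] + dv xab => /(_ xab)[du <-]; have [{}dv <-] := dv xab.
rewrite !derive1E -[u \* v]/(u * v) deriveM//.
by rewrite addrC /GRing.scale/= mulrC [X in _ + X]mulrC.
Qed.
End Integrals.

(** * The first-order system *)

Section ODE.
Context {R : realType}.
Implicit Types (a b c d x y z t : R) (f g h k u v : R -> R).
Notation mu := (@lebesgue_measure R).

Lemma le_geometric (x y M : R) : (forall n : nat, x <= y + M / 2 ^+ n) -> x <= y.
Proof.
move=> H; apply/ler_addgt0Pr => e e0.
have [n Mn] : exists n : nat, M < e * 2 ^+ n.
  exists (Num.bound (`|M| / e)).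
  have := @archi_boundP R (`|M| / e) (divr_ge0 (normr_ge0 _) (ltW e0)).
  set n := Num.bound _; rewrite ltr_pdivrMr// mulrC => h.
  apply: (le_lt_trans (ler_norm _)); apply: (lt_le_trans h).
  rewrite ler_pM2l// -natrX ler_nat; exact: ltnW (ltn_expl _ _).
by rewrite (le_trans (H n))// lerD2l ler_pdivrMr ?exprn_gt0// ltW.
Qed.

(** Iterating the improvement from [M] to [A + M / 2] tends to its fixed point [2 A]. On short
    intervals this takes the place of a Gronwall inequality. *)
Lemma absorb_bound (T : Type) (S : T -> Prop) (f : T -> R) (A M0 : R) : 0 <= A -> 0 <= M0 ->
  (forall p, S p -> `|f p| <= M0) ->
  (forall M, 0 <= M -> (forall p, S p -> `|f p| <= M) -> forall p, S p -> `|f p| <= A + M / 2) ->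
  forall p, S p -> `|f p| <= 2 * A.
Proof.
move=> A0 M00 fM0 step.
suff H n : forall p, S p -> `|f p| <= 2 * A + M0 / 2 ^+ n.
  by move=> p Sp; apply: (@le_geometric _ _ M0) => n; exact: H.
elim: n => [|n IH] p Sp.
  by rewrite expr0 divr1 (le_trans (fM0 p Sp))// ler_wpDl// mulr_ge0.
have M1 : 0 <= 2 * A + M0 / 2 ^+ n by rewrite addr_ge0 ?mulr_ge0 ?divr_ge0 ?exprn_ge0.
have := step _ M1 IH p Sp.
have -> : M0 / 2 ^+ n.+1 = (M0 / 2 ^+ n) / 2 by rewrite exprSr invfM mulrA.
lra.
Qed.

Lemma prim_on_cat a b c h f : a <= b -> b <= c -> L1 h -> prim_on a b h f -> prim_on b c h f ->
  prim_on a c h f.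
Proof.
move=> ab bc hi fab fbc x y ax xy yc.
have [yb|by_] := leP y b; first exact: fab.
have [bx|xb] := leP b x; first exact: fbc.
rewrite (@oint_split _ x b y)// ?ltW// -(fab x b)// ?ltW// -(fbc b y)// ?ltW//; ring.
Qed.

Lemma eq_prim_on a b h h' f f' : (forall t, a < t -> t <= b -> h t = h' t) ->
  (forall t, a <= t -> t <= b -> f t = f' t) -> prim_on a b h f -> prim_on a b h' f'.
Proof.
move=> hh ff fh x y ax xy yb.
rewrite -!ff ?fh ?(le_trans ax)// ?(le_trans xy)//.
by apply: eq_oint => t xt ty; apply: hh; [exact: le_lt_trans xt|exact: le_trans yb].
Qed.

Lemma prim_onS a b c d h f : a <= c -> d <= b -> prim_on a b h f -> prim_on c d h f.
Proof. by move=> ac db fh x y cx xy yd; apply: fh => //; [exact: le_trans cx|exact: le_trans yd _]. Qed.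

Lemma fine_partition a b h (e : R) : a < b -> L1 h -> 0 < e -> exists2 N : nat, (0 < N)%N &
  forall i : nat, (i < N)%N ->
    oint (a + i%:R * ((b - a) / N%:R)) (a + i.+1%:R * ((b - a) / N%:R)) (fun t => `|h t|) < e.
Proof.
move=> ab hi e0; have [d d0 dP] := L1_abs_continuous hi e0.
exists (Num.bound ((b - a) / d)).+1 => // i iN; set N := _.+1.
apply: dP => //; rewrite lebesgue_measure_itv/= lte_fin.
have N0 : 0 < (N%:R : R) by rewrite ltr0n.
have dx : a + i.+1%:R * ((b - a) / N%:R) - (a + i%:R * ((b - a) / N%:R)) = (b - a) / N%:R.
  by rewrite -natr1; ring.
have -> : a + i%:R * ((b - a) / N%:R) < a + i.+1%:R * ((b - a) / N%:R).
  by rewrite -subr_gt0 dx divr_gt0// subr_gt0.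
rewrite EFinN -EFinD dx lte_fin ltr_pdivrMr// mulrC -ltr_pdivrMr//.
have := @archi_boundP R ((b - a) / d) (ltac:(by rewrite divr_ge0 ?subr_ge0 ?ltW)).
by move=> /lt_trans; apply; rewrite ltr_nat.
Qed.

Lemma oint_continuous c d h : c <= d -> L1 h -> continuous (fun x => oint c (clamp c d x) h).
Proof.
move=> cd hi.
have F : prim_on c d h (oint c ^~ h).
  by move=> x y cx xy yd; rewrite (@oint_split _ c x y)//; ring.
have := seq_abs_continuous_continuous cd (abs_continuous_seq (prim_on_abs_continuous hi F)).
exact.
Qed.

Lemma bfun_oint c d h (u0 : R) : c <= d -> L1 h -> bfun (fun x => u0 + oint c (clamp c d x) h).
Proof.
move=> cd hi; split.
  apply: measurable_funD => //; apply: continuous_measurable_fun; exact: oint_continuous.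
exists (`|u0| + oint c d (fun t => `|h t|)) => x.
rewrite (le_trans (ler_normD _ _))// lerD2l (le_trans (oint_norm _ _ hi))//.
have /andP[h1 h2] := clamp_itv x cd.
by apply: oint_sub => //; exact: L1_norm.
Qed.

(** [2 * K / 2 ^+ n] is the tail of the geometric series of increments, so [lo n] increases, [hi n]
    decreases, and the supremum of the former is the uniform limit. *)
Lemma uniform_limit_sequence (U : nat -> R -> R) (K : R) : 0 <= K ->
  (forall n x, `|U n.+1 x - U n x| <= K / 2 ^+ n) -> (forall n, bfun (U n)) ->
  exists2 u, bfun u & forall n x, `|u x - U n x| <= 2 * K / 2 ^+ n.
Proof.
move=> K0 dU bU.
pose lo n x := U n x - 2 * K / 2 ^+ n; pose hi n x := U n x + 2 * K / 2 ^+ n.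
have half n : 2 * K / 2 ^+ n.+1 = K / 2 ^+ n.
  by rewrite exprS; field; rewrite expf_neq0.
have lo_nd n x : lo n x <= lo n.+1 x.
  have := dU n x; rewrite ler_norml => /andP[h _]; rewrite /lo half.
  have -> : 2 * K / 2 ^+ n = 2 * (K / 2 ^+ n) by ring.
  lra.
have hi_ni n x : hi n.+1 x <= hi n x.
  have := dU n x; rewrite ler_norml => /andP[_ h]; rewrite /hi half.
  have -> : 2 * K / 2 ^+ n = 2 * (K / 2 ^+ n) by ring.
  lra.
have lohi n x : lo n x <= hi n x.
  have : 0 <= 2 * K / 2 ^+ n by rewrite divr_ge0 ?mulr_ge0 ?exprn_ge0.
  rewrite /lo /hi; lra.
have lomono m n x : (m <= n)%N -> lo m x <= lo n x.
  move=> mn; elim: n mn => [|n IH]; first by rewrite leqn0 => /eqP ->.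
  by rewrite leq_eqVlt => /orP[/eqP->//|mn]; exact: le_trans (IH mn) (lo_nd n x).
have himono m n x : (m <= n)%N -> hi n x <= hi m x.
  move=> mn; elim: n mn => [|n IH]; first by rewrite leqn0 => /eqP ->.
  by rewrite leq_eqVlt => /orP[/eqP->//|mn]; exact: le_trans (hi_ni n x) (IH mn).
have cross m n x : lo m x <= hi n x.
  case: (leqP m n) => mn; first exact: le_trans (lomono _ _ x mn) (lohi n x).
  exact: le_trans (lohi m x) (himono _ _ x (ltnW mn)).
pose u x := sup (range (lo ^~ x)).
have ub x (n : nat) : has_ubound (range (lo ^~ x)) by exists (hi n x) => _ [m _ <-].
have loU n x : lo n x <= u x by apply: ub_le_sup; [exact: (ub x 0%N)|exists n].
have uhi n x : u x <= hi n x.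
  by apply: ge_sup; [exists (lo 0%N x), 0%N|move=> _ [m _ <-]].
have err n x : `|u x - U n x| <= 2 * K / 2 ^+ n.
  have := loU n x; have := uhi n x; rewrite /lo /hi => h1 h2.
  by rewrite ler_norml; lra.
exists u => //; split.
  apply: (@measurable_fun_cvg _ _ _ setT U) => [m|x _]; first by have [] := bU m.
  apply/cvgrPdist_le => e e0.
  have [n nP] : exists n : nat, 2 * K / 2 ^+ n <= e.
    apply: contrapT => H; have : e <= 0; last by rewrite leNgt e0.
    apply: (@le_geometric _ _ (2 * K)) => n; rewrite add0r ltW// ltNge.
    by apply/negP => h; apply: H; exists n.
  near=> m; rewrite (le_trans (err m x))// (le_trans _ nP)//.
  rewrite ler_wpM2l ?mulr_ge0// lef_pV2 ?posrE ?exprn_gt0//.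
  rewrite -!natrX ler_nat leq_exp2l//; near: m; exact: nbhs_infty_ge.
have [_ [M MU]] := bU 0%N.
exists (2 * K + M) => x; rewrite -[u x](subrK (U 0%N x)) (le_trans (ler_normD _ _))// lerD//.
by have := err 0%N x; rewrite expr0 divr1.
Unshelve. all: by end_near. Qed.

Section Picard.
Variables (c d : R) (A : bool -> bool -> R -> R).
Hypotheses (cd : c <= d) (Ai : forall i j, L1 (A i j)).
Let H i t := `|A i true t| + `|A i false t|.
Hypothesis small : forall i, oint c d (H i) <= 1 / 2.

Let Hi i : L1 (H i).
Proof. by apply: L1D; exact: L1_norm. Qed.

(** The components of the system are indexed by [bool]: [true] is the function, [false] its
    quasi-derivative. *)
Definition rhs (F : bool -> R -> R) i t := A i true t * F true t + A i false t * F false t.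

Lemma rhs_L1 F i : (forall j, bfun (F j)) -> L1 (rhs F i).
Proof. by move=> bF; apply: L1D; exact: L1M. Qed.

Lemma rhs_bound F F' i x y (M : R) : (forall j, bfun (F j)) -> (forall j, bfun (F' j)) ->
  0 <= M -> c <= x -> x <= y -> y <= d ->
  (forall j t, c <= t -> t <= d -> `|F j t - F' j t| <= M) ->
  `|oint x y (rhs F i) - oint x y (rhs F' i)| <= M / 2.
Proof.
move=> bF bF' M0 cx xy yd FM.
have i1 := rhs_L1 i bF; have i2 := rhs_L1 i bF'.
rewrite -ointB// (le_trans (oint_norm _ _ (L1B i1 i2)))//.
apply: (@le_trans _ _ (oint x y (fun t => M * H i t))).
  apply: oint_le; [exact: L1_norm (L1B i1 i2)|exact: L1Z|].
  move=> t xt ty.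
  have -> : rhs F i t - rhs F' i t = A i true t * (F true t - F' true t) + A i false t * (F false t
    - F' false t).
    by rewrite /rhs; ring.
  have ct : c <= t by rewrite (le_trans cx)// ltW.
  have td : t <= d by exact: le_trans yd.
  rewrite (le_trans (ler_normD _ _))// !normrM /H mulrDr; apply: lerD.
    by rewrite mulrC ler_wpM2r// FM.
  by rewrite mulrC ler_wpM2r// FM.
rewrite ointZ// ler_wpM2l// -[leRHS]div1r (le_trans _ (small i))// oint_sub//.
by move=> t; rewrite addr_ge0.
Qed.

(** The row integrals being at most 1/2, the Picard map contracts uniform distances by the factor
    1/2. Clamping the upper limit keeps the iterates bounded on the whole line. *)
Lemma picard (v : bool -> R) : exists F : bool -> R -> R, forall i,
  [/\ bfun (F i), prim_on c d (rhs F i) (F i) & F i c = v i].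
Proof.
pose step (F : bool -> R -> R) i x := v i + oint c (clamp c d x) (rhs F i).
pose U n := iter n step (fun i _ => v i).
have bU n i : bfun (U n i).
  elim: n i => [|n IH] i; first exact: bfun_cst.
  by apply: bfun_oint => //; exact: rhs_L1.
have clampP x : c <= clamp c d x /\ clamp c d x <= d by apply/andP; exact: clamp_itv.
have step_lip (F F' : bool -> R -> R) M : (forall j, bfun (F j)) -> (forall j, bfun (F' j)) -> 0 <= M ->
    (forall j t, `|F j t - F' j t| <= M) -> forall i x, `|step F i x - step F' i x| <= M / 2.
  move=> bF bF' M0 FM i x; rewrite /step opprD addrACA subrr add0r.
  by have [h1 h2] := clampP x; apply: rhs_bound.
have [K K0 U1] : exists2 K, 0 <= K & forall i x, `|U 1%N i x - U 0%N i x| <= K.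
  have [_ [K1 U1]] := bU 1%N true; have [_ [K2 U2]] := bU 1%N false.
  have K10 := le_trans (normr_ge0 _) (U1 0); have K20 := le_trans (normr_ge0 _) (U2 0).
  exists (K1 + K2 + `|v true| + `|v false|).
    by rewrite !addr_ge0.
  have n1 := normr_ge0 (v true); have n2 := normr_ge0 (v false).
  by case=> x; rewrite (le_trans (ler_normB _ _))//; [have := U1 x|have := U2 x]; rewrite /=; lra.
have dU n i x : `|U n.+1 i x - U n i x| <= K / 2 ^+ n.
  elim: n i x => [|n IH] i x; first by rewrite expr0 divr1; exact: U1.
  rewrite exprSr invfM mulrA; apply: (step_lip _ _ _ (bU _) (bU _) _ IH).
  by rewrite divr_ge0 ?exprn_ge0.
have /choice[F FP] : forall i, exists u, bfun u /\ forall n x, `|u x - U n i x| <= 2 * K / 2 ^+ n.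
  by move=> i; have [u bu uP] := @uniform_limit_sequence (fun n => U n i) K K0 (fun n => dU n i)
    (bU ^~ i); exists u.
have bF i : bfun (F i) by have [] := FP i.
have FE i x : F i x = step F i x.
  apply/eqP; rewrite -subr_eq0 -normr_le0; apply: (@le_geometric _ _ (2 * K)) => n.
  rewrite add0r.
  have -> : F i x - step F i x = (F i x - U n.+1 i x) + (step (U n) i x - step F i x).
    by rewrite /U /= -/(U n); ring.
  rewrite (le_trans (ler_normD _ _))//.
  have h1 := (FP i).2 n.+1 x.
  have h2 : `|step (U n) i x - step F i x| <= (2 * K / 2 ^+ n) / 2.
    apply: step_lip => //; first by rewrite divr_ge0 ?mulr_ge0 ?exprn_ge0.
    by move=> j t; rewrite distrC; exact: (FP j).2.
  have E : 2 * K / 2 ^+ n.+1 = (2 * K / 2 ^+ n) / 2 by rewrite exprSr invfM mulrA.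
  rewrite E in h1; lra.
exists F => i; split => //.
  move=> x y cx xy yd; rewrite (FE i y) (FE i x) /step !clamp_id ?cx ?yd ?(le_trans cx)// ?(le_trans xy)//.
  by rewrite (@oint_split _ c x y)//; [ring|exact: rhs_L1].
by rewrite FE /step clamp_id ?lexx// ointxx addr0.
Qed.

(** A bound [M] on the solution improves to [M / 2], so [absorb_bound] applies with [A = 0]; the
    zero of [F] may be at any point of the interval. *)
Lemma picard_unique (F : bool -> R -> R) (x0 : R) : c <= x0 <= d ->
  (forall i, bfun (F i)) -> (forall i, prim_on c d (rhs F i) (F i)) ->
  (forall i, F i x0 = 0) -> forall i x, c <= x <= d -> F i x = 0.
Proof.
move=> /andP[cx0 x0d] bF pF F0 i x xcd.
have [_ [M1 B1]] := bF true; have [_ [M2 B2]] := bF false.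
have M10 := le_trans (normr_ge0 _) (B1 0); have M20 := le_trans (normr_ge0 _) (B2 0).
apply/eqP; rewrite -normr_le0.
have := @absorb_bound (bool * R) (fun p => c <= p.2 <= d) (fun p => F p.1 p.2) 0 (M1 + M2) (lexx 0)
  (addr_ge0 M10 M20).
rewrite mulr0 => absb; apply: (absb _ _ (i, x) xcd) => [[[] t] _ /=|M M0 FM [j t] /andP[/= ct td]].
- by rewrite (le_trans (B1 t))// lerDl.
- by rewrite (le_trans (B2 t))// lerDr.
have b0 : forall j : bool, bfun ((fun (_ : bool) (_ : R) => 0) j) by move=> _; exact: bfun_cst.
have z0 y z : oint y z (rhs (fun _ _ => 0) j) = 0.
  rewrite (@eq_oint _ y z _ (fun=> 0)); last by move=> *; rewrite /rhs !mulr0 addr0.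
  by rewrite /oint Rintegral_cst// mul0r.
have key y z : c <= y -> y <= z -> z <= d -> `|F j z - F j y| <= 0 + M / 2.
  move=> cy yz zd; rewrite pF// add0r -[oint _ _ _]subr0 -(z0 y z).
  by apply: rhs_bound => // k s cs sd; rewrite subr0; apply: (FM (k, s)); rewrite /= cs.
have [tx|xt] := leP t x0.
  by have := key t x0 ct tx x0d; rewrite F0 sub0r normrN.
by have := key x0 t cx0 (ltW xt) td; rewrite F0 subr0.
Qed.

End Picard.
End ODE.

(* [slw] stands for [1 / p]; all coefficients are integrable on the whole line
   and the signs hold everywhere. *)
Record sl_data (R : realType) := SLData {
  sla : R; slb : R; slw : R -> R; slq : R -> R; slr : R -> R; sls : R -> R;
  sl_lt : sla < slb;
  slw_L1 : L1 slw; slq_L1 : L1 slq; slr_L1 : L1 slr; sls_L1 : L1 sls;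
  slw_ge0 : forall t, 0 <= slw t;
  slr_ge0 : forall t, 0 <= slr t;
  slw_gt0 : forall x y, sla <= x -> x < y -> y <= slb -> 0 < oint x y slw;
  slr_gt0 : forall x y, sla <= x -> x < y -> y <= slb -> 0 < oint x y slr }.

(** * Energy identities and estimates on short intervals *)

Section Energy.
Context {R : realType} (S : sl_data R).
Implicit Types (c d x y t sg : R) (u z : R -> R).
Notation a := (sla S). Notation b := (slb S).
Notation w := (slw S). Notation q := (slq S). Notation r := (slr S). Notation s := (sls S).
Let ab : a < b := sl_lt S.
Let wi : L1 w := slw_L1 S. Let qi : L1 q := slq_L1 S.
Let ri : L1 r := slr_L1 S. Let si : L1 s := sls_L1 S.
Let w0 := slw_ge0 S. Let r0 := slr_ge0 S.

(* With [z] for the quasi-derivative of [u], the equation is the first-order system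
   [u' = ueq u z], [z' = zeq sg u z]. *)
Definition ueq u z t := - s t * u t + w t * z t.
Definition zeq sg u z t := (q t - sg * r t) * u t + s t * z t.
(** The primes name a second pair. Since [w] is [1 / p] and [z], [z'] are the quasi-derivatives,
    [w z z'] is [p] times the product of the two expressions derivative plus [s] times function. *)
Definition edens sg u z u' z' t := w t * (z t * z' t) + (q t - sg * r t) * (u t * u' t).
Definition eint sg x y u z u' z' := oint x y (edens sg u z u' z').
(** Only the first equation is imposed: [z] is any bounded measurable function and need not be
    continuous. *)
Definition form_elt u z := [/\ bfun u, bfun z & prim_on a b (ueq u z) u].
(** The bound 1/8 cancels the factor 8 of [sup_bound]: if [u c = 0] then [u ^+ 2] is at most the
    integral [P] of [w z ^+ 2], and the potential term is at most [P / 8], which leaves more than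
    [P / 2] of energy. *)
Definition small_itv sg c d :=
  oint c d (fun t => w t + `|s t| + `|q t| + `|sg| * r t) <= 1 / 8.

Lemma Nsi : L1 (fun t => - s t). Proof. exact: L1N. Qed.
Lemma qsr_L1 sg : L1 (fun t => q t - sg * r t). Proof. by apply: L1B => //; exact: L1Z. Qed.

Lemma ueq_L1 u z : bfun u -> bfun z -> L1 (ueq u z).
Proof. by move=> bu bz; apply: L1D; apply: L1M => //; exact: Nsi. Qed.

Lemma zeq_L1 sg u z : bfun u -> bfun z -> L1 (zeq sg u z).
Proof. by move=> bu bz; apply: L1D; apply: L1M => //; exact: qsr_L1. Qed.

Lemma edens_L1 sg u z u' z' : bfun u -> bfun z -> bfun u' -> bfun z' ->
  L1 (edens sg u z u' z').
Proof.
move=> bu bz bu' bz'; apply: L1D; apply: L1M => //; try exact: qsr_L1.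
- exact: bfunM.
- exact: bfunM.
Qed.

Lemma wz2_L1 z : bfun z -> L1 (fun t => w t * z t ^+ 2).
Proof. by move=> bz; apply: L1M => //; exact: bfunM. Qed.

Lemma ru2_L1 u : bfun u -> L1 (fun t => r t * u t ^+ 2).
Proof. by move=> bu; apply: L1M => //; exact: bfunM. Qed.

Lemma bfun_norm u : bfun u -> bfun (fun t => `|u t|).
Proof.
by move=> [mu_ [M uM]]; split; [exact: measurableT_comp|exists M => x; rewrite normr_id].
Qed.

Lemma small_parts sg c d : small_itv sg c d ->
  [/\ oint c d w <= 1 / 8, oint c d (fun t => `|s t|) <= 1 / 8,
      oint c d (fun t => `|q t - sg * r t|) <= 1 / 8 &
      oint c d (fun t => `|q t - sg * r t| + `|s t|) <= 1 / 8].
Proof.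
move=> sm.
have wL : L1 (fun t => w t + `|s t| + `|q t| + `|sg| * r t).
  by apply: L1D; [apply: L1D; [apply: L1D|]|] => //; [exact: L1_norm|exact: L1_norm|exact: L1Z].
have tri t : `|q t - sg * r t| <= `|q t| + `|sg| * r t.
  by rewrite (le_trans (ler_normB _ _))// normrM (ger0_norm (r0 t)).
have ns t := normr_ge0 (s t); have nq t := normr_ge0 (q t).
have nr t : 0 <= `|sg| * r t by rewrite mulr_ge0.
have qL := L1_norm (qsr_L1 sg); have sL := L1_norm si.
split; apply: le_trans sm; apply: oint_le => //; try exact: L1D; move=> t _ _;
  by have := tri t; have := ns t; have := nq t; have := nr t; have := w0 t; lra.
Qed.

Lemma prim_on_lin c d k h h' f f' : L1 h -> L1 h' -> prim_on c d h f -> prim_on c d h' f' ->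
  prim_on c d (fun t => k * h t + h' t) (fun t => k * f t + f' t).
Proof.
move=> hi hi' fh fh' x y cx xy yd; rewrite ointD//; last exact: L1Z.
by rewrite ointZ// -fh// -fh'//; ring.
Qed.

Lemma ueq_lin k u z u' z' t : k * ueq u z t + ueq u' z' t =
  ueq (fun t => k * u t + u' t) (fun t => k * z t + z' t) t.
Proof. by rewrite /ueq; ring. Qed.

Lemma zeq_lin sg k u z u' z' t : k * zeq sg u z t + zeq sg u' z' t =
  zeq sg (fun t => k * u t + u' t) (fun t => k * z t + z' t) t.
Proof. by rewrite /zeq; ring. Qed.

(** The energy density is the derivative of the product of [z] and [u']: the two terms in [s]
    cancel. *)
Lemma green sg c d u z u' z' : c <= d -> bfun u -> bfun z -> bfun u' -> bfun z' ->
  prim_on c d (zeq sg u z) z -> prim_on c d (ueq u' z') u' ->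
  eint sg c d u z u' z' = z d * u' d - z c * u' c.
Proof.
move=> cd bu bz bu' bz' zP uP.
have := prim_onM cd (zeq_L1 sg bu bz) (ueq_L1 bu' bz') bz bu' zP uP.
move=> /(_ c d (lexx c) cd (lexx d)) /= ->.
by apply: eq_oint => t _ _; rewrite /edens /zeq /ueq; ring.
Qed.

Lemma oint_cauchy_schwarz c d z : c <= d -> bfun z -> 0 < oint c d w ->
  (oint c d (fun t => w t * `|z t|)) ^+ 2 <= oint c d w * oint c d (fun t => w t * z t ^+ 2).
Proof.
move=> cd bz W0.
have bn := bfun_norm bz.
set W := oint c d w in W0 *; set A := oint c d (fun t => w t * `|z t|).
set P := oint c d (fun t => w t * z t ^+ 2).
(* The value of [k] minimizing the quadratic polynomial below. *)
pose k := A / W.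
have : 0 <= oint c d (fun t => w t * (`|z t| - k) ^+ 2).
  by apply: oint_ge0 => t _ _; rewrite mulr_ge0// sqr_ge0.
rewrite (@eq_oint _ c d _ (fun t => (w t * z t ^+ 2 + (- (2 * k)) * (w t * `|z t|)) + k ^+ 2 * w
  t)); last first.
  by move=> t _ _; rewrite sqrrB real_normK ?num_real//; ring.
have wz := L1M wi bn.
rewrite ointD; [|apply: L1D; [exact: wz2_L1|exact: L1Z]|exact: L1Z].
rewrite ointD; [|exact: wz2_L1|exact: L1Z].
rewrite !ointZ// -/P -/A -/W => h.
have : 0 <= W * (P + - (2 * k) * A + k ^+ 2 * W) by rewrite mulr_ge0// ltW.
rewrite {h}/k.
have -> : W * (P + - (2 * (A / W)) * A + (A / W) ^+ 2 * W) = W * P - A ^+ 2.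
  by field; rewrite gt_eqF.
by rewrite subr_ge0.
Qed.

(** With [Q] the integral of [w |z|], absorbing the term in [s] gives [|u x| <= 2 (|u x0| + Q)].
    Squaring yields the factors 8, and the Cauchy-Schwarz inequality bounds [Q ^+ 2]. *)
Lemma sup_bound c d x0 x u z : a <= c -> c < d -> d <= b -> bfun u -> bfun z ->
  prim_on c d (ueq u z) u -> oint c d (fun t => `|s t|) <= 1 / 2 ->
  c <= x0 <= d -> c <= x <= d ->
  u x ^+ 2 <= 8 * u x0 ^+ 2 + 8 * (oint c d w * oint c d (fun t => w t * z t ^+ 2)).
Proof.
move=> ac cd db bu bz uP sm /andP[cx0 x0d] xcd.
have W0 : 0 < oint c d w by exact: slw_gt0.
have CS := oint_cauchy_schwarz (ltW cd) bz W0.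
have bn := bfun_norm bz.
set Q := oint c d (fun t => w t * `|z t|) in CS.
have Q0 : 0 <= Q by apply: oint_ge0 => t _ _; rewrite mulr_ge0.
have [_ [M0 uM0]] := bu; have M00 := le_trans (normr_ge0 _) (uM0 0).
have A0 : 0 <= `|u x0| + Q by rewrite addr_ge0.
have key y1 y2 M : c <= y1 -> y1 <= y2 -> y2 <= d -> 0 <= M ->
    (forall p, c <= p <= d -> `|u p| <= M) -> `|u y2 - u y1| <= Q + M / 2.
  move=> cy y12 yd M_0 uM; rewrite uP//.
  have sL := L1_norm si; have wzL := L1M wi bn.
  rewrite (le_trans (oint_norm _ _ (ueq_L1 bu bz)))//.
  apply: (@le_trans _ _ (oint y1 y2 (fun t => w t * `|z t| + M * `|s t|))).
    apply: oint_le; [exact: L1_norm (ueq_L1 bu bz)|by apply: L1D => //; exact: L1Z|].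
    move=> t y1t ty2; rewrite /ueq addrC (le_trans (ler_normD _ _))//.
    rewrite !normrM normrN (ger0_norm (w0 t)) lerD2l mulrC ler_wpM2r// uM//.
    by rewrite (le_trans cy)/= ?(le_trans ty2)// ltW.
  rewrite ointD//; last exact: L1Z.
  rewrite ointZ// lerD//; first by apply: oint_sub => // t; rewrite mulr_ge0.
  rewrite ler_wpM2l// -[leRHS]div1r (le_trans _ sm)//.
  by apply: oint_sub.
have := absorb_bound A0 M00 (fun p (_ : c <= p <= d) => uM0 p).
move=> /(_ _ x xcd) ux.
have {}ux : `|u x| <= 2 * (`|u x0| + Q).
  apply: ux => M M_0 uM p /andP[cp pd].
  rewrite -[u p](subrK (u x0)) (le_trans (ler_normD _ _))//.
  have [px|xp] := leP p x0.
    by have := key p x0 M cp px x0d M_0 uM; rewrite distrC; lra.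
  by have := key x0 p M cx0 (ltW xp) pd M_0 uM; lra.
have n0 := normr_ge0 (u x0).
have : `|u x| ^+ 2 <= (2 * (`|u x0| + Q)) ^+ 2 by rewrite lerXn2r// nnegrE mulr_ge0.
rewrite real_normK ?num_real//.
have <- : `|u x0| ^+ 2 = u x0 ^+ 2 by rewrite real_normK ?num_real.
have := sqr_ge0 (`|u x0| - Q).
move: (`|u x0|) CS => U CS h1 h2; nra.
Qed.

Lemma wz2_ge0 c d z : 0 <= oint c d (fun t => w t * z t ^+ 2).
Proof. by apply: oint_ge0 => t _ _; rewrite mulr_ge0// sqr_ge0. Qed.

Lemma short_coercive sg c d u z : a <= c -> c < d -> d <= b -> bfun u -> bfun z ->
  prim_on c d (ueq u z) u -> small_itv sg c d -> u c = 0 ->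
  let P := oint c d (fun t => w t * z t ^+ 2) in
  [/\ P / 2 <= eint sg c d u z u z,
      oint c d (fun t => r t * u t ^+ 2) <= oint a b r * P &
      forall x, c <= x <= d -> u x ^+ 2 <= P].
Proof.
move=> ac cd db bu bz uP /small_parts[h1 h2 h3 _] uc P.
have P0 : 0 <= P by exact: wz2_ge0.
have ux x : c <= x <= d -> u x ^+ 2 <= P.
  move=> xcd; have := @sup_bound c d c x u z ac cd db bu bz uP (le_trans h2 _) _ xcd.
  rewrite uc expr0n /= mulr0 add0r -/P lexx (ltW cd) => /(_ _ isT) h.
  apply: (le_trans (h _)); first by lra.
  have : oint c d w * P <= 1 / 8 * P by rewrite ler_wpM2r.
  lra.
split => //.
- have bu2 : bfun (fun t => u t ^+ 2) by exact: bfunM.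
  have qL := qsr_L1 sg.
  rewrite /eint (@eq_oint _ c d _ (fun t => w t * z t ^+ 2 + (q t - sg * r t) * u t ^+ 2)); last first.
    by move=> t _ _; rewrite /edens !expr2.
  rewrite ointD; [|exact: wz2_L1|exact: L1M].
  rewrite -/P.
  have : oint c d (fun t => `|(q t - sg * r t) * u t ^+ 2|) <= P * (1 / 8).
    apply: (@le_trans _ _ (oint c d (fun t => P * `|q t - sg * r t|))).
      apply: oint_le; [exact: L1_norm (L1M qL bu2)|exact: L1Z (L1_norm qL)|].
      move=> t ct td; rewrite normrM mulrC ler_wpM2r// ger0_norm ?sqr_ge0// ux//.
      by rewrite ltW.
    by rewrite ointZ ?ler_wpM2l//; exact: L1_norm.
  have := oint_norm c d (L1M qL bu2).
  rewrite ler_norml => /andP[g1 g2] g3; lra.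
- apply: (@le_trans _ _ (oint c d (fun t => P * r t))).
    apply: oint_le; [exact: ru2_L1|exact: L1Z|].
    by move=> t ct td; rewrite mulrC ler_wpM2r// ux// ltW.
  rewrite ointZ// mulrC ler_wpM2r//.
  by apply: oint_sub => //; exact: ltW.
Qed.

End Energy.

(** * Broken solutions on a mesh *)

Section Nodes.
Context {R : realType} (S : sl_data R).
Implicit Types (c d x y t sg : R) (u z : R -> R).
Notation a := (sla S). Notation b := (slb S).
Notation w := (slw S). Notation q := (slq S). Notation r := (slr S). Notation s := (sls S).
Let ab : a < b := sl_lt S.
Let wi : L1 w := slw_L1 S. Let qi : L1 q := slq_L1 S.
Let ri : L1 r := slr_L1 S. Let si : L1 s := sls_L1 S.
Let w0 := slw_ge0 S. Let r0 := slr_ge0 S.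

Definition ode_sol sg c d u z := [/\ bfun u, bfun z, prim_on c d (ueq S u z) u &
  prim_on c d (zeq S sg u z) z].

Definition sl_coef sg (i j : bool) : R -> R :=
  match i, j with
  | true, true => fun t => - s t
  | true, false => w
  | false, true => fun t => q t - sg * r t
  | false, false => s
  end.

Lemma sl_coef_L1 sg i j : L1 (sl_coef sg i j).
Proof. by case: i; case: j => //=; [exact: Nsi|exact: qsr_L1]. Qed.

Lemma sl_coef_small sg c d : small_itv S sg c d -> forall i,
  oint c d (fun t => `|sl_coef sg i true t| + `|sl_coef sg i false t|) <= 1 / 2.
Proof.
move=> /small_parts[h1 h2 h3 h4] [] /=; last by lra.
rewrite (@eq_oint _ c d _ (fun t => `|s t| + w t)); last first.
  by move=> t _ _; rewrite normrN (ger0_norm (w0 t)).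
by rewrite ointD//; [lra|exact: L1_norm].
Qed.

Lemma ivp sg c d (v : bool -> R) : c <= d -> small_itv S sg c d ->
  exists u z, [/\ ode_sol sg c d u z, u c = v true & z c = v false].
Proof.
move=> cd sm.
have [F FP] := picard cd (sl_coef_L1 sg) (sl_coef_small sm) v.
have [b1 p1 v1] := FP true; have [b2 p2 v2] := FP false.
by exists (F true), (F false).
Qed.

Lemma ivp_unique sg c d u z x0 : c <= d -> small_itv S sg c d -> ode_sol sg c d u z ->
  c <= x0 <= d -> u x0 = 0 -> z x0 = 0 -> forall x, c <= x <= d -> u x = 0 /\ z x = 0.
Proof.
move=> cd sm [bu bz pu pz] cx0d ux0 zx0 x xcd.
pose F (i : bool) := if i then u else z.
have H := @picard_unique R c d (sl_coef sg) (sl_coef_L1 sg) (sl_coef_small sm) F x0 cx0d.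
have H1 : forall i : bool, F i x = 0 by move=> i; apply: H => // -[].
by split; [exact: (H1 true)|exact: (H1 false)].
Qed.

Lemma ode_sol_lin sg c d k u z u' z' : ode_sol sg c d u z -> ode_sol sg c d u' z' ->
  ode_sol sg c d (fun t => k * u t + u' t) (fun t => k * z t + z' t).
Proof.
move=> [bu bz pu pz] [bu' bz' pu' pz']; split; try exact: bfunP.
  have := prim_on_lin k (ueq_L1 S bu bz) (ueq_L1 S bu' bz') pu pu'.
  by apply: eq_prim_on => // t _ _; rewrite ueq_lin.
have := prim_on_lin k (zeq_L1 S sg bu bz) (zeq_L1 S sg bu' bz') pz pz'.
by apply: eq_prim_on => // t _ _; rewrite zeq_lin.
Qed.

(** It suffices that the solution [phi] with [phi c = 0] and quasi-derivative 1 at [c] does not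
    vanish at [d]. Otherwise [green] makes its energy zero, so coercivity forces [P = 0] and
    [phi = 0]; but then its quasi-derivative stays above 3/4 and [P] is positive. *)
Lemma bvp sg c d al be : a <= c -> c < d -> d <= b -> small_itv S sg c d ->
  exists u z, [/\ ode_sol sg c d u z, u c = al & u d = be].
Proof.
move=> ac cd db sm; have cd' := ltW cd.
have [phi [ph [P1 phic phc]]] := @ivp sg c d (fun i => if i then 0 else 1) cd' sm.
have [psi [ps [P2 psic psc]]] := @ivp sg c d (fun i => if i then 1 else 0) cd' sm.
have phid : phi d != 0.
  apply/eqP => phid; have [bu bz pu pz] := P1.
  have [h1 h2 h3] := short_coercive ac cd db bu bz pu sm phic.
  have := green cd' bu bz bu bz pz pu; rewrite phid phic !mulr0 subrr => E0.
  set P := oint c d _ in h1 h2 h3.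
  have P0 : P = 0 by apply/eqP; rewrite eq_le (wz2_ge0 S c d ph) andbT; lra.
  have [s1 s2 s3 _] := small_parts sm.
  have [_ [M0 zM0]] := bz.
  have M00 := le_trans (normr_ge0 _) (zM0 0).
  have phi0 x : c <= x <= d -> phi x = 0.
    move=> /h3; rewrite P0 => h; apply/eqP; rewrite -sqrf_eq0 eq_le h sqr_ge0//.
  have z1 x : c <= x <= d -> `|ph x - 1| <= 2 * (1 / 8).
    have A0 : 0 <= 1 / 8 :> R by rewrite divr_ge0.
    apply: (@absorb_bound R R (fun x => c <= x <= d) (fun x => ph x - 1) _ (M0 + 1) A0).
    - by rewrite addr_ge0.
    - by move=> p _; rewrite (le_trans (ler_normB _ _))// normr1 lerD2r.
    move=> M M_0 zM p /andP[cp pd].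
    have -> : ph p - 1 = ph p - ph c by rewrite phc.
    rewrite pz//.
    rewrite (le_trans (oint_norm _ _ (zeq_L1 S sg bu bz)))//.
    have sL := L1_norm si.
    apply: (@le_trans _ _ (oint c p (fun t => (M + 1) * `|s t|))).
      apply: oint_le; [exact: L1_norm (zeq_L1 S sg bu bz)|exact: L1Z|].
      move=> t ct tp; have tcd : c <= t <= d by rewrite ltW//= (le_trans tp).
      rewrite /zeq phi0// mulr0 add0r normrM mulrC ler_wpM2r//.
      rewrite -[ph t](subrK 1) (le_trans (ler_normD _ _))// normr1 lerD2r.
      exact: zM.
    rewrite ointZ//.
    have : oint c p (fun t => `|s t|) <= 1 / 8.
      by apply: le_trans s2; apply: oint_sub.
    have : 0 <= oint c p (fun t => `|s t|) by apply: oint_ge0.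
    move: (oint c p _) => X X0 X1.
    have : (M + 1) * X <= (M + 1) * (1 / 8) by rewrite ler_wpM2l// addr_ge0.
    lra.
  have : 0 < oint c d w by exact: slw_gt0.
  have : oint c d w <= 4 * P.
    rewrite /P -ointZ; last exact: wz2_L1.
    apply: oint_le => //; first by apply: L1Z; exact: wz2_L1.
    move=> t ct td; have := z1 t (ltac:(by rewrite ltW)).
    rewrite ler_norml => /andP[g1 g2].
    have p0 : 3 / 4 <= ph t by lra.
    have : 1 <= 4 * ph t ^+ 2 by rewrite expr2; nra.
    by have := w0 t; nra.
  by rewrite P0 mulr0; lra.
pose k := (be - al * psi d) / phi d.
(* [ode_sol_lin] adds an unscaled second solution, so [k phi] is written as [(k - 1) phi + phi]. *)
have P3 := ode_sol_lin al P2 (ode_sol_lin (k - 1) P1 P1).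
eexists; eexists; split; first exact: P3.
- by rewrite /= psic phic; ring.
- by rewrite /k /=; field.
Qed.

Section Partition.
Variables (sg : R) (N : nat).
Hypothesis N0 : (0 < N)%N.

Definition node (i : nat) : R := a + i%:R * ((b - a) / N%:R).

Definition small_mesh := forall i, (i < N)%N -> small_itv S sg (node i) (node i.+1).
Hypothesis small : small_mesh.

Let step0 : 0 < (b - a) / N%:R.
Proof. by rewrite divr_gt0 ?subr_gt0// ltr0n. Qed.

Lemma node0 : node 0 = a. Proof. by rewrite /node mul0r addr0. Qed.
Lemma nodeN : node N = b.
Proof. by rewrite /node mulrC divfK ?subrKC// gt_eqF// ltr0n. Qed.
Lemma node_lt i : node i < node i.+1.
Proof. by rewrite /node ltrD2l ltr_pM2r// ltr_nat. Qed.
Lemma node_le i j : (i <= j)%N -> node i <= node j.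
Proof. by move=> ij; rewrite /node lerD2l ler_pM2r// ler_nat. Qed.
Lemma node_ge i : a <= node i. Proof. by rewrite -node0 node_le. Qed.
Lemma node_leb i : (i <= N)%N -> node i <= b. Proof. by move=> iN; rewrite -nodeN node_le. Qed.

Lemma node_itv x : a <= x -> x <= b -> exists2 i, (i < N)%N & node i <= x <= node i.+1.
Proof.
move=> ax; rewrite -nodeN.
elim: {-2}N (leqnn N) N0 => // n IH nN _ xn.
have [xn'|xn'] := leP x (node n); last by exists n => //; rewrite ltW.
have [n0|n0] := posnP n; first by exists n => //; rewrite xn andbT n0 node0.
have [i i_n xi] := IH (ltnW nN) n0 xn'.
by exists i => //; exact: ltnW.
Qed.

Lemma oint_nodes_upto n h : L1 h -> oint a (node n) h = \sum_(i < n) oint (node i) (node i.+1) h.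
Proof.
move=> hi; elim: n => [|n IH]; first by rewrite node0 ointxx big_ord0.
by rewrite big_ord_recr /= -IH (@oint_split _ a (node n))// ?node_ge// node_le.
Qed.

Lemma oint_nodes h : L1 h -> oint a b h = \sum_(i < N) oint (node i) (node i.+1) h.
Proof. by move=> hi; rewrite -oint_nodes_upto// nodeN. Qed.

(* [zeta i] is the continuous representative of [z] on the closed interval
   [[node i, node i.+1]]; [z] itself may jump at the nodes. *)
Definition broken_sol u z (zeta : nat -> R -> R) := form_elt S u z /\
  forall i, (i < N)%N -> [/\ bfun (zeta i),
    prim_on (node i) (node i.+1) (zeq S sg u (zeta i)) (zeta i) &
    forall t, node i < t -> t <= node i.+1 -> z t = zeta i t].

Lemma bfun_patch c u u' : bfun u -> bfun u' -> bfun (fun t => if t <= c then u t else u' t).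
Proof.
move=> [mu_ [M uM]] [mu' [M' uM']]; split.
  by apply: measurable_fun_ifT => //; apply: measurable_fun_ler => //; exact: measurable_id.
exists (Num.max M M') => x; case: ifPn => _; rewrite le_max ?uM// uM' orbT//.
Qed.

Lemma nodal_interp (v : nat -> R) : exists u z zeta, broken_sol u z zeta /\
  forall i, (i <= N)%N -> u (node i) = v i.
Proof.
suff H n : (n <= N)%N -> exists u z zeta, [/\ bfun u, bfun z, prim_on a (node n) (ueq S u z) u,
    forall i, (i <= n)%N -> u (node i) = v i &
    forall i, (i < n)%N -> [/\ bfun (zeta i),
      prim_on (node i) (node i.+1) (zeq S sg u (zeta i)) (zeta i) &
      forall t, node i < t -> t <= node i.+1 -> z t = zeta i t]].
  have [u [z [zeta [bu bz pu uv zz]]]] := H N (leqnn N).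
  by exists u, z, zeta; split => //; split => //; split => //; rewrite -nodeN.
elim: n => [|n IH] nN.
  exists (fun=> v 0%N), (fun=> 0), (fun _ _ => 0); split; try exact: bfun_cst.
  - move=> x y ax xy; rewrite node0 => ya.
    have -> : y = x by apply/eqP; rewrite eq_le xy (le_trans ya).
    by rewrite subrr ointxx.
  - by move=> i; rewrite leqn0 => /eqP ->.
  - by [].
have [u [z [zeta [bu bz pu uv zz]]]] := IH (ltnW nN).
have [u1 [z1 [[bu1 bz1 pu1 pz1] u1n u1n1]]] :=
  @bvp sg (node n) (node n.+1) (v n) (v n.+1) (node_ge n) (node_lt n) (node_leb nN) (small nN).
have lt_node i t : (i <= n)%N -> t <= node i -> t <= node n.
  by move=> i_n ti; rewrite (le_trans ti)// node_le.
exists (fun t => if t <= node n then u t else u1 t), (fun t => if t <= node n then z t else z1 t),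
  (fun i => if (i < n)%N then zeta i else z1).
have ueqE t : node n <= t -> (if t <= node n then u t else u1 t) = u1 t.
  move=> nt; case: ifPn => // tn; have -> : t = node n by apply/eqP; rewrite eq_le nt tn.
  by rewrite uv// u1n.
split; try exact: bfun_patch.
- apply: (@prim_on_cat _ a (node n)).
  + exact: node_ge.
  + exact: node_le.
  + by apply: ueq_L1; exact: bfun_patch.
  + by apply: eq_prim_on pu => t _ tn; rewrite /ueq ?tn.
  + apply: eq_prim_on pu1 => t nt tn.
      by rewrite /ueq leNgt nt.
    by rewrite ueqE.
- move=> i; rewrite leq_eqVlt => /orP[/eqP ->|i_n].
    by rewrite ueqE// ?u1n1// node_le.
  by rewrite node_le// uv.
- move=> i; rewrite ltnS => i_n; case: ltnP => [lin|nli].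
    have [z1_ z2_ z3_] := zz i lin; split => //.
      by apply: eq_prim_on z2_ => // t _ ti; rewrite /zeq (lt_node i.+1).
    by move=> t it ti; rewrite (lt_node i.+1)// z3_.
  have -> : i = n by apply/eqP; rewrite eqn_leq i_n.
  split => //; first by apply: eq_prim_on pz1 => // t nt _; rewrite /zeq ueqE// ltW.
  by move=> t nt _; rewrite leNgt nt.
Qed.

Lemma eint_nodes u z u' z' : bfun u -> bfun z -> bfun u' -> bfun z' ->
  eint S sg a b u z u' z' = \sum_(i < N) eint S sg (node i) (node i.+1) u z u' z'.
Proof. by move=> bu bz bu' bz'; rewrite /eint oint_nodes//; exact: edens_L1. Qed.

(** [z] and [zeta i] agree on the half-open cell, so the integral only sees [zeta i] and [green]
    applies cell by cell. *)
Lemma broken_green u z zeta u' z' : broken_sol u z zeta -> form_elt S u' z' ->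
  eint S sg a b u z u' z' = \sum_(i < N) (zeta i (node i.+1) * u' (node i.+1) - zeta i (node i) *
    u' (node i)).
Proof.
move=> [[bu bz pu] zz] [bu' bz' pu'].
rewrite eint_nodes//; apply: eq_bigr => i _.
have [bzi pzi ziE] := zz i (ltn_ord i).
have pui : prim_on (node i) (node i.+1) (ueq S u' z') u'.
  by apply: prim_onS pu'; [exact: node_ge|exact: node_leb (ltn_ord i)].
rewrite -(green (ltW (node_lt i)) bu bzi bu' bz' pzi pui).
by apply: eq_oint => t it ti; rewrite /edens ziE.
Qed.

Lemma nodal_zero_coercive u z : form_elt S u z -> (forall i, (i <= N)%N -> u (node i) = 0) ->
  [/\ oint a b (fun t => w t * z t ^+ 2) / 2 <= eint S sg a b u z u z,
      oint a b (fun t => r t * u t ^+ 2) <= oint a b r * oint a b (fun t => w t * z t ^+ 2) &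
      forall x, a <= x <= b -> u x ^+ 2 <= oint a b (fun t => w t * z t ^+ 2)].
Proof.
move=> [bu bz pu] u0.
have piece i : (i < N)%N -> _ := fun iN =>
  @short_coercive _ S sg (node i) (node i.+1) u z (node_ge i) (node_lt i) (node_leb iN) bu bz
    (prim_onS (node_ge i) (node_leb iN) pu) (small iN) (u0 i (ltnW iN)).
have WL := wz2_L1 S bz; have RL := ru2_L1 S bu.
split.
- rewrite eint_nodes// oint_nodes// mulr_suml; apply: ler_sum => i _.
  by have [] := piece i (ltn_ord i).
- rewrite (oint_nodes RL) (oint_nodes WL) mulr_sumr; apply: ler_sum => i _.
  by have [] := piece i (ltn_ord i).
- move=> x /andP[ax xb]; have [i iN xi] := node_itv ax xb.
  have [_ _ /(_ x xi) h] := piece i iN; apply: (le_trans h).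
  apply: oint_sub => //; [exact: node_ge|exact/ltW/node_lt|exact: node_leb|].
  by move=> t; rewrite mulr_ge0// sqr_ge0.
Qed.

End Partition.
End Nodes.

(** * Global bounds and uniqueness *)

Section Bounds.
Context {R : realType} (S : sl_data R).
Implicit Types (c d x y t sg : R) (u z : R -> R).
Notation a := (sla S). Notation b := (slb S).
Notation w := (slw S). Notation q := (slq S). Notation r := (slr S). Notation s := (sls S).
Let ab : a < b := sl_lt S.
Let wi : L1 w := slw_L1 S. Let qi : L1 q := slq_L1 S.
Let ri : L1 r := slr_L1 S. Let si : L1 s := sls_L1 S.
Let w0 := slw_ge0 S. Let r0 := slr_ge0 S.

Lemma small_mesh_exists sg : exists2 N, (0 < N)%N & small_mesh S sg N.
Proof.
have hL : L1 (fun t => w t + `|s t| + `|q t| + `|sg| * r t).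
  by apply: L1D; [apply: L1D; [apply: L1D|]|] => //; [exact: L1_norm|exact: L1_norm|exact: L1Z].
have e0 : 0 < 1 / 8 :> R by rewrite divr_gt0.
have [N N0 H] := fine_partition ab hL e0.
exists N => // i iN; apply: ltW; have := H i iN.
rewrite (@eq_oint _ _ _ _ (fun t => w t + `|s t| + `|q t| + `|sg| * r t))//.
by move=> t _ _; rewrite ger0_norm// !addr_ge0// mulr_ge0.
Qed.

(** [sup_bound] averaged over its base point with the weight [r]. *)
Lemma point_bound c d x u z : a <= c -> c < d -> d <= b -> bfun u -> bfun z ->
  prim_on c d (ueq S u z) u -> oint c d (fun t => `|s t|) <= 1 / 2 -> c <= x <= d ->
  u x ^+ 2 <= 8 * (oint c d (fun t => r t * u t ^+ 2) / oint c d r) +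
              8 * (oint c d w * oint c d (fun t => w t * z t ^+ 2)).
Proof.
move=> ac cd db bu bz pu sm xcd.
have R0 : 0 < oint c d r by exact: slr_gt0.
set P := oint c d w * _.
have bu2 : bfun (fun t => u t ^+ 2) by exact: bfunM.
have RL := ru2_L1 S bu.
have : u x ^+ 2 * oint c d r <= 8 * oint c d (fun t => r t * u t ^+ 2) + 8 * P * oint c d r.
  rewrite -!ointZ// -ointD; [|exact: L1Z|exact: L1Z].
  apply: oint_le; [exact: L1Z|by apply: L1D; exact: L1Z|].
  move=> t ct td.
  have tcd : c <= t <= d by rewrite ltW.
  have := @sup_bound _ S c d t x u z ac cd db bu bz pu sm tcd xcd.
  rewrite -/P => h.
  have : u x ^+ 2 * r t <= (8 * u t ^+ 2 + 8 * P) * r t by rewrite ler_wpM2r.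
  lra.
rewrite -ler_pdivlMr// mulrDl => h; apply: (le_trans h).
by rewrite mulrA mulfK// gt_eqF.
Qed.

Lemma form_elt_null u z : form_elt S u z -> oint a b (fun t => r t * u t ^+ 2) = 0 ->
  forall x, a <= x <= b -> u x = 0.
Proof.
move=> [bu bz pu] G0 x /andP[ax xb].
set P := oint a b (fun t => w t * z t ^+ 2).
have P0 : 0 <= P by exact: wz2_ge0.
apply/eqP; rewrite -sqrf_eq0 eq_le sqr_ge0 andbT; apply/ler_addgt0Pr => e e0; rewrite add0r.
(* Where the weighted norm vanishes, [point_bound] leaves 8 times the integral of [w] over the cell
   times [P]; this factor makes that product less than [e]. *)
have hL : L1 (fun t => 16 * (P + e) / e * w t + `|s t|).
  by apply: L1D; [exact: L1Z|exact: L1_norm].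
have e2 : 0 < 1 / 2 :> R by rewrite divr_gt0.
have [N N0 mesh] := fine_partition ab hL e2.
have [i iN xi] := @node_itv _ S N N0 x ax xb.
have := mesh i iN; rewrite -/(node S N i) -/(node S N i.+1).
have kk : 0 <= 16 * (P + e) / e by rewrite divr_ge0 ?mulr_ge0 ?addr_ge0// ltW.
rewrite (@eq_oint _ _ _ _ (fun t => 16 * (P + e) / e * w t + `|s t|)); last first.
  by move=> t _ _; rewrite ger0_norm// addr_ge0// mulr_ge0.
rewrite ointD; [|exact: L1Z|exact: L1_norm].
rewrite ointZ//.
have an := node_ge S N0 i; have nb := node_leb S N0 iN; have nn := node_lt S N0 i.
have s0 : 0 <= oint (node S N i) (node S N i.+1) (fun t => `|s t|) by exact: oint_ge0.
have W0 : 0 <= oint (node S N i) (node S N i.+1) w by apply: oint_ge0.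
move=> sm.
have wk0 : 0 <= 16 * (P + e) / e * oint (node S N i) (node S N i.+1) w by rewrite mulr_ge0.
have sm2 : oint (node S N i) (node S N i.+1) (fun t => `|s t|) <= 1 / 2 by lra.
have := point_bound an nn nb bu bz (prim_onS an nb pu) sm2 xi.
have -> : oint (node S N i) (node S N i.+1) (fun t => r t * u t ^+ 2) = 0.
  apply/eqP; rewrite eq_le; apply/andP; split.
    rewrite -G0; apply: oint_sub => //; [exact: ltW|exact: ru2_L1|].
    by move=> t; rewrite mulr_ge0// sqr_ge0.
  by apply: oint_ge0 => t _ _; rewrite mulr_ge0// sqr_ge0.
rewrite mul0r mulr0 add0r => /le_trans; apply.
have Pi : oint (node S N i) (node S N i.+1) (fun t => w t * z t ^+ 2) <= P.
  apply: oint_sub => //; [exact: ltW|exact: wz2_L1|].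
  by move=> t; rewrite mulr_ge0// sqr_ge0.
have {}sm : 16 * (P + e) / e * oint (node S N i) (node S N i.+1) w <= 1 / 2 by lra.
rewrite mulrAC ler_pdivrMr// in sm.
move: (oint _ _ w) (oint _ _ (fun t => w t * _)) W0 sm Pi => W Q W0 sm QP.
have h1 : W * Q <= W * P by rewrite ler_wpM2l.
have h2 : 0 <= W * e by rewrite mulr_ge0// ltW.
nra.
Qed.

(** [T] collects all factors of the supremum of [u ^+ 2] in the negative terms. On a mesh where
    [T + 1] times the integral of [w] is below 1/16, that supremum is at most a multiple of the
    weighted norm plus [P / (2 (T + 1))], so the negative terms consume at most half of [P]. *)
Lemma form_lower_bound K : 0 <= K -> exists2 C, 0 <= C & forall u z, form_elt S u z ->
  - C * oint a b (fun t => r t * u t ^+ 2) <= eint S 0 a b u z u z - K * (u a ^+ 2 + u b ^+ 2).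
Proof.
move=> K0.
pose T := oint a b (fun t => `|q t|) + 2 * K.
have q0 : 0 <= oint a b (fun t => `|q t|) by apply: oint_ge0.
have T0 : 0 <= T by rewrite addr_ge0// mulr_ge0.
have hL : L1 (fun t => (T + 1) * w t + `|s t|).
  by apply: L1D; [exact: L1Z|exact: L1_norm].
have e2 : 0 < 1 / 16 :> R by rewrite divr_gt0.
have [N N0 mesh] := fine_partition ab hL e2.
have [rho rho0 rhoP] := @pos_lower_bound R 'I_N predT
  (fun i => oint (node S N i) (node S N i.+1) r)
  (fun i _ => slr_gt0 (node_ge S N0 i) (node_lt S N0 i) (node_leb S N0 (ltn_ord i))).
exists (8 / rho * T); first by rewrite mulr_ge0// divr_ge0// ltW.
move=> u z [bu bz pu].
set G := oint a b (fun t => r t * u t ^+ 2).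
set P := oint a b (fun t => w t * z t ^+ 2).
have P0 : 0 <= P by exact: wz2_ge0.
have G0 : 0 <= G by apply: oint_ge0 => t _ _; rewrite mulr_ge0// sqr_ge0.
have ubnd x : a <= x <= b -> u x ^+ 2 <= 8 / rho * G + P / (2 * (T + 1)).
  move=> /andP[ax xb]; have [i iN xi] := @node_itv _ S N N0 x ax xb.
  have := mesh i iN; rewrite -/(node S N i) -/(node S N i.+1).
  rewrite (@eq_oint _ _ _ _ (fun t => (T + 1) * w t + `|s t|)); last first.
    by move=> t _ _; rewrite ger0_norm// addr_ge0// mulr_ge0// addr_ge0.
  rewrite ointD; [|exact: L1Z|exact: L1_norm].
  rewrite ointZ//.
  have an := node_ge S N0 i; have nb := node_leb S N0 iN; have nn := node_lt S N0 i.
  have s0 : 0 <= oint (node S N i) (node S N i.+1) (fun t => `|s t|) by exact: oint_ge0.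
  have W0 : 0 <= oint (node S N i) (node S N i.+1) w by apply: oint_ge0.
  move=> sm.
  have TW : 0 <= (T + 1) * oint (node S N i) (node S N i.+1) w.
    by rewrite mulr_ge0// addr_ge0.
  have sm2 : oint (node S N i) (node S N i.+1) (fun t => `|s t|) <= 1 / 2 by lra.
  have := point_bound an nn nb bu bz (prim_onS an nb pu) sm2 xi.
  move=> /le_trans; apply; apply: lerD.
    rewrite -[leRHS]mulrA ler_wpM2l//.
    have R0 : 0 < oint (node S N i) (node S N i.+1) r by exact: slr_gt0.
    rewrite [leRHS]mulrC; apply: ler_pM.
    - by apply: oint_ge0 => t _ _; rewrite mulr_ge0// sqr_ge0.
    - by rewrite invr_ge0 ltW.
    - apply: oint_sub => //; [exact: ltW|exact: ru2_L1|].
      by move=> t; rewrite mulr_ge0// sqr_ge0.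
    - by rewrite lef_pV2 ?posrE// (rhoP (Ordinal iN)).
  have Pi : oint (node S N i) (node S N i.+1) (fun t => w t * z t ^+ 2) <= P.
    apply: oint_sub => //; [exact: ltW|exact: wz2_L1|].
    by move=> t; rewrite mulr_ge0// sqr_ge0.
  rewrite ler_pdivlMr; last by rewrite mulr_gt0// ltr_wpDl.
  move: (oint _ _ w) (oint _ _ (fun t => w t * _)) W0 sm TW Pi => W Q W0 sm TW QP.
  have h1 : (T + 1) * W * Q <= (T + 1) * W * P by rewrite ler_wpM2l.
  have h2 : (T + 1) * W * P <= 1 / 16 * P by rewrite ler_wpM2r//; lra.
  nra.
set M := 8 / rho * G + P / (2 * (T + 1)) in ubnd.
have M0 : 0 <= M.
  by apply: addr_ge0; [rewrite mulr_ge0// divr_ge0// ltW|rewrite divr_ge0// mulr_ge0// addr_ge0].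
have bu2 : bfun (fun t => u t ^+ 2) by exact: bfunM.
rewrite /eint (@eq_oint _ a b _ (fun t => w t * z t ^+ 2 + q t * u t ^+ 2)); last first.
  by move=> t _ _; rewrite /edens mul0r subr0 !expr2.
rewrite ointD; [|exact: wz2_L1|exact: L1M].
rewrite -/P.
have qu : oint a b (fun t => `|q t * u t ^+ 2|) <= M * oint a b (fun t => `|q t|).
  rewrite -ointZ; last exact: L1_norm.
  apply: oint_le; [exact: L1_norm (L1M qi bu2)|exact: L1Z (L1_norm qi)|].
  move=> t ct td; rewrite normrM mulrC ler_wpM2r// ger0_norm ?sqr_ge0// ubnd//.
  by rewrite ltW.
have := oint_norm a b (L1M qi bu2).
rewrite ler_norml => /andP[g1 g2].
have ua : u a ^+ 2 <= M by apply: ubnd; rewrite lexx ltW.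
have ub : u b ^+ 2 <= M by apply: ubnd; rewrite lexx ltW.
have Kab : K * (u a ^+ 2 + u b ^+ 2) <= K * (M + M) by rewrite ler_wpM2l// lerD.
have MT : M * T = 8 / rho * T * G + P * (T / (2 * (T + 1))).
  by rewrite /M; ring.
have : P * (T / (2 * (T + 1))) <= P * (1 / 2).
  rewrite ler_wpM2l// ler_pdivrMr ?mulr_gt0 ?ltr_wpDl//.
  by rewrite mulrA div1r mulVf// mul1r lerDl.
have : M * T = M * oint a b (fun t => `|q t|) + K * (M + M) by rewrite /T; ring.
move: g1 qu Kab MT; move: (oint _ _ _) => X; move: (oint _ _ _) => Y.
move: (M * oint _ _ _) => Z; lra.
Qed.

(** Local uniqueness propagates the zero initial data from node to node. *)
Lemma ode_unique sg u z : ode_sol S sg a b u z -> u a = 0 -> z a = 0 ->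
  forall x, a <= x <= b -> u x = 0 /\ z x = 0.
Proof.
move=> [bu bz pu pz] ua za.
have [N N0 sm] := small_mesh_exists sg.
have H n : (n <= N)%N -> u (node S N n) = 0 /\ z (node S N n) = 0.
  elim: n => [|n IH] nN; first by rewrite node0.
  have [un zn] := IH (ltnW nN).
  have sol : ode_sol S sg (node S N n) (node S N n.+1) u z.
    have h1 := node_ge S N0 n; have h2 := node_leb S N0 nN.
    by split => //; [exact: prim_onS pu|exact: prim_onS pz].
  have nn := ltW (node_lt S N0 n).
  apply: (ivp_unique nn (sm n nN) sol _ un zn); by rewrite ?lexx ?nn.
move=> x /andP[ax xb]; have [i iN xi] := @node_itv _ S N N0 x ax xb.
have [ui zi] := H i (ltnW iN).
have nn := ltW (node_lt S N0 i).
have sol : ode_sol S sg (node S N i) (node S N i.+1) u z.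
  have h1 := node_ge S N0 i; have h2 := node_leb S N0 iN.
  by split => //; [exact: prim_onS pu|exact: prim_onS pz].
by apply: (ivp_unique nn (sm i iN) sol _ ui zi xi); rewrite lexx nn.
Qed.

End Bounds.

(** * Form domain and Lagrangian boundary conditions *)

Section Complex.
Context {R : realType}.
Implicit Types x y : R[i].

Lemma conjcE (x y : R) : Num.conj (x +i* y) = x -i* y. Proof. by []. Qed.

Lemma Re_mul_conj x y :
  complex.Re (x * Num.conj y) = complex.Re x * complex.Re y + complex.Im x * complex.Im y.
Proof. by case: x => a b; case: y => c d; rewrite conjcE /=; ring. Qed.

Lemma Im_mul_conj x y :
  complex.Im (x * Num.conj y) = complex.Im x * complex.Re y - complex.Re x * complex.Im y.
Proof. by case: x => a b; case: y => c d; rewrite conjcE /=; ring. Qed.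

Lemma ReB x y : complex.Re (x - y) = complex.Re x - complex.Re y.
Proof. by case: x; case: y. Qed.

Lemma complex_eq x y : complex.Re x = complex.Re y -> complex.Im x = complex.Im y -> x = y.
Proof. by case: x => a b; case: y => c d /= -> ->. Qed.

Definition vec2 x y : 'cV[R[i]]_2 := \col_(i < 2) (if i == 0 then x else y).

Lemma vec2_0 x y : vec2 x y 0 0 = x. Proof. by rewrite mxE. Qed.
Lemma vec2_1 x y : vec2 x y 1 0 = y. Proof. by rewrite mxE. Qed.

Lemma vec2_lin k x y x' y' : k *: vec2 x y + vec2 x' y' = vec2 (k * x + x') (k * y + y').
Proof. by apply/matrixP => i j; rewrite !mxE; case: ifP. Qed.

Lemma vec2E (X : 'cV[R[i]]_2) : X = vec2 (X 0 0) (X 1 0).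
Proof.
apply/matrixP => i j; rewrite !mxE (ord1 j).
by case: i => -[|[|//]] h; congr (X _ _); exact/val_inj.
Qed.

(** The Lagrange bracket of two boundary vectors; the difference of its values at the two ends is
    the obstruction to symmetry of the form. *)
Definition symplectic (X Y : 'cV[R[i]]_2) : R[i] :=
  X 1 0 * Num.conj (Y 0 0) - X 0 0 * Num.conj (Y 1 0).

(* [lag_iso] and [lag_max] say that [L] is Lagrangian for the Lagrange bracket;
   by [lag_bound] the boundary term of the form is controlled by the values of
   the functions alone, which makes the form bounded below. *)
Record lagrangian_bc (L : @boundary_condition R) : Prop := LagrangianBc {
  lag0 : L 0 0;
  lagP : forall k X Y X' Y', L X Y -> L X' Y' -> L (k *: X + X') (k *: Y + Y');
  lag_iso : forall X Y X' Y', L X Y -> L X' Y' -> symplectic X X' = symplectic Y Y';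
  lag_max : forall X Y, (forall X' Y', L X' Y' -> symplectic X X' = symplectic Y Y') -> L X Y;
  lag_bound : exists2 K, 0 <= K & forall X Y, L X Y ->
    complex.Re (Y 1 0 * Num.conj (Y 0 0) - X 1 0 * Num.conj (X 0 0)) <=
    K * (complex.Re (X 0 0) ^+ 2 + complex.Im (X 0 0) ^+ 2 +
         complex.Re (Y 0 0) ^+ 2 + complex.Im (Y 0 0) ^+ 2) }.
End Complex.

Section FormDomain.
Context {R : realType} (S : sl_data R) (L : @boundary_condition R).
Hypothesis HL : lagrangian_bc L.
Implicit Types (c : bool) (t x y sg k : R).
Notation a := (sla S). Notation b := (slb S).
Notation w := (slw S). Notation q := (slq S). Notation r := (slr S). Notation s := (sls S).
Let ab : a < b := sl_lt S.
Let qi : L1 q := slq_L1 S.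
Let ri : L1 r := slr_L1 S.
Let r0 := slr_ge0 S.

(* An element gathers the real ([c = false]) and imaginary ([c = true]) parts of
   a function, of its quasi-derivative, and of boundary values of the latter;
   the last two are only linked by the equation once the element is a solution. *)
Definition fspace : lmodType R := (bool * (R + R + bool))%type -> R^o.
Implicit Types f g : fspace.

Definition fu f c : R -> R := fun t => f (c, inl (inl t)).
Definition fz f c : R -> R := fun t => f (c, inl (inr t)).
Definition fal f c : R := f (c, inr false).
Definition fbe f c : R := f (c, inr true).
Definition fmk (u z : bool -> R -> R) (al be : bool -> R) : fspace := fun p =>
  match p with
  | (c, inl (inl t)) => u c t
  | (c, inl (inr t)) => z c t
  | (c, inr false) => al c
  | (c, inr true) => be c
  end.

Lemma fuP k f g c : fu (k *: f + g) c = fun t => k * fu f c t + fu g c t.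
Proof. by []. Qed.
Lemma fzP k f g c : fz (k *: f + g) c = fun t => k * fz f c t + fz g c t.
Proof. by []. Qed.
Lemma falP k f g c : fal (k *: f + g) c = k * fal f c + fal g c.
Proof. by []. Qed.
Lemma fbeP k f g c : fbe (k *: f + g) c = k * fbe f c + fbe g c.
Proof. by []. Qed.

Definition Ya f := vec2 (fu f false a +i* fu f true a) (fal f false +i* fal f true).
Definition Yb f := vec2 (fu f false b +i* fu f true b) (fbe f false +i* fbe f true).

Definition Dform f : Prop := (forall c, form_elt S (fu f c) (fz f c)) /\ L (Ya f) (Yb f).

Definition Gc f g c := oint a b (fun t => r t * (fu f c t * fu g c t)).
Definition Gform f g := Gc f g false + Gc f g true.
(** The boundary term cancels the one produced by [green], so that an eigenelement pairs with [D] as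
    a multiple of [Gform]. It uses the stored values, because [fz] has no meaningful values at the
    ends for a general element. *)
Definition Bc f g c := eint S 0 a b (fu f c) (fz f c) (fu g c) (fz g c) -
  (fbe f c * fu g c b - fal f c * fu g c a).
Definition Bform f g := Bc f g false + Bc f g true.

Lemma cplx_lin (k x y x' y' : R) :
  (k * x + x') +i* (k * y + y') = k%:C * (x +i* y) + (x' +i* y').
Proof. by apply: complex_eq => /=; ring. Qed.

Lemma YaP k f g : Ya (k *: f + g) = k%:C *: Ya f + Ya g.
Proof. by rewrite vec2_lin -!cplx_lin. Qed.
Lemma YbP k f g : Yb (k *: f + g) = k%:C *: Yb f + Yb g.
Proof. by rewrite vec2_lin -!cplx_lin. Qed.

Lemma form_eltP k u z u' z' : form_elt S u z -> form_elt S u' z' ->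
  form_elt S (fun t => k * u t + u' t) (fun t => k * z t + z' t).
Proof.
move=> [bu bz pu] [bu' bz' pu']; split; try exact: bfunP.
have := prim_on_lin k (ueq_L1 S bu bz) (ueq_L1 S bu' bz') pu pu'.
by apply: eq_prim_on => // t _ _; rewrite ueq_lin.
Qed.

Lemma form_elt0 : form_elt S (fun=> 0) (fun=> 0).
Proof.
split; try exact: bfun_cst.
move=> x y _ _ _; rewrite subrr (@eq_oint _ _ _ _ (fun=> 0)); last first.
  by move=> t _ _; rewrite /ueq !mulr0 addr0.
by rewrite /oint Rintegral_cst// mul0r.
Qed.

Lemma vec2_00 : vec2 (0 +i* 0) (0 +i* 0) = 0 :> 'cV[R[i]]_2.
Proof. by apply/matrixP => i j; rewrite !mxE; case: ifP. Qed.

Lemma Dform0 : Dform 0.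
Proof.
split; first by move=> c; exact: form_elt0.
by rewrite /Ya /Yb /fu /fal /fbe /= vec2_00; exact: lag0 HL.
Qed.

Lemma DformP k f g : Dform f -> Dform g -> Dform (k *: f + g).
Proof.
move=> [ef Lf] [eg Lg]; split; first by move=> c; exact: (form_eltP k (ef c) (eg c)).
by rewrite YaP YbP; exact: lagP.
Qed.

Lemma Dbfun f c : Dform f -> bfun (fu f c) /\ bfun (fz f c).
Proof. by move=> [H _]; have [bu bz _] := H c. Qed.

Lemma eint_lin sg x y k u z u' z' u2 z2 : bfun u -> bfun z -> bfun u' -> bfun z' ->
  bfun u2 -> bfun z2 ->
  eint S sg x y (fun t => k * u t + u' t) (fun t => k * z t + z' t) u2 z2 =
  k * eint S sg x y u z u2 z2 + eint S sg x y u' z' u2 z2.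
Proof.
move=> bu bz bu' bz' bu2 bz2.
have e1 := edens_L1 S sg bu bz bu2 bz2; have e2 := edens_L1 S sg bu' bz' bu2 bz2.
rewrite /eint -ointZ// -ointD//; last exact: L1Z.
by apply: eq_oint => t _ _; rewrite /edens; ring.
Qed.

Lemma eintC sg x y u z u' z' : eint S sg x y u z u' z' = eint S sg x y u' z' u z.
Proof. by apply: eq_oint => t _ _; rewrite /edens; ring. Qed.

Lemma ruu_L1 u u' : bfun u -> bfun u' -> L1 (fun t => r t * (u t * u' t)).
Proof. by move=> bu bu'; apply: L1M => //; exact: bfunM. Qed.

Lemma Gform_sym : symmetric_form_on Dform Gform.
Proof.
split=> [k f g h Df Dg Dh|f g Df Dg]; last first.
  by rewrite /Gform /Gc; congr (_ + _); apply: eq_oint => t _ _; rewrite [fu f _ t * _]mulrC.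
have E c : Gc (k *: f + g) h c = k * Gc f h c + Gc g h c.
  have [bf _] := Dbfun c Df; have [bg _] := Dbfun c Dg; have [bh _] := Dbfun c Dh.
  have l1 := ruu_L1 bf bh; have l2 := ruu_L1 bg bh.
  rewrite /Gc -ointZ// -ointD//; last exact: L1Z.
  by apply: eq_oint => t _ _; rewrite fuP; ring.
by rewrite /Gform !E; ring.
Qed.

Lemma symplectic_re f g : complex.Re (symplectic (Ya f) (Ya g)) =
  fal f false * fu g false a + fal f true * fu g true a -
  (fal g false * fu f false a + fal g true * fu f true a).
Proof. by rewrite /symplectic !vec2_0 !vec2_1 ReB !Re_mul_conj /=; ring. Qed.

Lemma symplectic_reb f g : complex.Re (symplectic (Yb f) (Yb g)) =
  fbe f false * fu g false b + fbe f true * fu g true b -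
  (fbe g false * fu f false b + fbe g true * fu f true b).
Proof. by rewrite /symplectic !vec2_0 !vec2_1 ReB !Re_mul_conj /=; ring. Qed.

(** The energy integral is symmetric by itself; the boundary terms are symmetric by the real part of
    the isotropy identity. *)
Lemma Bform_sym : symmetric_form_on Dform Bform.
Proof.
split=> [k f g h Df Dg Dh|f g Df Dg].
  have E c : Bc (k *: f + g) h c = k * Bc f h c + Bc g h c.
    have [bf zf] := Dbfun c Df; have [bg zg] := Dbfun c Dg; have [bh zh] := Dbfun c Dh.
    by rewrite /Bc fuP fzP eint_lin// falP fbeP; ring.
  by rewrite /Bform !E; ring.
have := congr1 (fun Z : R[i] => complex.Re Z) (lag_iso HL Df.2 Dg.2); rewrite symplectic_re
  symplectic_reb => E.
by rewrite /Bform /Bc !(eintC 0 a b (fu g _)); lra.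
Qed.

Lemma GcE f c : Gc f f c = oint a b (fun t => r t * fu f c t ^+ 2).
Proof. by apply: eq_oint => t _ _; rewrite expr2. Qed.

Lemma Gc_ge0 f c : 0 <= Gc f f c.
Proof. by rewrite GcE; apply: oint_ge0 => t _ _; rewrite mulr_ge0// sqr_ge0. Qed.

Lemma Gform_ge0 f : Dform f -> 0 <= Gform f f.
Proof. by move=> _; rewrite addr_ge0// Gc_ge0. Qed.

Lemma Gform_null f : Dform f -> Gform f f = 0 -> forall c x, a <= x <= b -> fu f c x = 0.
Proof.
move=> Df G0 c; apply: form_elt_null; first exact: Df.1 c.
have := Gc_ge0 f false; have := Gc_ge0 f true; move: G0; rewrite /Gform -GcE.
by case: c; lra.
Qed.

Lemma Bform_lower : exists C, forall f, Dform f -> - C * Gform f f <= Bform f f.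
Proof.
have [K K0 KP] := lag_bound HL.
have [C C0 CP] := form_lower_bound S K0.
exists C => f Df; have := KP _ _ Df.2.
rewrite !vec2_0 !vec2_1 ReB !Re_mul_conj /= => h.
have h1 := CP _ _ (Df.1 false); have h2 := CP _ _ (Df.1 true).
rewrite -!GcE in h1 h2; rewrite /Gform /Bform /Bc; lra.
Qed.

Lemma eint_shift sg f g c : Dform f -> Dform g ->
  eint S sg a b (fu f c) (fz f c) (fu g c) (fz g c) =
  eint S 0 a b (fu f c) (fz f c) (fu g c) (fz g c) - sg * Gc f g c.
Proof.
move=> Df Dg; have [bf zf] := Dbfun c Df; have [bg zg] := Dbfun c Dg.
have l1 := ruu_L1 bf bg.
rewrite /eint /Gc -ointZ// -ointB//; [|exact: edens_L1|exact: L1Z].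
by apply: eq_oint => t _ _; rewrite /edens; ring.
Qed.

Lemma shifted_form sg f g : Dform f -> Dform g -> Bform f g - sg * Gform f g =
  (eint S sg a b (fu f false) (fz f false) (fu g false) (fz g false) -
     (fbe f false * fu g false b - fal f false * fu g false a)) +
  (eint S sg a b (fu f true) (fz f true) (fu g true) (fz g true) -
     (fbe f true * fu g true b - fal f true * fu g true a)).
Proof.
by move=> Df Dg; rewrite (eint_shift sg false Df Dg) (eint_shift sg true Df Dg) /Bform /Bc /Gform; ring.
Qed.

Section AtMesh.
Variables (sg : R) (N : nat).
Hypotheses (N0 : (0 < N)%N) (sm : small_mesh S sg N).

Definition nodal_zero f := forall c i, (i <= N)%N -> fu f c (node S N i) = 0.
Definition broken f (zeta : bool -> nat -> R -> R) :=
  forall c, broken_sol S sg N (fu f c) (fz f c) (zeta c).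

Lemma broken_interp (v : bool -> nat -> R) (al be : bool -> R) :
  L (vec2 (v false 0%N +i* v true 0%N) (al false +i* al true))
    (vec2 (v false N +i* v true N) (be false +i* be true)) ->
  exists f zeta, [/\ Dform f, broken f zeta,
    forall c i, (i <= N)%N -> fu f c (node S N i) = v c i &
    forall c, fal f c = al c /\ fbe f c = be c].
Proof.
move=> Lv.
have /choice[F HF] : forall c, exists F : (R -> R) * (R -> R) * (nat -> R -> R),
    broken_sol S sg N F.1.1 F.1.2 F.2 /\ forall i, (i <= N)%N -> F.1.1 (node S N i) = v c i.
  by move=> c; have [u [z [zt [h1 h2]]]] := nodal_interp N0 sm (v c); exists (u, z, zt).
exists (fmk (fun c => (F c).1.1) (fun c => (F c).1.2) al be), (fun c => (F c).2).
have H c : form_elt S (F c).1.1 (F c).1.2 by have [[]] := HF c.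
have va c : (F c).1.1 a = v c 0%N by rewrite -(node0 S N); apply: (HF c).2.
have vb c : (F c).1.1 b = v c N by rewrite -(nodeN S N0); apply: (HF c).2.
split => //.
- by split => //; rewrite /Ya /Yb /fu /fal /fbe /= !va !vb.
- by move=> c; have [] := HF c.
- by move=> c; have [] := HF c.
Qed.

Lemma broken_form f zeta g : Dform f -> broken f zeta -> Dform g ->
  Bform f g - sg * Gform f g =
  (\sum_(i < N) (zeta false i (node S N i.+1) * fu g false (node S N i.+1) -
     zeta false i (node S N i) * fu g false (node S N i)) -
     (fbe f false * fu g false b - fal f false * fu g false a)) +
  (\sum_(i < N) (zeta true i (node S N i.+1) * fu g true (node S N i.+1) -
     zeta true i (node S N i) * fu g true (node S N i)) -
     (fbe f true * fu g true b - fal f true * fu g true a)).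
Proof.
move=> Df Bf Dg; rewrite shifted_form//.
by rewrite !(broken_green N0 (Bf _))//; [exact: Dg.1|exact: Dg.1].
Qed.

Lemma broken_orth f zeta g : Dform f -> broken f zeta -> Dform g -> nodal_zero g ->
  Bform f g - sg * Gform f g = 0.
Proof.
move=> Df Bf Dg g0; rewrite (broken_form Df Bf Dg).
have E c : \sum_(i < N) (zeta c i (node S N i.+1) * fu g c (node S N i.+1) -
     zeta c i (node S N i) * fu g c (node S N i)) = 0.
  by rewrite big1// => i _; rewrite !g0 ?mulr0 ?subrr// ltnW.
have ga c : fu g c a = 0 by rewrite -(node0 S N) g0.
have gb c : fu g c b = 0 by rewrite -(nodeN S N0) g0.
by rewrite !E !ga !gb !mulr0 !subrr addr0.
Qed.

Lemma nodal_zero_form f : Dform f -> nodal_zero f ->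
  1 / (2 * (oint a b r + 1)) * Gform f f <= Bform f f - sg * Gform f f.
Proof.
move=> Df f0; rewrite shifted_form//.
have ga c : fu f c a = 0 by rewrite -(node0 S N) f0.
have gb c : fu f c b = 0 by rewrite -(nodeN S N0) f0.
rewrite !ga !gb !mulr0 !subrr !subr0 mulrDr.
have R0 : 0 < oint a b r by exact: slr_gt0.
have E c : 1 / (2 * (oint a b r + 1)) * Gc f f c <=
    eint S sg a b (fu f c) (fz f c) (fu f c) (fz f c).
  have [h1 h2 _] := nodal_zero_coercive N0 sm (Df.1 c) (f0 c).
  apply: le_trans h1; rewrite GcE div1r mulrC ler_pdivrMr; last first.
    by rewrite mulr_gt0// ltr_wpDl// ltW.
  have := wz2_ge0 S a b (fz f c); move: (oint a b (fun t => w t * _)) h2 => P h2 P0.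
  lra.
exact: lerD.
Qed.

End AtMesh.

(** [nod] lists the values of both parts at all nodes. An element in its kernel may still carry
    nonzero stored boundary values, but these are multiplied by zero function values in the form.
    The projection is the broken interpolant with the same stored values, hence with the same
    boundary data. *)
Lemma Dform_finite_index sg : finite_index_at Dform Bform Gform sg.
Proof.
have [N N0 sm] := small_mesh_exists S sg.
pose I : finType := (bool * 'I_N.+1)%type.
pose pt (j : 'I_#|{: I}|) : bool * 'I_N.+1 := enum_val j.
pose nod f : 'rV[R]_#|{: I}| := \row_j fu f (pt j).1 (node S N (pt j).2).
have nod0P f : nod f = 0 <-> nodal_zero N f.
  split => [/rowP f0 c i iN|f0]; last first.
    by apply/rowP => j; rewrite !mxE; apply: f0; rewrite -ltnS.
  have := f0 (enum_rank (c, Ordinal (iN : (i < N.+1)%N))).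
  by rewrite !mxE /pt enum_rankK.
exists #|{: I}|, nod, (1 / (2 * (oint a b r + 1))).
have R0 : 0 < oint a b r by exact: slr_gt0.
split.
- by rewrite divr_gt0// mulr_gt0// ltr_wpDl// ltW.
- by move=> k f g; apply/rowP => j; rewrite !mxE.
- by move=> g Dg /nod0P g0; exact: (nodal_zero_form N0 sm).
- move=> x Dx Gx; apply/nod0P => c i iN; apply: Gform_null => //.
  by rewrite node_ge// node_leb.
- move=> f Df.
  have [|x [zeta [Dx bx xv xab]]] := @broken_interp sg N N0 sm
    (fun c i => fu f c (node S N i)) (fal f) (fbe f).
    by rewrite node0 (nodeN S N0); exact: Df.2.
  exists x; split => //.
    by apply/rowP => j; rewrite !mxE xv// -ltnS.
  by move=> g Dg /nod0P g0; exact: (broken_orth N0 Dx bx).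
Qed.

End FormDomain.

(** * Kernel elements are eigenfunctions *)

Section Kernel.
Context {R : realType} (S : sl_data R) (L : @boundary_condition R).
Hypothesis HL : lagrangian_bc L.
Implicit Types (c : bool) (t x y sg k : R).
Notation a := (sla S). Notation b := (slb S).
Let ab : a < b := sl_lt S.
Implicit Types f g : @fspace R.
Notation D := (Dform S L). Notation B := (Bform S). Notation G := (Gform S).

Lemma sum_delta_node (N i : nat) (F : nat -> R) (iN : (i < N)%N) :
  \sum_(l < N) F l * ((l : nat) == i)%:R = F i.
Proof.
rewrite (bigD1 (Ordinal iN))//= eqxx mulr1 big1 ?addr0// => l /negbTE li.
by rewrite -val_eqE /= in li; rewrite li mulr0.
Qed.

Lemma telescope_node N (F : nat -> R) : \sum_(l < N) (F l.+1 - F l) = F N - F 0%N.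
Proof.
elim: N => [|N IH]; first by rewrite big_ord0 subrr.
by rewrite big_ord_recr /= IH; ring.
Qed.

Section AtMesh.
Variables (sg : R) (N : nat).
Hypotheses (N0 : (0 < N)%N) (sm : small_mesh S sg N).
Notation node := (node S N).
Variables (x : @fspace R) (zeta : bool -> nat -> R -> R).
Hypotheses (Dx : D x) (bx : broken S sg N x zeta).
Hypothesis orth : forall g xi, D g -> broken S sg N g xi -> B x g - sg * G x g = 0.

(** The test element equal to 1 at one interior node, in one component, and to 0 at all other nodes
    isolates the jump of the quasi-derivative there. *)
Lemma kernel_matching c i : (i.+1 < N)%N -> zeta c i (node i.+1) = zeta c i.+1 (node i.+1).
Proof.
move=> iN; have iN' := ltnW iN.
pose v (c' : bool) (l : nat) : R := ((c' == c) && (l == i.+1))%:R.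
have v0 c' : v c' 0%N = 0 by rewrite /v andbF.
have vN c' : v c' N = 0 by rewrite /v (gtn_eqF iN) andbF.
have [|g [xi [Dg bg gv gab]]] := @broken_interp R S L sg N N0 sm v (fun=> 0) (fun=> 0).
  by rewrite !v0 !vN vec2_00; exact: lag0 HL.
have := orth Dg bg; rewrite (broken_form N0 Dx bx Dg).
have ga c' : fu g c' a = 0 by rewrite -(node0 S N) gv// v0.
have gb c' : fu g c' b = 0 by rewrite -(nodeN S N0) gv// vN.
rewrite !ga !gb !mulr0 !subrr !subr0.
have E c' : \sum_(l < N) (zeta c' l (node l.+1) * fu g c' (node l.+1) -
    zeta c' l (node l) * fu g c' (node l)) =
    (c' == c)%:R * (zeta c' i (node i.+1) - zeta c' i.+1 (node i.+1)).
  rewrite mulrBr -(sum_delta_node (fun l => zeta c' l (node l.+1)) iN').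
  rewrite -(sum_delta_node (fun l => zeta c' l (node l)) iN).
  rewrite !mulr_sumr -sumrB; apply: eq_bigr => l _.
  rewrite !gv//; last exact: ltnW.
  rewrite /v; case: (c' == c); rewrite /= ?mul1r ?mulr0 ?mul0r ?eqSS//.
by rewrite !E; case: c {v v0 vN gv E} => /=; lra.
Qed.

(** [fz x] is tied to [zeta] only to the right of [a], so the value at [a] itself has to be
    supplied. *)
Definition zglue c t := if t <= a then zeta c 0%N a else fz x c t.

Lemma zglue_node c i t : (i < N)%N -> node i <= t -> t <= node i.+1 -> zglue c t = zeta c i t.
Proof.
move=> iN it ti; rewrite /zglue.
have [_ zz] := bx c; have [_ _ zE] := zz i iN.
have an := node_ge S N0 i.
move: it; rewrite le_eqVlt => /orP[/eqP it|it]; last first.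
  by rewrite leNgt (le_lt_trans an it)/= zE.
rewrite -it; case: i iN ti zE an it => [|i] iN ti zE an it.
  by rewrite node0 lexx.
have ai : a < node i.+1 by rewrite (le_lt_trans (node_ge S N0 i))// node_lt.
rewrite leNgt ai /=.
have [_ _ ->] := zz i (ltnW iN); [exact: kernel_matching|exact: node_lt|by []].
Qed.

Lemma zglue_sol c : ode_sol S sg a b (fu x c) (zglue c).
Proof.
have [[bu bz pu] zz] := bx c.
have bZ : bfun (zglue c) by apply: bfun_patch => //; exact: bfun_cst.
split => //.
  by apply: eq_prim_on pu => // t at_ tb; rewrite /ueq /zglue leNgt at_.
suff H n : (n <= N)%N -> prim_on a (node n) (zeq S sg (fu x c) (zglue c)) (zglue c).
  by have := H N (leqnn N); rewrite (nodeN S N0).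
elim: n => [|n IH] nN.
  move=> s t as_ st; rewrite node0 => ta.
  have -> : t = s by apply/eqP; rewrite eq_le st (le_trans ta).
  by rewrite subrr ointxx.
apply: (prim_on_cat _ _ _ (IH (ltnW nN))).
- exact: node_ge.
- exact: ltW (node_lt S N0 n).
- exact: zeq_L1.
have [bzn pzn _] := zz n nN.
apply: eq_prim_on pzn => [t nt tn|t nt tn].
  by rewrite /zeq (@zglue_node c n)// ltW.
by rewrite (@zglue_node c n).
Qed.

(** Once the jumps vanish, the sums over the cells telescope to the two ends. *)
Lemma kernel_boundary g xi : D g -> broken S sg N g xi ->
  (zglue false b - fbe x false) * fu g false b + (zglue true b - fbe x true) * fu g true b =
  (zglue false a - fal x false) * fu g false a + (zglue true a - fal x true) * fu g true a.
Proof.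
move=> Dg bg; have := orth Dg bg; rewrite (broken_form N0 Dx bx Dg).
have E c : \sum_(l < N) (zeta c l (node l.+1) * fu g c (node l.+1) -
    zeta c l (node l) * fu g c (node l)) = zglue c b * fu g c b - zglue c a * fu g c a.
  have -> : zglue c b * fu g c b - zglue c a * fu g c a =
    zglue c (node N) * fu g c (node N) - zglue c (node 0) * fu g c (node 0).
    by rewrite (nodeN S N0) node0.
  rewrite -(@telescope_node N (fun l => zglue c (node l) * fu g c (node l))).
  apply: eq_bigr => l _; congr (_ * _ - _ * _).
    by rewrite (@zglue_node c l)//; exact: ltW (node_lt S N0 l).
  by rewrite (@zglue_node c l)//; exact: ltW (node_lt S N0 l).
rewrite !E; lra.
Qed.

(** Let [da], [db] be the differences between the true and the stored boundary values of the
    quasi-derivative. Testing against all of [L] shows that the pair with zero function values and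
    these quasi-derivatives is skew-orthogonal to [L], hence in [L] by maximality; adding it to the
    stored data gives the true data. *)
Lemma zglue_bc : L (vec2 (fu x false a +i* fu x true a) (zglue false a +i* zglue true a))
                   (vec2 (fu x false b +i* fu x true b) (zglue false b +i* zglue true b)).
Proof.
pose da := (zglue false a - fal x false) +i* (zglue true a - fal x true).
pose db := (zglue false b - fbe x false) +i* (zglue true b - fbe x true).
have real_part X Y : L X Y -> complex.Re (da * Num.conj (X 0 0)) = complex.Re (db * Num.conj (Y 0 0)).
  move=> LXY.
  have parts (z : R[i]) : complex.Re z +i* complex.Im z = z by case: z.
  pose ri (c : bool) (z : R[i]) := if c then complex.Im z else complex.Re z.
  pose v (c : bool) (l : nat) : R := if l is 0%N then ri c (X 0 0) else ri c (Y 0 0).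
  have vN c : v c N = ri c (Y 0 0) by rewrite /v; case: (N) N0.
  have [|g [xi [Dg bg gv gab]]] := @broken_interp R S L sg N N0 sm v
      (fun c => ri c (X 1 0)) (fun c => ri c (Y 1 0)).
    by rewrite !vN /v /ri /= !parts -!vec2E.
  have := kernel_boundary Dg bg.
  have ga c : fu g c a = ri c (X 0 0) by rewrite -(node0 S N) gv.
  have gb c : fu g c b = ri c (Y 0 0) by rewrite -(nodeN S N0) gv// vN.
  by rewrite !ga !gb !Re_mul_conj /ri /=.
(* The form being real, tests only give real parts; replacing the test vector by [i] times itself
   gives the imaginary parts. *)
have full X Y : L X Y -> da * Num.conj (X 0 0) = db * Num.conj (Y 0 0).
  move=> LXY; apply: complex_eq; first exact: real_part.
  have := real_part _ _ (lagP HL (0 +i* 1) LXY (lag0 HL)).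
  rewrite !addr0 ![((_ *: _) : 'cV_2) 0 0]mxE !Re_mul_conj !Im_mul_conj.
  by case: (X 0 0) => X1 X2; case: (Y 0 0) => Y1 Y2 /=; lra.
have L0 : L (vec2 0 da) (vec2 0 db).
  apply: (lag_max HL) => X Y LXY.
  by rewrite /symplectic !vec2_0 !vec2_1 !mul0r !subr0; exact: full.
have := lagP HL 1 L0 Dx.2; rewrite /Ya /Yb !vec2_lin !mulr0 !add0r !mul1r.
by rewrite /da /db; congr (L (vec2 _ _) (vec2 _ _)); apply: complex_eq => /=; ring.
Qed.

End AtMesh.

(** Let [x] be the broken interpolant of [f] and [n = f - x], which vanishes at the nodes. As [f] is
    in the kernel and [x] is orthogonal to [n], the shifted form vanishes at [n]; coercivity then
    gives [f = x] on [[a, b]], and [x] inherits orthogonality to the broken elements. *)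
Lemma kernel_solution sg f : D f -> (forall g, D g -> B f g - sg * G f g = 0) ->
  exists Z : bool -> R -> R, (forall c, ode_sol S sg a b (fu f c) (Z c)) /\
    L (vec2 (fu f false a +i* fu f true a) (Z false a +i* Z true a))
      (vec2 (fu f false b +i* fu f true b) (Z false b +i* Z true b)).
Proof.
move=> Df orthf.
have [N N0 sm] := small_mesh_exists S sg.
have [|x [zeta [Dx bx xv xab]]] := @broken_interp R S L sg N N0 sm
  (fun c i => fu f c (node S N i)) (fal f) (fbe f).
  by rewrite node0 (nodeN S N0); exact: Df.2.
pose n := -1 *: x + f.
have Dn : D n := DformP HL (-1) Dx Df.
have n0 : nodal_zero S N n by move=> c i iN; rewrite /n fuP xv//; ring.
have [B1 B2] := Bform_sym S HL; have [G1 G2] := Gform_sym S L.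
have nform g : D g -> B n g - sg * G n g = - (B x g - sg * G x g).
  move=> Dg; have := orthf g Dg; rewrite (B1 (-1) x f g Dx Df Dg) (G1 (-1) x f g Dx Df Dg).
  move: (B x g) (B f g) (G x g) (G f g) => b1 b2 g1 g2; lra.
have orthx g xi : D g -> broken S sg N g xi -> B x g - sg * G x g = 0.
  move=> Dg bg.
  have := broken_orth N0 Dg bg Dn n0; rewrite (B2 g n Dg Dn) (G2 g n Dg Dn) nform//.
  by move/eqP; rewrite oppr_eq0 => /eqP.
have fx c t : a <= t <= b -> fu f c t = fu x c t.
  have Gn : G n n = 0.
    have := nodal_zero_form N0 sm Dn n0.
    rewrite (nform n Dn) (broken_orth N0 Dx bx Dn n0) oppr0.
    have R0 : 0 < oint a b (slr S) by exact: slr_gt0.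
    have k0 : 0 < 1 / (2 * (oint a b (slr S) + 1)).
      by rewrite divr_gt0// mulr_gt0// ltr_wpDl// ltW.
    rewrite pmulr_rle0// => h; apply/eqP; rewrite eq_le h; exact: (Gform_ge0 Dn).
  move=> tab; have := Gform_null Dn Gn c tab; rewrite /n fuP; lra.
exists (zglue x zeta); split.
  move=> c; have [bu bz pu pz] := zglue_sol N0 sm Dx bx orthx c.
  have [bf _] := Dbfun c Df.
  have fx' t : a <= t -> t <= b -> fu x c t = fu f c t by move=> h1 h2; rewrite fx// h1.
  split => //.
    apply: eq_prim_on pu => // t at_ tb; by rewrite /ueq fx'// ltW.
  by apply: eq_prim_on pz => // t at_ tb; rewrite /zeq fx'// ltW.
have := zglue_bc N0 sm Dx bx orthx.
by rewrite !fx// ?lexx ?ltW.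
Qed.

End Kernel.

Lemma exists_kernel_family (F : fieldType) (I J : finType) (A : I -> J -> F) :
  exists k (X : 'I_k -> I -> F), [/\ (#|I| - #|J| <= k)%N,
    forall l j, \sum_i X l i * A i j = 0 &
    forall a : 'I_k -> F, (forall i, \sum_l a l * X l i = 0) -> forall l, a l = 0].
Proof.
pose M : 'M[F]_(#|I|, #|J|) := \matrix_(i, j) A (enum_val i) (enum_val j).
pose K := row_base (kermx M).
exists (\rank (kermx M)), (fun l i => K l (enum_rank i)); split.
- by rewrite mxrank_ker leq_sub2l// rank_leq_col.
- move=> l j; have : K *m M = 0.
    by apply/sub_kermxP; rewrite eq_row_base.
  move=> /matrixP/(_ l (enum_rank j)); rewrite !mxE => E; rewrite -[RHS]E.
  rewrite (reindex _ (onW_bij _ (@enum_val_bij I)))/=.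
  by apply: eq_bigr => i _; rewrite enum_valK !mxE enum_rankK.
- move=> a aK; have /row_freeP[Q KQ] : row_free K by exact: row_base_free.
  have aK0 : (\row_l a l) *m K = 0.
    apply/rowP => i; rewrite !mxE -[RHS](aK (enum_val i)).
    by apply: eq_bigr => l _; rewrite mxE enum_valK.
  have : (\row_l a l) *m K *m Q = 0 by rewrite aK0 mul0mx.
  by rewrite -mulmxA KQ mulmx1 => /rowP a0 l; have := a0 l; rewrite !mxE.
Qed.

(** * Forms on spans of eigenvectors *)

Section EigenFamily.
Context {R : realType} {V : lmodType R} (D : V -> Prop) (B G : V -> V -> R).
Hypothesis D0 : D 0.
Hypothesis DP : forall c f g, D f -> D g -> D (c *: f + g).
Hypotheses (sB : symmetric_form_on D B) (sG : symmetric_form_on D G).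
Hypothesis G_ge0 : forall f, D f -> 0 <= G f f.

(** If [G f f = 0], then [G] at [t f + h] is affine in [t] and nonnegative, so its slope
    vanishes. *)
Lemma semidef_null f h : D f -> D h -> G f f = 0 -> G f h = 0.
Proof.
move=> Df Dh Gf.
have H t : 0 <= 2 * t * G f h + G h h.
  have := G_ge0 (DP t Df Dh).
  rewrite (sG.1 t f h)//; last exact: DP.
  rewrite (sG.2 f)//; last exact: DP.
  rewrite (sG.2 h)//; last exact: DP.
  by rewrite !(sG.1 t f h)// Gf (sG.2 h f)//; lra.
apply/eqP; apply: contrapT => /negP G0.
have := H (- (G h h + 1) / (2 * G f h)).
have -> : 2 * (- (G h h + 1) / (2 * G f h)) * G f h = - (G h h + 1) by field.
lra.
Qed.

Variables (I : finType) (E : I -> V) (mu : I -> R).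
Hypothesis DE : forall i, D (E i).
Hypothesis eig : forall i f, D f -> B (E i) f = mu i * G (E i) f.
Hypothesis indep_at : forall v c, (forall i, mu i != v -> c i = 0) ->
  G (lin_comb c E) (lin_comb c E) = 0 -> forall i, c i = 0.

Lemma eig_orth i j : mu i != mu j -> G (E i) (E j) = 0.
Proof.
move=> ij; have h1 := eig i (DE j); have h2 := eig j (DE i).
rewrite (sB.2 (E j))// (sG.2 (E j))// h1 in h2.
have /eqP : (mu i - mu j) * G (E i) (E j) = 0 by rewrite mulrBl h2 subrr.
by rewrite mulf_eq0 subr_eq0 (negbTE ij) /= => /eqP.
Qed.

(** The component [d] of the combination at one eigenvalue satisfies [G d d = G c d] by
    orthogonality, and the right side is zero by [semidef_null]; independence within an eigenvalue
    concludes. *)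
Lemma eig_indep c : G (lin_comb c E) (lin_comb c E) = 0 -> forall i, c i = 0.
Proof.
move=> G0 i.
pose d j := if mu j == mu i then c j else 0.
have dE : G (lin_comb d E) (lin_comb d E) = G (lin_comb c E) (lin_comb d E).
  rewrite !(form_lc2 D0 DP sG)//; apply: eq_bigr => j _; apply: eq_bigr => k _.
  rewrite /d; case: (eqVneq (mu k) (mu i)) => ki; last by rewrite !mulr0 !mul0r.
  case: (eqVneq (mu j) (mu i)) => ji //.
  by rewrite eig_orth ?mulr0// ki.
have := @indep_at (mu i) d _ _ i; rewrite /d eqxx; apply.
- by move=> j /negbTE ->.
- by rewrite -/d dE; apply: semidef_null => //; exact: D_lin_comb.
Qed.

Lemma eig_form nu c : B (lin_comb c E) (lin_comb c E) - nu * G (lin_comb c E) (lin_comb c E) =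
  \sum_i \sum_j (c i * c j * ((mu i - nu) * G (E i) (E j))).
Proof.
rewrite (form_lc2 D0 DP sB)// (form_lc2 D0 DP sG)// mulr_sumr -sumrB.
apply: eq_bigr => i _; rewrite mulr_sumr -sumrB; apply: eq_bigr => j _.
by rewrite eig//; ring.
Qed.

(* Eigenvectors for distinct eigenvalues being [G]-orthogonal, the weights
   [nu - mu i] can be distributed as [Num.sqrt (nu - mu i)] on both factors. *)
Lemma eig_form_sqrt nu c : (forall i, mu i <= nu) ->
  B (lin_comb c E) (lin_comb c E) - nu * G (lin_comb c E) (lin_comb c E) =
  - G (lin_comb (fun i => Num.sqrt (nu - mu i) * c i) E)
      (lin_comb (fun i => Num.sqrt (nu - mu i) * c i) E).
Proof.
move=> munu; rewrite eig_form (form_lc2 D0 DP sG)// -sumrN; apply: eq_bigr => i _.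
rewrite -sumrN; apply: eq_bigr => j _.
have [ij|ij] := eqVneq (mu i) (mu j); last by rewrite eig_orth// !mulr0 oppr0.
rewrite -ij; set m := Num.sqrt _.
have -> : mu i - nu = - m ^+ 2 by rewrite sqr_sqrtr ?subr_ge0// opprB.
ring.
Qed.

Lemma eig_form_le nu c : (forall i, mu i <= nu) ->
  B (lin_comb c E) (lin_comb c E) <= nu * G (lin_comb c E) (lin_comb c E).
Proof.
by move=> munu; rewrite -subr_le0 eig_form_sqrt// oppr_le0 G_ge0//; exact: D_lin_comb.
Qed.

Lemma eig_form_eq nu c : (forall i, mu i <= nu) ->
  B (lin_comb c E) (lin_comb c E) = nu * G (lin_comb c E) (lin_comb c E) ->
  forall i, mu i != nu -> c i = 0.
Proof.
move=> munu /eqP; rewrite -subr_eq0 eig_form_sqrt// oppr_eq0 => /eqP /eig_indep H i inu.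
have /eqP := H i; rewrite mulf_eq0 sqrtr_eq0 subr_le0 => /orP[h|/eqP//].
by move: inu; rewrite eq_le munu h.
Qed.

Lemma eig_nonpos nu : (forall i, mu i <= nu) -> nonpos_family D B G nu E.
Proof.
move=> munu; split => // c [i ci]; split; last exact: eig_form_le.
rewrite lt_neqAle G_ge0 ?andbT; last exact: D_lin_comb.
by apply/eqP => /esym/eig_indep /(_ i)/eqP; rewrite (negbTE ci).
Qed.

End EigenFamily.

(** * Self-adjoint conditions are Lagrangian *)

Section LagrangianConditions.
Context {R : realType}.
Implicit Types (X Y : 'cV[R[i]]_2).

Lemma Re_bound (k x y : R[i]) : complex.Re (k * x * Num.conj y) <=
  (`|complex.Re k| + `|complex.Im k|) *
  (complex.Re x ^+ 2 + complex.Im x ^+ 2 + (complex.Re y ^+ 2 + complex.Im y ^+ 2)).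
Proof.
case: k => k1 k2; case: x => x1 x2; case: y => y1 y2; rewrite conjcE /=.
set S := x1 ^+ 2 + _ + _.
have bd (e p q : R) : `|p| <= S -> e * p <= `|e| * S.
  by move=> pS; rewrite (le_trans (ler_norm _))// normrM ler_wpM2l.
have h1 : `|x1 * y1 + x2 * y2| <= S.
  rewrite /S ler_norml; apply/andP; split.
    have := sqr_ge0 (x1 + y1); have := sqr_ge0 (x2 + y2); have := sqr_ge0 x1.
    by have := sqr_ge0 x2; have := sqr_ge0 y1; have := sqr_ge0 y2; nra.
  have := sqr_ge0 (x1 - y1); have := sqr_ge0 (x2 - y2); have := sqr_ge0 x1.
  by have := sqr_ge0 x2; have := sqr_ge0 y1; have := sqr_ge0 y2; nra.
have h2 : `|x1 * y2 - x2 * y1| <= S.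
  rewrite /S ler_norml; apply/andP; split.
    have := sqr_ge0 (x1 + y2); have := sqr_ge0 (x2 - y1); have := sqr_ge0 x1.
    by have := sqr_ge0 x2; have := sqr_ge0 y1; have := sqr_ge0 y2; nra.
  have := sqr_ge0 (x1 - y2); have := sqr_ge0 (x2 + y1); have := sqr_ge0 x1.
  by have := sqr_ge0 x2; have := sqr_ge0 y1; have := sqr_ge0 y2; nra.
have := bd k1 _ 0 h1; have := bd k2 _ 0 h2.
rewrite mulrDl; lra.
Qed.

(** Pick elements of [L] spanning the function values attained on [L]. This gives an element
    [(X', Y')] with the values of [(X, Y)] and depending linearly on them; the difference has zero
    values, and its isotropy against [(X, Y)] shows that both have the same boundary term, now
    quadratic in the values. *)
Lemma isotropic_bound (L : @boundary_condition R) : L 0 0 ->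
  (forall k X Y X' Y', L X Y -> L X' Y' -> L (k *: X + X') (k *: Y + Y')) ->
  (forall X Y X' Y', L X Y -> L X' Y' -> symplectic X X' = symplectic Y Y') ->
  exists2 K, 0 <= K & forall X Y, L X Y ->
    complex.Re (Y 1 0 * Num.conj (Y 0 0) - X 1 0 * Num.conj (X 0 0)) <=
    K * (complex.Re (X 0 0) ^+ 2 + complex.Im (X 0 0) ^+ 2 +
         complex.Re (Y 0 0) ^+ 2 + complex.Im (Y 0 0) ^+ 2).
Proof.
move=> L0 LP Liso.
have LZ k X Y : L X Y -> L (k *: X) (k *: Y).
  by move=> LXY; have := LP k _ _ _ _ LXY L0; rewrite !addr0.
have zc k X X' : (k *: X + X') 0 0 = k * X 0 0 + X' 0 0 by rewrite !mxE.
have oc k X X' : (k *: X + X') 1 0 = k * X 1 0 + X' 1 0 by rewrite !mxE.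
have [X1 [Y1 [X2 [Y2 [L1_ L2_ span]]]]] : exists X1 Y1 X2 Y2, [/\ L X1 Y1, L X2 Y2 &
    forall X Y, L X Y -> X 0 0 = X 0 0 * X1 0 0 + Y 0 0 * X2 0 0 /\
                         Y 0 0 = X 0 0 * Y1 0 0 + Y 0 0 * Y2 0 0].
  (* The values [(X 0 0, Y 0 0)] attained on [L] form the whole plane, the line of [(1, 0)], another
     line, or zero. *)
  have [[X1 [Y1 [L1_ x1 y1]]]|no1] := pselect (exists X1 Y1, [/\ L X1 Y1, X1 0 0 = 1 & Y1 0 0 = 0]).
    have [[X2 [Y2 [L2_ x2 y2]]]|no2] := pselect (exists X1 Y1, [/\ L X1 Y1, X1 0 0 = 0 & Y1 0 0 = 1]).
      exists X1, Y1, X2, Y2; split => // X Y _.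
      by rewrite x1 y1 x2 y2; split; ring.
    exists X1, Y1, 0, 0; split => // X Y LXY; rewrite x1 y1 !mxE.
    have [Y0|Y0] := eqVneq (Y 0 0) 0; first by rewrite Y0; split; ring.
    case: no2; exists (- (X 0 0 / Y 0 0) *: X1 + (Y 0 0)^-1 *: X), (- (X 0 0 / Y 0 0) *: Y1 + (Y 0
      0)^-1 *: Y).
    split; first by apply: LP => //; exact: LZ.
      by rewrite !mxE x1; field.
    by rewrite !mxE y1; field.
  have [[X2 [Y2 [L2_ y2]]]|no2] := pselect (exists X2 Y2, L X2 Y2 /\ Y2 0 0 = 1).
    exists 0, 0, X2, Y2; split => // X Y LXY; rewrite y2 !mxE mulr0 !add0r mulr1; split => //.
    apply/eqP; rewrite -subr_eq0; apply: contrapT => /negP/eqP X0.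
    case: no1; exists ((X 0 0 - Y 0 0 * X2 0 0)^-1 *: (- Y 0 0 *: X2 + X)), ((X 0 0 - Y 0 0 * X2 0
      0)^-1 *: (- Y 0 0 *: Y2 + Y)).
    split; first by apply: LZ; exact: LP.
      by rewrite !mxE; field; exact/eqP.
    by rewrite !mxE y2; ring.
  exists 0, 0, 0, 0; split => // X Y LXY; rewrite !mxE !mulr0 addr0.
  have Y0 : Y 0 0 = 0.
    apply/eqP; apply: contrapT => /negP Y0; apply: no2.
    exists ((Y 0 0)^-1 *: X), ((Y 0 0)^-1 *: Y); split; first exact: LZ.
    by rewrite !mxE mulVf.
  split => //; apply/eqP; apply: contrapT => /negP X0; apply: no1.
  exists ((X 0 0)^-1 *: X), ((X 0 0)^-1 *: Y); split; first exact: LZ.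
    by rewrite !mxE mulVf.
  by rewrite !mxE Y0 mulr0.
pose N (k : R[i]) := `|complex.Re k| + `|complex.Im k|.
have N0 k : 0 <= N k by rewrite addr_ge0.
exists (2 * (N (X1 1 0) + N (X2 1 0) + N (Y1 1 0) + N (Y2 1 0))).
  by rewrite mulr_ge0// !addr_ge0.
move=> X Y LXY; have [spx spy] := span X Y LXY.
pose X' := X 0 0 *: X1 + (Y 0 0 *: X2 + 0); pose Y' := X 0 0 *: Y1 + (Y 0 0 *: Y2 + 0).
have L' : L X' Y' := LP _ _ _ _ _ L1_ (LP _ _ _ _ _ L2_ L0).
have X'0 : X' 0 0 = X 0 0 by rewrite [RHS]spx !mxE; ring.
have Y'0 : Y' 0 0 = Y 0 0 by rewrite [RHS]spy !mxE; ring.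
have X'1 : X' 1 0 = X1 1 0 * X 0 0 + X2 1 0 * Y 0 0 by rewrite !mxE; ring.
have Y'1 : Y' 1 0 = Y1 1 0 * X 0 0 + Y2 1 0 * Y 0 0 by rewrite !mxE; ring.
clearbody X' Y'.
have LD := LP (-1) _ _ _ _ L' LXY.
have := Liso _ _ _ _ LD LXY; rewrite /symplectic !zc !oc.
rewrite X'0 Y'0 !mulN1r !addNr !mul0r !subr0 => E.
have -> : Y 1 0 * Num.conj (Y 0 0) - X 1 0 * Num.conj (X 0 0) =
  Y' 1 0 * Num.conj (Y 0 0) - X' 1 0 * Num.conj (X 0 0).
  apply/eqP; rewrite -subr_eq0; apply/eqP.
  move: E; move: (Num.conj _) (Num.conj _) (X' 1 0) (Y' 1 0) => cy cx p q E.
  rewrite -[RHS](subrr ((- q + Y 1 0) * cy)) -{2}E; ring.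
rewrite X'1 Y'1 !mulrDl opprD.
have ReD (x y : R[i]) : complex.Re (x + y) = complex.Re x + complex.Re y by case: x; case: y.
have h1 := Re_bound (Y1 1 0) (X 0 0) (Y 0 0); have h2 := Re_bound (Y2 1 0) (Y 0 0) (Y 0 0).
have h3 := Re_bound (- X1 1 0) (X 0 0) (X 0 0); have h4 := Re_bound (- X2 1 0) (Y 0 0) (X 0 0).
rewrite -!mulNr !ReD.
have NN k : `|complex.Re (- k : R[i])| + `|complex.Im (- k : R[i])| = N k.
  by case: k => k1 k2; rewrite /N /= !normrN.
rewrite NN in h3; rewrite NN in h4; rewrite -/(N _) in h1; rewrite -/(N _) in h2.
move: (complex.Re (X 0 0)) (complex.Im (X 0 0)) (complex.Re (Y 0 0)) (complex.Im (Y 0 0)) h1 h2 h3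
  h4 => x1 x2 y1 y2 h1 h2 h3 h4.
have q1 := sqr_ge0 x1; have q2 := sqr_ge0 x2; have q3 := sqr_ge0 y1; have q4 := sqr_ge0 y2.
move: (N0 (X1 1 0)) (N0 (X2 1 0)) (N0 (Y1 1 0)) (N0 (Y2 1 0)) h1 h2 h3 h4.
move: (N _) (N _) (N _) (N _) => n4 n3 n2 n1 n10 n20 n30 n40 h1 h2 h3 h4.
set T := x1 ^+ 2 + x2 ^+ 2 + y1 ^+ 2 + y2 ^+ 2.
have g1 : n3 * (x1 ^+ 2 + x2 ^+ 2 + (y1 ^+ 2 + y2 ^+ 2)) <= n3 * (2 * T) by rewrite ler_wpM2l// /T; lra.
have g2 : n4 * (y1 ^+ 2 + y2 ^+ 2 + (y1 ^+ 2 + y2 ^+ 2)) <= n4 * (2 * T) by rewrite ler_wpM2l// /T; lra.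
have g3 : n1 * (x1 ^+ 2 + x2 ^+ 2 + (x1 ^+ 2 + x2 ^+ 2)) <= n1 * (2 * T) by rewrite ler_wpM2l// /T; lra.
have g4 : n2 * (y1 ^+ 2 + y2 ^+ 2 + (x1 ^+ 2 + x2 ^+ 2)) <= n2 * (2 * T) by rewrite ler_wpM2l// /T; lra.
move: g1 g2 g3 g4; move: h1 h2 h3 h4; clearbody T; lra.
Qed.

End LagrangianConditions.

Section MatrixConditions.
Context {R : realType}.
Implicit Types (X Y : 'cV[R[i]]_2) (A B : 'M[R[i]]_2).
Notation E := (@symplectic_E R).

Lemma sum2 (F : 'I_2 -> R[i]) : \sum_i F i = F 0 + F 1.
Proof. by rewrite big_ord_recl big_ord1; congr (_ + F _); exact/val_inj. Qed.

Lemma symplectic_E0 X : (E *m X) 0 0 = - X 1 0.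
Proof. by rewrite mxE sum2 !mxE /= mul0r add0r mulN1r. Qed.

Lemma symplectic_E1 X : (E *m X) 1 0 = X 0 0.
Proof. by rewrite mxE sum2 !mxE /= mul0r mul1r addr0. Qed.

(** Pairing with the vectors [E A* c] reads off the components of [A X], which turns the matrix
    condition into a skew-orthogonality condition. *)
Lemma symplectic_adjoint A X (c : 'cV[R[i]]_2) :
  symplectic X (E *m adjoint_mx A *m c) = - \sum_i Num.conj (c i 0) * (A *m X) i 0.
Proof.
rewrite /symplectic -mulmxA symplectic_E0 symplectic_E1.
have adj i j : adjoint_mx A i j = Num.conj (A j i) by rewrite !mxE.
rewrite !mxE !sum2 !adj !mxE !sum2 !rmorphN !rmorphD !rmorphM /= !conjCK.
ring.
Qed.

Lemma symplecticN X Y : symplectic X (- Y) = - symplectic X Y.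
Proof. by rewrite /symplectic !mxE !rmorphN /=; ring. Qed.

Lemma dot_eq0 (v : 'cV[R[i]]_2) :
  (forall c : 'cV[R[i]]_2, \sum_i Num.conj (c i 0) * v i 0 = 0) -> v = 0.
Proof.
move=> H; apply/matrixP => i j; rewrite ord1 [RHS]mxE.
have := H (delta_mx i 0); rewrite (bigD1 i)//= mxE !eqxx rmorph1 mul1r big1 ?addr0//.
by move=> k ki; rewrite mxE (negbTE ki) /= rmorph0 mul0r.
Qed.

(** The identity [A E A* = B E B*] puts the rows of [P] in the kernel of the transposed matrix of
    the condition. Both spaces have dimension 2, so they coincide. *)
Lemma matrix_bc_param A B : self_adjoint_bc A B -> forall X Y, matrix_bc A B X Y ->
  exists c, X = E *m adjoint_mx A *m c /\ Y = - (E *m adjoint_mx B *m c).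
Proof.
move=> [rAB AEB] X Y XY.
pose P : 'M[R[i]]_(2, 2 + 2) := row_mx ((E *m adjoint_mx A)^T) (- (E *m adjoint_mx B)^T).
pose M : 'M[R[i]]_(2 + 2, 2) := (row_mx A B)^T.
have PM : P *m M = 0.
  rewrite /P /M tr_row_mx mul_row_col mulNmx -!trmx_mul -linearB /= !mulmxA.
  by rewrite AEB subrr linear0.
have EE : E *m E = - 1%:M.
  apply/matrixP => i j; rewrite !mxE sum2 !mxE.
  by case: i => -[|[|//]] ?; case: j => -[|[|//]] ? /=; ring.
have rP : \rank P = 2.
  have -> : P = map_mx Num.conj (row_mx A B) *m block_mx E^T 0 0 (- E^T).
    rewrite map_row_mx mul_row_block !mulmx0 addr0 add0r mulmxN /P !trmx_mul.
    by rewrite /adjoint_mx !trmxK.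
  rewrite mxrankMfree ?mxrank_map//.
  apply/row_freeP; exists (block_mx E^T 0 0 (- E^T) *m (- 1%:M)).
  rewrite mulmxN mulmx1 mulmxN mulmx_block !mulmx0 !mul0mx !addr0 !add0r.
  rewrite mulNmx mulmxN opprK -!trmx_mul EE linearN /= trmx1.
  rewrite -[RHS]opprK; congr (- _).
  by rewrite (scalar_mx_block 2 2 1) opp_block_mx !oppr0.
have rK : \rank (kermx M) = 2 by rewrite mxrank_ker mxrank_tr rAB.
have sub : (P <= kermx M)%MS by apply/sub_kermxP.
have /eqmxP eqPK : (P == kermx M)%MS by rewrite -(mxrank_leqif_eq sub) rP rK.
pose v : 'rV[R[i]]_(2 + 2) := row_mx X^T Y^T.
have : (v <= P)%MS.
  rewrite eqPK; apply/sub_kermxP; rewrite /v /M tr_row_mx mul_row_col -!trmx_mul -linearD /=.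
  by have := XY; rewrite /matrix_bc => ->; rewrite linear0.
move=> /submxP[D]; rewrite /v /P mul_mx_row => /eq_row_mx[h1 h2].
exists D^T; split.
  by rewrite -[LHS]trmxK h1 trmx_mul trmxK.
by rewrite -[LHS]trmxK h2 mulmxN linearN /= trmx_mul trmxK.
Qed.

(** Everything follows from [diff]: the bracket defect against a parametrized solution is a pairing
    of [A X + B Y] with [c]. It vanishes for solutions, and it vanishes for all [c] only for
    solutions. *)
Lemma matrix_bc_lagrangian A B : self_adjoint_bc A B -> lagrangian_bc (matrix_bc A B).
Proof.
move=> sa.
have L0 : matrix_bc A B 0 0 by rewrite /matrix_bc !mulmx0 addr0.
have LP k X Y X' Y' : matrix_bc A B X Y -> matrix_bc A B X' Y' ->
    matrix_bc A B (k *: X + X') (k *: Y + Y').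
  rewrite /matrix_bc => h1 h2; rewrite !mulmxDr -!scalemxAr addrACA -scalerDr h1 h2.
  by rewrite scaler0 addr0.
have diff X Y c : symplectic X (E *m adjoint_mx A *m c) - symplectic Y (- (E *m adjoint_mx B *m c)) =
    - \sum_i Num.conj (c i 0) * (A *m X + B *m Y) i 0.
  rewrite symplecticN !symplectic_adjoint opprK -opprD -big_split /=; congr (- _).
  apply: eq_bigr => i _.
  have -> : (A *m X + B *m Y) i 0 = (A *m X) i 0 + (B *m Y) i 0 by rewrite mxE.
  by rewrite mulrDr.
have Liso X Y X' Y' : matrix_bc A B X Y -> matrix_bc A B X' Y' -> symplectic X X' = symplectic Y Y'.
  move=> XY /(matrix_bc_param sa)[c [-> ->]]; apply/eqP; rewrite -subr_eq0 diff.
  by rewrite /matrix_bc in XY; rewrite XY; rewrite big1 ?oppr0// => i _; rewrite mxE mulr0.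
split => //; last exact: isotropic_bound.
move=> X Y H; rewrite /matrix_bc; apply: dot_eq0 => c.
apply/eqP; rewrite -oppr_eq0 -diff subr_eq0; apply/eqP; apply: H.
rewrite /matrix_bc mulmxN !mulmxA -mulmxBl.
by have [_ ->] := sa; rewrite subrr mul0mx.
Qed.

Lemma dirichlet_bc_lagrangian : lagrangian_bc (@dirichlet_bc R).
Proof.
have L0 : dirichlet_bc 0 (0 : 'cV[R[i]]_2) by split; rewrite mxE.
have LP k X Y X' Y' : @dirichlet_bc R X Y -> @dirichlet_bc R X' Y' ->
    dirichlet_bc (k *: X + X') (k *: Y + Y').
  by move=> [h1 h2] [h3 h4]; split; rewrite !mxE ?h1 ?h2 ?h3 ?h4 mulr0 addr0.
have Liso X Y X' Y' : @dirichlet_bc R X Y -> @dirichlet_bc R X' Y' ->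
    symplectic X X' = symplectic Y Y'.
  by move=> [h1 h2] [h3 h4]; rewrite /symplectic h1 h2 h3 h4 rmorph0 !mulr0 !mul0r.
split => //; last exact: isotropic_bound.
move=> X Y H; split.
  have := H (vec2 0 1) 0; rewrite /symplectic !vec2_0 !vec2_1 !mxE rmorph0 rmorph1 !mulr0 mulr1 subr0 sub0r.
  move=> h; apply/eqP; rewrite -oppr_eq0 h//.
  by split; rewrite !mxE.
have := H 0 (vec2 0 1); rewrite /symplectic !vec2_0 !vec2_1 !mxE rmorph0 rmorph1 !mulr0 mulr1 subr0 sub0r.
move=> h; apply/eqP; rewrite -oppr_eq0 -h//.
by split; rewrite !mxE.
Qed.

End MatrixConditions.

(** * Eigenfunctions *)

Section Data.
Context {R : realType}.
Notation mu := (@lebesgue_measure R).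
Implicit Types (a b x y : R) (h p q r s : R -> R).

Lemma oint_gt0 x y h : L1 h -> (forall t, 0 <= h t) -> x < y ->
  {ae mu, forall t, t \in `]x, y[ -> 0 < h t} -> 0 < oint x y h.
Proof.
move=> hi h0 xy hpos; rewrite lt_neqAle oint_ge0 ?andbT; last by [].
apply/eqP => /esym h00.
have hI : mu.-integrable `]x, y] (EFin \o h) by exact: L1S.
have mh : measurable_fun `]x, y] (EFin \o h) by exact: measurable_int hI.
have : (\int[mu]_(t in `]x, y]) `|(h t)%:E| = 0)%E.
  have -> : (\int[mu]_(t in `]x, y]) `|(h t)%:E| = \int[mu]_(t in `]x, y]) (h t)%:E)%E.
    by apply: eq_integral => t _; rewrite gee0_abs// lee_fin.
  rewrite -[LHS]fineK; last exact: integrable_fin_num.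
  by move: h00; rewrite /oint /Rintegral => ->.
move/(ae_eq_integral_abs mu (measurable_itv _) mh) => hae.
have [N [mN N0 NP]] : mu.-negligible `]x, y[%classic.
  have : {ae mu, forall t, ~ (t \in `]x, y[)}.
    move: hae hpos; apply: aeS2 => t ht hp txy.
    have := hp txy; have [] : h t = 0; last by move=> ->; rewrite ltxx.
    have txy' : `]x, y]%classic t.
      by move: txy; rewrite /= !in_itv/= => /andP[-> /ltW].
    by have := ht txy' => -[].
  by rewrite /almost_everywhere; apply: negligibleS => t /= txy; rewrite notK.
have : (mu `]x, y[%classic <= mu N)%E by apply: le_measure => //; rewrite inE.
rewrite N0 lebesgue_measure_itv/= lte_fin xy -EFinD lee_fin; lra.
Qed.

Lemma in_L1_representative a b h : in_L1 a b h ->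
  exists2 g : R -> R, L1 g & {ae mu, forall x, x \in `]a, b[ -> h x = g x}.
Proof.
move=> [g gi hg]; exists (g \_ `]a, b[%classic).
  rewrite /L1 -restrict_EFin; apply/integrable_restrict => //.
  by rewrite setTI.
move: hg; apply: aeS => x hx xab; rewrite patchE mem_set ?hx//.
Qed.

(** Absolute values of integrable representatives make the signs of [1 / p] and [r] hold everywhere,
    and change nothing almost everywhere on []a, b[]. *)
Lemma sl_data_exists a b p q r s : a < b -> in_L1 a b (fun x => (p x)^-1) ->
  in_L1 a b q -> in_L1 a b r -> in_L1 a b s ->
  {ae mu, forall x, x \in `]a, b[ -> 0 < p x} ->
  {ae mu, forall x, x \in `]a, b[ -> 0 < r x} ->
  exists S : sl_data R, [/\ sla S = a, slb S = b &
    {ae mu, forall x, x \in `]a, b[ ->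
      [/\ 0 < p x, slw S x = (p x)^-1, slq S x = q x, slr S x = r x & sls S x = s x]}].
Proof.
move=> ab /in_L1_representative[w wL pw] /in_L1_representative[q' qL qq]
  /in_L1_representative[r' rL rr] /in_L1_representative[s' sL ss] p0 r0.
pose w1 t := `|w t|; pose r1 t := `|r' t|.
have pos h1 : L1 h1 -> (forall t, 0 <= h1 t) -> {ae mu, forall t, t \in `]a, b[ -> 0 < h1 t} ->
    forall x y, a <= x -> x < y -> y <= b -> 0 < oint x y h1.
  move=> h1L h10 h1p x y ax xy yb; apply: oint_gt0 => //.
  move: h1p; apply: aeS => t ht; rewrite in_itv/= => /andP[xt ty]; apply: ht.
  by rewrite in_itv/= (le_lt_trans ax)// (lt_le_trans ty).
have w1P : {ae mu, forall t, t \in `]a, b[ -> 0 < p t /\ w1 t = (p t)^-1}.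
  move: p0 pw; apply: aeS2 => t hp hw tab; have pt := hp tab.
  by rewrite /w1 -(hw tab) ger0_norm// invr_ge0 ltW.
have r1P : {ae mu, forall t, t \in `]a, b[ -> 0 < r t /\ r1 t = r t}.
  move: r0 rr; apply: aeS2 => t hr hw tab; have rt := hr tab.
  by rewrite /r1 -(hw tab) ger0_norm// ltW.
have w1p : {ae mu, forall t, t \in `]a, b[ -> 0 < w1 t}.
  by move: w1P; apply: aeS => t H tab; have [pt ->] := H tab; rewrite invr_gt0.
have r1p : {ae mu, forall t, t \in `]a, b[ -> 0 < r1 t}.
  by move: r1P; apply: aeS => t H tab; have [rt ->] := H tab.
have n0 (h : R -> R) : forall t, 0 <= `|h t| by [].
exists (SLData ab (L1_norm wL) qL (L1_norm rL) sL (n0 w) (n0 r')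
  (pos _ (L1_norm wL) (n0 w) w1p) (pos _ (L1_norm rL) (n0 r') r1p)).
split => //=.
have H1 : {ae mu, forall x, x \in `]a, b[ -> [/\ 0 < p x, w1 x = (p x)^-1 & r1 x = r x]}.
  by move: w1P r1P; apply: aeS2 => t h1 h2 tab; have [] := h1 tab; have [] := h2 tab.
have H2 : {ae mu, forall x, x \in `]a, b[ -> q' x = q x /\ s' x = s x}.
  by move: qq ss; apply: aeS2 => t h1 h2 tab; rewrite h1// h2.
move: H1 H2; apply: aeS2 => t h1 h2 tab.
by have [] := h1 tab; have [] := h2 tab.
Qed.

End Data.

Section Solutions.
Context {R : realType} (S : sl_data R).
Notation mu := (@lebesgue_measure R).
Implicit Types (c : bool) (x t : R).
Notation a := (sla S). Notation b := (slb S).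
Variables p q r s : R -> R.
Hypothesis coef : {ae mu, forall x, x \in `]a, b[ ->
  [/\ 0 < p x, slw S x = (p x)^-1, slq S x = q x, slr S x = r x & sls S x = s x]}.
Let ab : a < b := sl_lt S.
Let leab : a <= b := ltW ab.

Definition cpart c (z : R[i]) : R := if c then complex.Im z else complex.Re z.

Lemma bfun_clamp (f : R -> R) : abs_continuous a b f -> bfun (f \o clamp a b).
Proof.
move=> acf; have [h hi hf] := abs_continuous_density leab acf.
have -> : f \o clamp a b = fun x => f a + oint a (clamp a b x) h.
  apply/funext => x /=; have /andP[h1 h2] := clamp_itv x leab.
  by rewrite -[oint _ _ _]hf//; ring.
exact: bfun_oint.
Qed.

Lemma prim_on_clamp (f g : R -> R) : prim_on a b g f -> prim_on a b g (f \o clamp a b).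
Proof. by apply: eq_prim_on => // t at_ tb; rewrite /= clamp_id// at_. Qed.

Lemma SL_solution_ode lam y y1 : SL_solution a b p q r s lam%:C y y1 ->
  forall c, ode_sol S lam a b (cpart c \o y \o clamp a b) (cpart c \o y1 \o clamp a b).
Proof.
move=> [[acRe acIm] [[acRe1 acIm1] eq1] eq2] c.
have acy : abs_continuous a b (cpart c \o y) by clear eq1 eq2; case: c.
have acy1 : abs_continuous a b (cpart c \o y1) by clear acy eq1 eq2; case: c.
have bu : bfun (cpart c \o y \o clamp a b) := bfun_clamp acy.
have bz : bfun (cpart c \o y1 \o clamp a b) := bfun_clamp acy1.
have cid' t : t \in `]a, b[ -> clamp a b t = t.
  by rewrite in_itv/= => /andP[/ltW at_ /ltW tb]; rewrite clamp_id// at_.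
split => //.
  apply: prim_on_clamp; apply: abs_continuous_prim => //; first exact: ueq_L1.
  move: coef eq1; apply: aeS2 => t hc he tab.
  have [p0 wE qE rE sE] := hc tab; have := he tab.
  rewrite /ueq /= cid'// wE sE => ->.
  have pn0 : p t != 0 by rewrite gt_eqF.
  by clear bu bz acy acy1; case: c; rewrite /cpart /cderiv /=; case: (y t) => yr yi /=; field.
apply: prim_on_clamp; apply: abs_continuous_prim => //; first exact: zeq_L1.
move: coef eq2; apply: aeS2 => t hc he tab.
have [p0 wE qE rE sE] := hc tab; have := he tab.
rewrite /zeq /= cid'// qE rE sE.
clear bu bz acy acy1; case: c; rewrite /cpart /cderiv; case: (y t) => yr yi; case: (y1 t) => y1r y1i /=.
  by move=> /(congr1 (fun Z : R[i] => complex.Im Z)) /=; lra.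
by move=> /(congr1 (fun Z : R[i] => complex.Re Z)) /=; lra.
Qed.

Lemma ode_SL_solution lam (u z : bool -> R -> R) : (forall c, ode_sol S lam a b (u c) (z c)) ->
  SL_solution a b p q r s lam%:C (fun t => u false t +i* u true t) (fun t => z false t +i* z true t).
Proof.
move=> sol.
have uL c : L1 (ueq S (u c) (z c)) by have [bu bz _ _] := sol c; exact: ueq_L1.
have zL c : L1 (zeq S lam (u c) (z c)) by have [bu bz _ _] := sol c; exact: zeq_L1.
have up c : prim_on a b (ueq S (u c) (z c)) (u c) by have [] := sol c.
have zp c : prim_on a b (zeq S lam (u c) (z c)) (z c) by have [] := sol c.
have du c : {ae mu, forall x, x \in `]a, b[ -> derive1 (u c) x = ueq S (u c) (z c) x}.
  by move: (prim_on_derivable (uL c) (up c)); apply: aeS => t H /H[].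
have dz c : {ae mu, forall x, x \in `]a, b[ -> derive1 (z c) x = zeq S lam (u c) (z c) x}.
  by move: (prim_on_derivable (zL c) (zp c)); apply: aeS => t H /H[].
split.
- by split; [exact: prim_on_abs_continuous (uL false) (up false)|exact: prim_on_abs_continuous (uL
  true) (up true)].
- split.
    by split; [exact: prim_on_abs_continuous (zL false) (zp false)|exact: prim_on_abs_continuous
      (zL true) (zp true)].
  have := coef; apply: aeS2 (_ : {ae mu, forall x, x \in `]a, b[ ->
      derive1 (u false) x = ueq S (u false) (z false) x /\ derive1 (u true) x = ueq S (u true) (z true) x}).
    move=> t hd hc tab; have [d1 d2] := hd tab; have [p0 wE qE rE sE] := hc tab.
    have pn0 : p t != 0 by rewrite gt_eqF.
    rewrite /cderiv /= d1 d2 /ueq wE sE.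
    by apply: complex_eq => /=; field.
  by move: (du false) (du true); apply: aeS2 => t h1 h2 tab; rewrite h1// h2.
- have := coef; apply: aeS2 (_ : {ae mu, forall x, x \in `]a, b[ ->
      derive1 (z false) x = zeq S lam (u false) (z false) x /\ derive1 (z true) x = zeq S lam (u
        true) (z true) x}).
    move=> t hd hc tab; have [d1 d2] := hd tab; have [p0 wE qE rE sE] := hc tab.
    rewrite /cderiv /= d1 d2 /zeq qE rE sE.
    by apply: complex_eq => /=; ring.
  by move: (dz false) (dz true); apply: aeS2 => t h1 h2 tab; rewrite h1// h2.
Qed.

End Solutions.

Section Eigenfunctions.
Context {R : realType} (S : sl_data R) (L : @boundary_condition R).
Hypothesis HL : lagrangian_bc L.
Notation mu := (@lebesgue_measure R).
Implicit Types (c : bool) (x t : R) (f g : @fspace R).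
Notation a := (sla S). Notation b := (slb S).
Variables p q r s : R -> R.
Hypothesis coef : {ae mu, forall x, x \in `]a, b[ ->
  [/\ 0 < p x, slw S x = (p x)^-1, slq S x = q x, slr S x = r x & sls S x = s x]}.
Let ab : a < b := sl_lt S.
Let leab : a <= b := ltW ab.
Notation D := (Dform S L). Notation B := (Bform S). Notation G := (Gform S).

Definition eig_elt lam f := [/\ D f, forall c, ode_sol S lam a b (fu f c) (fz f c),
  forall c, fal f c = fz f c a & forall c, fbe f c = fz f c b].

Definition elt (y y1 : R -> R[i]) : @fspace R :=
  fmk (fun c => cpart c \o y \o clamp a b) (fun c => cpart c \o y1 \o clamp a b)
      (fun c => cpart c (y1 a)) (fun c => cpart c (y1 b)).

(** Multiplication by the imaginary unit; it supplies the second real direction of a complex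
    eigenfunction. *)
Definition elt_i f : @fspace R :=
  fmk (fun c t => if c then fu f false t else - fu f true t)
      (fun c t => if c then fz f false t else - fz f true t)
      (fun c => if c then fal f false else - fal f true)
      (fun c => if c then fbe f false else - fbe f true).

Lemma clampa : clamp a b a = a. Proof. by rewrite clamp_id// lexx. Qed.
Lemma clampb : clamp a b b = b. Proof. by rewrite clamp_id// lexx leab. Qed.

Lemma cpartE (z : R[i]) : cpart false z +i* cpart true z = z.
Proof. by case: z. Qed.

Lemma cpart_sum (I : finType) (F : I -> R[i]) c : cpart c (\sum_i F i) = \sum_i cpart c (F i).
Proof.
elim/big_rec2 : _ => [|i x z _ <-]; first by case: c.
by case: c; case: (F i); case: z.
Qed.

Lemma elt_eig lam y y1 : SL_solution a b p q r s lam%:C y y1 ->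
  L (bvec y y1 a) (bvec y y1 b) -> eig_elt lam (elt y y1).
Proof.
move=> sol bc; have odes := SL_solution_ode coef sol.
split => //; last 2 first.
- by move=> c; rewrite /fz /= clampa.
- by move=> c; rewrite /fz /= clampb.
split; first by move=> c; have [bu bz pu _] := odes c.
by rewrite /Ya /Yb /fu /fal /fbe /= !clampa !clampb !cpartE.
Qed.

Lemma ode_solN lam u z : ode_sol S lam a b u z -> ode_sol S lam a b (fun t => - u t) (fun t => - z t).
Proof.
move=> sol; have := ode_sol_lin (- 2) sol sol.
have -> : (fun t => - 2 * u t + u t) = (fun t => - u t) by apply/funext => t; ring.
by have -> : (fun t => - 2 * z t + z t) = (fun t => - z t) by apply/funext => t; ring.
Qed.

Lemma elt_i_eig lam f : eig_elt lam f -> eig_elt lam (elt_i f).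
Proof.
move=> [[_ Lf] odes al be].
have odes' c : ode_sol S lam a b (fu (elt_i f) c) (fz (elt_i f) c).
  by case: c; [exact: odes|exact: ode_solN (odes true)].
split => //.
- split; first by move=> c; have [bu bz pu _] := odes' c.
  have := lagP HL (0 +i* 1) Lf (lag0 HL); rewrite !addr0.
  have E (x y z t : R) : (0 +i* 1) *: vec2 (x +i* y) (z +i* t) = vec2 (- y +i* x) (- t +i* z).
    by apply/matrixP => i j; rewrite !mxE; case: ifP => _; apply: complex_eq => /=; ring.
  by rewrite !E.
- by case; [exact: al|exact: (congr1 (fun v : R => - v) (al true))].
- by case; [exact: be|exact: (congr1 (fun v : R => - v) (be true))].
Qed.

Lemma eig_weak lam f g : eig_elt lam f -> D g -> B f g = lam * G f g.
Proof.
move=> [Df odes al be] Dg; apply/eqP; rewrite -subr_eq0 (shifted_form lam Df Dg).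
have E c : eint S lam a b (fu f c) (fz f c) (fu g c) (fz g c) =
    fz f c b * fu g c b - fz f c a * fu g c a.
  have [bu bz pu pz] := odes c; have [bu' bz' pu'] := Dg.1 c.
  exact: green.
by rewrite !E !al !be !subrr addr0.
Qed.

Lemma functional_lc (phi : @fspace R -> R) (I : finType) (c : I -> R) (e : I -> @fspace R) :
  (forall k f g, phi (k *: f + g) = k * phi f + phi g) ->
  phi (lin_comb c e) = \sum_i c i * phi (e i).
Proof.
move=> phiP.
have phi0 : phi 0 = 0.
  by have := phiP (-1) 0 0; rewrite scaler0 addr0 mulN1r addNr.
rewrite /lin_comb; elim/big_rec2 : _ => [//|i x y _ IH].
by rewrite phiP IH.
Qed.

Lemma fu_lc (I : finType) (k : I -> R) (e : I -> @fspace R) c t :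
  fu (lin_comb k e) c t = \sum_i k i * fu (e i) c t.
Proof. by rewrite (@functional_lc (fun f => fu f c t)). Qed.

Lemma fz_lc (I : finType) (k : I -> R) (e : I -> @fspace R) c t :
  fz (lin_comb k e) c t = \sum_i k i * fz (e i) c t.
Proof. by rewrite (@functional_lc (fun f => fz f c t)). Qed.

Lemma Gform_eq0 f : (forall c t, a <= t <= b -> fu f c t = 0) -> G f f = 0.
Proof.
move=> f0; have E c : Gc S f f c = 0.
  rewrite /Gc (@eq_oint _ a b _ (fun=> 0)); last first.
    by move=> t at_ tb; rewrite f0 ?mulr0// tb ltW.
  by rewrite /oint Rintegral_cst// mul0r.
by rewrite /Gform !E addr0.
Qed.

Variable lam : nat -> R.
Hypothesis hlam : eigenvalue_sequence a b p q r s L lam.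

(** For an eigenvalue [v], a basis of the eigenspace with an injection [h] of the indices [k] such
    that [lam k = v] into the basis. The data are total functions in one tuple, so that a choice can
    be made for all [v] at once. *)
Lemma eigenfunction_data v : exists d : nat * (nat -> R -> R[i]) * (nat -> R -> R[i]) * (nat -> nat),
  let m := d.1.1.1 in let f := d.1.1.2 in let f1 := d.1.2 in let h := d.2 in
  (exists n, lam n = v) ->
  [/\ forall j, (j < m)%N -> SL_solution a b p q r s v%:C (f j) (f1 j) /\ L (bvec (f j) (f1 j) a)
    (bvec (f j) (f1 j) b),
      forall C : nat -> R[i], (forall x, x \in `[a, b] -> \sum_(j < m) C j * f j x = 0) ->
        forall j, (j < m)%N -> C j = 0,
      forall k, lam k = v -> (h k < m)%N &
      forall k l, lam k = v -> lam l = v -> h k = h l -> k = l].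
Proof.
have [[n nv]|no] := pselect (exists n, lam n = v); last first.
  by exists (0%N, fun _ _ => 0, fun _ _ => 0, fun _ => 0%N).
have [_ _ _ /(_ n)[m [F [F1 F2 _]] card]] := hlam; rewrite nv in F1 card.
have /choice[Y1 Y1P] : forall i : 'I_m, exists y1, SL_solution a b p q r s v%:C (F i) y1 /\
    L (bvec (F i) y1 a) (bvec (F i) y1 b).
  by move=> i; have [y1 h1 h2] := F1 i; exists y1.
have /card_set_bijP[h [hf hi _]] := card.
exists (m, fun j => oapp F (fun=> 0) (insub j), fun j => oapp Y1 (fun=> 0) (insub j), h) => /= _.
split.
- by move=> j jm; rewrite insubT /=.
- move=> C C0 j jm; have := F2 (fun i => C i) _ (Ordinal jm); apply => x xab.
  by rewrite -[RHS](C0 x xab); apply: eq_bigr => i _; rewrite valK.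
- by move=> k kv; exact: hf.
- by move=> k l kv lv; apply: hi; rewrite inE.
Qed.

Lemma eigenfunction_basis : exists Y Y1 : nat -> R -> R[i],
  (forall k, SL_solution a b p q r s (lam k)%:C (Y k) (Y1 k) /\
     L (bvec (Y k) (Y1 k) a) (bvec (Y k) (Y1 k) b)) /\
  forall n v (C : 'I_n -> R[i]), (forall k : 'I_n, lam k != v -> C k = 0) ->
    (forall x, x \in `[a, b] -> \sum_k C k * Y k x = 0) -> forall k : 'I_n, C k = 0.
Proof.
have /choice[d dP] := eigenfunction_data.
pose m v := (d v).1.1.1; pose f v := (d v).1.1.2; pose f1 v := (d v).1.2; pose h v := (d v).2.
have dataP k := dP (lam k) (ex_intro _ k erefl).
exists (fun k => f (lam k) (h (lam k) k)), (fun k => f1 (lam k) (h (lam k) k)); split.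
  by move=> k; have [sol _ hm _] := dataP k; apply: sol; exact: hm.
move=> n v C Cv CY k0.
have [kv|/Cv//] := eqVneq (lam k0) v; rewrite -{}kv in Cv.
have [_ indep hm hinj] := dataP k0.
rewrite -/(m _) -/(f _) -/(h _) in indep hm hinj.
set w := lam k0 in Cv indep hm hinj *.
(* The coefficients are transported along the injection [h w] from indices of [lam] to members of
   the basis. *)
pose D' j := \sum_(k < n | (lam k == w) && (h w k == j)) C k.
have D'E : D' (h w k0) = C k0.
  rewrite /D' (bigD1 k0) ?eqxx//= big1 ?addr0// => k /andP[/andP[/eqP kw /eqP hk] kk].
  by case/eqP: kk; apply/val_inj; exact: hinj.
rewrite -D'E; apply: indep; last exact: hm.
move=> x /CY CYx; rewrite -[RHS]CYx.
rewrite /D'; under eq_bigr do rewrite mulr_suml.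
rewrite (exchange_big_dep (fun k : 'I_n => lam k == w))/=; last by move=> ? ? _ /andP[].
rewrite [RHS](bigID (fun k : 'I_n => lam k == w))/= [X in _ = _ + X]big1 ?addr0; last first.
  by move=> k kw; rewrite Cv// mul0r.
apply: eq_bigr => k /eqP kw.
have hkm := hm k kw.
rewrite (bigD1 (Ordinal hkm))/= ?kw ?eqxx// big1 ?addr0// => j /andP[/eqP hj /eqP nj].
by case: nj; apply/val_inj.
Qed.

(** Two real elements for each index. Independence is asked for one eigenvalue at a time;
    orthogonality takes care of distinct eigenvalues. *)
Definition is_eigenfamily (E : nat -> bool -> @fspace R) :=
  (forall k c, eig_elt (lam k) (E k c)) /\
  forall n v (C : 'I_n * bool -> R), (forall i : 'I_n * bool, lam i.1 != v -> C i = 0) ->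
      G (lin_comb C (fun i : 'I_n * bool => E i.1 i.2)) (lin_comb C (fun i : 'I_n * bool => E i.1 i.2)) = 0 ->
      forall i, C i = 0.

Lemma eigenfamily_exists : exists E, is_eigenfamily E.
Proof.
have [Y [Y1 [YP Yind]]] := eigenfunction_basis.
pose E k c := if c then elt_i (elt (Y k) (Y1 k)) else elt (Y k) (Y1 k).
have Eeig k c : eig_elt (lam k) (E k c).
  have [sol bc] := YP k; have e := elt_eig sol bc.
  by case: c => //; exact: elt_i_eig.
exists E; split => // n v C Cv G0.
have DE (i : 'I_n * bool) : D (E i.1 i.2) by have [] := Eeig i.1 i.2.
have Dlc := @D_lin_comb R _ D (Dform0 S HL) (DformP HL) _ C _ DE.
have lc0 c x : a <= x <= b -> fu (lin_comb C (fun i : 'I_n * bool => E i.1 i.2)) c x = 0.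
  exact: Gform_null Dlc G0 c x.
(* A real combination of an element and its product with [i] is a complex multiple, with coefficient
   [Z k]. *)
pose Z (k : 'I_n) := C (k, false) +i* C (k, true).
suff Z0 k : Z k = 0.
  by move=> [k []]; have := Z0 k => -[].
apply: (Yind n v Z) => [l lv|x].
  by rewrite /Z !Cv.
rewrite in_itv /= => xab.
have sumE (c : bool) : fu (lin_comb C (fun i : 'I_n * bool => E i.1 i.2)) c x =
    \sum_(k < n) (C (k, false) * fu (E k false) c x + C (k, true) * fu (E k true) c x).
  rewrite fu_lc; transitivity (\sum_(k < n) \sum_c' C (k, c') * fu (E k c') c x).
    by rewrite pair_bigA; apply: eq_bigr => -[].
  by apply: eq_bigr => l _; rewrite big_bool addrC.
have cp (l : nat) (c : bool) : fu (E l false) c x = cpart c (Y l x).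
  by rewrite /fu /= clamp_id.
apply: complex_eq.
  rewrite [LHS](cpart_sum _ false) -[RHS](lc0 false x xab) sumE; apply: eq_bigr => l _.
  have -> : fu (E l true) false x = - fu (E l false) true x by [].
  by rewrite !cp /Z /cpart; case: (Y l x) => y1 y2 /=; ring.
rewrite [LHS](cpart_sum _ true) -[RHS](lc0 true x xab) sumE; apply: eq_bigr => l _.
have -> : fu (E l true) true x = fu (E l false) false x by [].
by rewrite !cp /Z /cpart; case: (Y l x) => y1 y2 /=; ring.
Qed.

End Eigenfunctions.

(** * The counting principle for the Sturm-Liouville form *)

Section Counting.
Context {R : realType} (S : sl_data R) (L : @boundary_condition R).
Hypothesis HL : lagrangian_bc L.
Notation mu := (@lebesgue_measure R).
Implicit Types (c : bool) (x t : R) (f g : @fspace R).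
Notation a := (sla S). Notation b := (slb S).
Variables p q r s : R -> R.
Hypothesis coef : {ae mu, forall x, x \in `]a, b[ ->
  [/\ 0 < p x, slw S x = (p x)^-1, slq S x = q x, slr S x = r x & sls S x = s x]}.
Notation D := (Dform S L). Notation B := (Bform S). Notation G := (Gform S).
Variable lam : nat -> R.
Hypothesis hlam : eigenvalue_sequence a b p q r s L lam.

Lemma cpartM c (z w : R[i]) :
  cpart c (z * w) = cpart false z * cpart c w + cpart true z * cpart c ((0 +i* 1) * w).
Proof. by case: z => z1 z2; case: w => w1 w2; case: c; rewrite /cpart /=; ring. Qed.

(** Kernel elements are complex eigenfunctions at [sg], with coordinates in a space of complex
    dimension [m]. More than [2 m] of them satisfy a real linear relation, against their
    independence. *)
Lemma kernel_family_multiplicity sg n (e : 'I_n -> @fspace R) : (forall i, D (e i)) ->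
  (forall i f, D f -> B (e i) f - sg * G (e i) f = 0) ->
  (forall c : 'I_n -> R, G (lin_comb c e) (lin_comb c e) = 0 -> forall i, c i = 0) ->
  exists ks : seq nat, [/\ uniq ks, forall k, k \in ks -> lam k = sg & (n <= 2 * size ks)%N].
Proof.
case: n e => [|n] e De ker indep; first by exists [::].
pose y (i : 'I_n.+1) t := fu (e i) false t +i* fu (e i) true t.
have ycE i c t : cpart c (y i t) = fu (e i) c t by case: c.
have yV i : eigenspace_SL a b p q r s L sg%:C (y i).
  have [Z [Zsol ZL]] := kernel_solution HL (De i) (ker i).
  exists (fun t => Z false t +i* Z true t); last exact: ZL.
  exact: (@ode_SL_solution _ S _ _ _ _ coef sg (fu (e i)) Z).
have [x xab yx] : exists2 x, x \in `[a, b] & y ord0 x != 0.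
  apply: contrapT => no.
  have /eqP : (1 : R) = 0; last by rewrite oner_eq0.
  have := indep (fun i => (i == ord0)%:R) _ ord0; rewrite eqxx; apply.
  have -> : lin_comb (fun i => (i == ord0)%:R) e = e ord0.
    rewrite /lin_comb (bigD1 ord0)//= scale1r big1 ?addr0// => i /negbTE ->.
    by rewrite scale0r.
  apply: Gform_eq0 => c t tab; rewrite -ycE.
  have -> : y ord0 t = 0; last by case: c.
  by apply/eqP; apply: contrapT => /negP y0; apply: no; exists t.
have [k0 sgk] : exists k, lam k = sg.
  have [_ _ hev _] := hlam; have [|k [kE]] := (hev sg%:C).1; last by exists k.
  by exists (y ord0) => //; exists x.
have [_ _ _ /(_ k0)[m [f [f1 f2 f3]] card]] := hlam; rewrite sgk in f1 f3 card.
have /choice[cf cfP] : forall i, exists c : 'I_m -> R[i], forall x, x \in `[a, b] ->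
    y i x = \sum_(j < m) c j * f j x by move=> i; exact: f3 (yV i).
have /card_set_bijP[h [hf hi _]] : (`I_m #= [set k | lam k = sg])%card by rewrite card_eq_sym.
exists [seq h j | j <- iota 0 m]; split.
- rewrite map_inj_in_uniq ?iota_uniq// => i j; rewrite !mem_iota !add0n => im jm.
  by apply: hi; rewrite inE.
- by move=> k /mapP[j]; rewrite mem_iota add0n => jm ->; exact: hf.
rewrite size_map size_iota leqNgt; apply/negP => big.
(* The real and imaginary parts of the [m] coordinates give [2 m] real equations; [cpartM] shows
   that they suffice to annihilate both parts of the combination. *)
have [|d [i0 di0] dP] := @exists_lin_relation R 'I_n.+1 ('I_m * bool)%type
    (fun i j => cpart j.2 (cf i j.1)) predT.
  by rewrite card_ord cardT -cardE card_prod card_ord card_bool mulnC.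
move/eqP: di0; apply; apply: indep.
apply: Gform_eq0 => c t tab; rewrite fu_lc.
under eq_bigr => i _ do rewrite -ycE cfP// cpart_sum mulr_sumr.
rewrite exchange_big big1// => j _.
under eq_bigr => i _ do rewrite cpartM mulrDr !mulrA.
rewrite big_split /= -!mulr_suml.
by rewrite (dP (j, false))// (dP (j, true))// !mul0r addr0.
Qed.

Lemma eigenvalue_le nu (I : finType) (e : I -> @fspace R) m :
  nonpos_family D B G nu e -> (2 * m < #|I|)%N -> lam m <= nu.
Proof.
apply: (nonpos_family_eigenvalue (Dform0 S HL) (DformP HL) (Bform_sym S HL) (Gform_sym S L)).
- exact: Gform_ge0.
- by have [H _ _ _] := hlam.
- exact: Bform_lower.
- exact: Dform_finite_index.
- exact: kernel_family_multiplicity.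
Qed.

End Counting.

Lemma lin_comb_comp (R : realType) (V : lmodType R) (I J : finType) (d : I -> R)
    (X : I -> J -> R) (e : J -> V) :
  lin_comb d (fun i => lin_comb (X i) e) = lin_comb (fun j => \sum_i d i * X i j) e.
Proof.
have := lin_comb_lin_comb d X e (fun=> 0).
rewrite [X in _ = _ + X]/lin_comb big1 ?addr0 => [<-|i _]; last by rewrite scaler0.
by congr lin_comb; apply/funext => i; rewrite addr0.
Qed.

Section EigenElements.
Context {R : realType} (S : sl_data R) (L : @boundary_condition R).
Hypothesis HL : lagrangian_bc L.
Implicit Types (c : bool) (x t : R) (f g : @fspace R).
Notation a := (sla S). Notation b := (slb S).
Notation D := (Dform S L). Notation B := (Bform S). Notation G := (Gform S).

Lemma ode_sol0 sg : ode_sol S sg a b (fun=> 0) (fun=> 0).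
Proof.
have [b0 _ p0] := form_elt0 S; split => //.
move=> x y _ _ _; rewrite subrr (@eq_oint _ _ _ _ (fun=> 0)); last first.
  by move=> t _ _; rewrite /zeq !mulr0 addr0.
by rewrite /oint Rintegral_cst// mul0r.
Qed.

Lemma eig_elt_lc sg (I : finType) (k : I -> R) (e : I -> @fspace R) :
  (forall i, k i != 0 -> eig_elt S L sg (e i)) -> eig_elt S L sg (lin_comb k e).
Proof.
move=> ke; rewrite /lin_comb; elim/big_rec : _ => [|i f _ IH].
  split => //; [exact: Dform0|move=> c; exact: ode_sol0].
have [->|/ke[De oe ale bee]] := eqVneq (k i) 0; first by rewrite scale0r add0r.
have [Df of_ alf bef] := IH; split.
- exact: DformP.
- by move=> c; exact: ode_sol_lin (oe c) (of_ c).
- by move=> c; rewrite falP fzP alf ale.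
- by move=> c; rewrite fbeP fzP bef bee.
Qed.

Variables (lam : nat -> R) (E : nat -> bool -> @fspace R) (n : nat) (nu : R).
Hypotheses (EP : is_eigenfamily S L lam E) (lam_le : nondecreasing_seq lam).
Hypothesis lam_nu : lam n <= nu.
Notation I := ('I_n.+1 * bool)%type.
Notation e := (fun i : I => E i.1 i.2).

Let eD (i : I) : D (e i). Proof. by have [H _] := EP; have [] := H i.1 i.2. Qed.
Let eig (i : I) f : D f -> B (e i) f = lam i.1 * G (e i) f.
Proof. by have [H _] := EP; exact: eig_weak. Qed.
Let lam_le_nu (i : I) : lam i.1 <= nu.
Proof. by rewrite (le_trans _ lam_nu)// lam_le// -ltnS. Qed.

Lemma eigenfamily_indep (c : I -> R) : G (lin_comb c e) (lin_comb c e) = 0 -> forall i, c i = 0.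
Proof.
apply: (eig_indep (Dform0 S HL) (DformP HL) (Bform_sym S HL) (Gform_sym S L)
  (@Gform_ge0 _ S L) eD eig).
by move=> v; exact: EP.2.
Qed.

Lemma eigenfamily_nonpos : nonpos_family D B G nu e.
Proof.
apply: (eig_nonpos (Dform0 S HL) (DformP HL) (Bform_sym S HL) (Gform_sym S L)
  (@Gform_ge0 _ S L) eD eig _ lam_le_nu).
by move=> v; exact: EP.2.
Qed.

Lemma eigenfamily_form_le (c : I -> R) :
  B (lin_comb c e) (lin_comb c e) <= nu * G (lin_comb c e) (lin_comb c e).
Proof.
apply: (eig_form_le (Dform0 S HL) (DformP HL) (Bform_sym S HL) (Gform_sym S L)
  (@Gform_ge0 _ S L) eD eig _ lam_le_nu).
Qed.

Lemma eigenfamily_form_eq (c : I -> R) :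
  B (lin_comb c e) (lin_comb c e) = nu * G (lin_comb c e) (lin_comb c e) ->
  eig_elt S L nu (lin_comb c e).
Proof.
move=> BG; apply: eig_elt_lc => i ci.
suff <- : lam i.1 = nu by exact: EP.1.
apply: contra_neq_eq ci => inu.
apply: (eig_form_eq (Dform0 S HL) (DformP HL) (Bform_sym S HL) (Gform_sym S L)
  (@Gform_ge0 _ S L) eD eig _ lam_le_nu BG) => //.
by move=> v; exact: EP.2.
Qed.

Lemma eigenfamily_D (c : I -> R) : D (lin_comb c e).
Proof. exact: (@D_lin_comb R _ D (Dform0 S HL) (DformP HL) _ c _ eD). Qed.

End EigenElements.

(** * Comparison with the Dirichlet eigenvalues *)

Section Comparison.
Context {R : realType} (S : sl_data R) (L : @boundary_condition R).
Hypothesis HL : lagrangian_bc L.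
Notation mu := (@lebesgue_measure R).
Implicit Types (c : bool) (x t : R) (f g : @fspace R).
Notation a := (sla S). Notation b := (slb S).
Variables p q r s : R -> R.
Hypothesis coef : {ae mu, forall x, x \in `]a, b[ ->
  [/\ 0 < p x, slw S x = (p x)^-1, slq S x = q x, slr S x = r x & sls S x = s x]}.
Let dir := @dirichlet_bc R.
Let Hdir : lagrangian_bc dir := dirichlet_bc_lagrangian.
Notation D := (Dform S L). Notation Dd := (Dform S dir).
Notation B := (Bform S). Notation G := (Gform S).
Variables lam lamD : nat -> R.
Hypothesis hlam : eigenvalue_sequence a b p q r s L lam.
Hypothesis hlamD : eigenvalue_sequence a b p q r s dir lamD.

Let lamP : nondecreasing_seq lam. Proof. by have [] := hlam. Qed.
Let lamDP : nondecreasing_seq lamD. Proof. by have [] := hlamD. Qed.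

Lemma Dform_dirichletP f : Dd f <-> (forall c, form_elt S (fu f c) (fz f c)) /\
  forall c, fu f c a = 0 /\ fu f c b = 0.
Proof.
split=> -[fe H]; split => //.
  move: H => -[]; rewrite !vec2_0 => -[a0 a1] [b0 b1].
  by case.
split; rewrite vec2_0.
  by rewrite (H false).1 (H true).1.
by rewrite (H false).2 (H true).2.
Qed.

Definition strip f : @fspace R := fmk (fu f) (fz f) (fun=> 0) (fun=> 0).

Lemma stripP f : Dd f -> D (strip f).
Proof.
move=> /Dform_dirichletP[fe f0]; split => //.
rewrite /Ya /Yb /= /fal /fbe /=.
have -> : fu (strip f) = fu f by [].
by rewrite !(f0 _).1 !(f0 _).2 vec2_00; exact: lag0.
Qed.

Lemma strip_nonpos nu (I : finType) (e : I -> @fspace R) :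
  nonpos_family Dd B G nu e -> nonpos_family D B G nu (strip \o e).
Proof.
move=> [De neg]; split => [i|k k0]; first exact: stripP.
have Dk := @D_lin_comb R _ Dd (Dform0 S Hdir) (DformP Hdir) _ k _ De.
have /Dform_dirichletP[_ bd] := Dk.
have uE : fu (lin_comb k (strip \o e)) = fu (lin_comb k e).
  by apply/funext => c; apply/funext => t; rewrite !fu_lc.
have zE : fz (lin_comb k (strip \o e)) = fz (lin_comb k e).
  by apply/funext => c; apply/funext => t; rewrite !fz_lc.
have GE : G (lin_comb k (strip \o e)) (lin_comb k (strip \o e)) = G (lin_comb k e) (lin_comb k e).
  by rewrite /Gform /Gc uE.
have BE : B (lin_comb k (strip \o e)) (lin_comb k (strip \o e)) = B (lin_comb k e) (lin_comb k e).
  by rewrite /Bform /Bc uE zE !(bd _).1 !(bd _).2 !mulr0.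
by rewrite GE BE; exact: neg.
Qed.

Lemma eigenvalue_le_dirichlet n : lam n <= lamD n.
Proof.
have [E EP] := eigenfamily_exists Hdir coef hlamD.
apply: (eigenvalue_le HL coef hlam (strip_nonpos (eigenfamily_nonpos Hdir EP lamDP (lexx (lamD n))))).
by rewrite card_prod card_ord card_bool mulnC ltn_pmul2r.
Qed.

(* The Dirichlet eigenvalues are simple: an eigenfunction is determined by its
   quasi-derivative at [a]. *)
Lemma dirichlet_simple n : lamD n < lamD n.+1.
Proof.
rewrite lt_neqAle lamDP// andbT; apply/eqP => lam_eq.
have [E EP] := eigenfamily_exists Hdir coef hlamD.
pose e (i : 'I_n.+2 * bool) := E i.1 i.2.
(* The [2 n + 4] coefficients are subject to two conditions on the quasi-derivative at [a] and to
   the [2 n] conditions that the coefficients of index below [n] vanish. What remains is a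
   combination at the supposed double eigenvalue. *)
have [|k [i0 ki0] kP] := @exists_lin_relation R ('I_n.+2 * bool)%type (bool + 'I_n * bool)%type
    (fun i j => match j with inl c => fz (e i) c a | inr (l, c) => ((val i.1 == l :> nat) && (i.2
      == c))%:R end) predT.
  by rewrite cardT -cardE card_sum !card_prod !card_ord card_bool; lia.
have kl (i : 'I_n.+2 * bool) : lamD i.1 != lamD n -> k i = 0.
  case: i => i c /= ine; have lin : (i < n)%N.
    rewrite ltnNge; apply/negP => ni; case/eqP: ine.
    have [ii|ii] : (i = n :> nat) \/ (i = n.+1 :> nat) by have := ltn_ord i; lia.
      by rewrite ii.
    by rewrite ii.
  have := kP (inr (Ordinal lin, c)) isT.
  rewrite (bigD1 (i, c))//= !eqxx mulr1 big1 ?addr0// => -[i' c'] /= ne.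
  case: eqP => [ii|_]; last by rewrite mulr0.
  case: eqP => [cc|_]; last by rewrite mulr0.
  by case/eqP: ne; rewrite cc; congr pair; apply/val_inj.
have [/Dform_dirichletP[_ f0] fo _ _] : eig_elt S dir (lamD n) (lin_comb k e).
  apply: eig_elt_lc => // i ki; have <- : lamD i.1 = lamD n.
    by apply: contra_neq_eq ki; exact: kl.
  exact: EP.1.
move/eqP: ki0; apply; apply: (EP.2 _ _ _ kl).
apply: Gform_eq0 => c t tab; apply: (ode_unique (fo c) (f0 c).1 _ tab).1.
by rewrite fz_lc; exact: (kP (inl c) isT).
Qed.

Lemma dirichlet_family_lt m (I : finType) (e : I -> @fspace R) :
  nonpos_family Dd B G (lamD m) e -> (#|I| <= 2 * m.+1)%N.
Proof.
move=> ne; rewrite leqNgt; apply/negP => /(eigenvalue_le Hdir coef hlamD ne).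
by rewrite leNgt dirichlet_simple.
Qed.

Lemma dirichlet_lt_eigenvalue n : lamD n < lam n.+2.
Proof.
rewrite ltNge; apply/negP => le; set nu := lamD n in le.
have [E EP] := eigenfamily_exists HL coef hlam.
have [F FP] := eigenfamily_exists Hdir coef hlamD.
pose e (i : 'I_n.+3 * bool) := E i.1 i.2.
have eD (c : _ -> R) : D (lin_comb c e).
  exact: (@eigenfamily_D _ S L HL lam E n.+2 EP c).
have eDd (c : _ -> R) : (forall c', fu (lin_comb c e) c' a = 0 /\ fu (lin_comb c e) c' b = 0) -> Dd
  (lin_comb c e).
  by move=> h; apply/Dform_dirichletP; split=> //; exact: (eD c).1.
have ele (c : _ -> R) := eigenfamily_form_le HL EP lamP le c.
have eindep (c : _ -> R) := @eigenfamily_indep _ S L HL lam E n.+2 EP c.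
have cardI : #|{: 'I_n.+3 * bool}| = (2 * n + 6)%N by rewrite card_prod card_ord card_bool; lia.
(* [v] is an eigenfunction for both conditions; by the Lagrange identity
   the values at [a] of the elements of [D] are then determined by those at [b]. *)
have no_common v : eig_elt S L nu v -> Dd v -> forall c t, a <= t <= b -> fu v c t = 0.
  move=> [Dv vo val_ vbe] Ddv c0 t0 t0ab; apply/eqP; apply: contrapT => /negP v0.
  have /Dform_dirichletP[_ vbd] := Ddv.
  have [k [X [kn XP Xind]]] := @exists_kernel_family R ('I_n.+3 * bool)%type bool (fun i c => fu (e i) c b).
  have za : fal v false +i* fal v true != 0.
    apply: contraNneq v0 => z0; have za c : fz v c a = 0.
      by rewrite -val_; case: z0; case: c.
    by rewrite (ode_unique (vo c0) (vbd c0).1 (za c0) t0ab).1.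
  have bDd (c : _ -> R) : (forall c', fu (lin_comb c e) c' b = 0) -> Dd (lin_comb c e).
    move=> cb; apply: eDd => c'; split => //.
    have := lag_iso HL Dv.2 (eD c).2; rewrite /symplectic !vec2_0 !vec2_1.
    rewrite !(vbd _).1 !(vbd _).2 !cb !conjcE oppr0 !mul0r !mulr0 subrr subr0 => /eqP.
    rewrite mulf_eq0 (negbTE za) /= eq_complex /= oppr_eq0 => /andP[/eqP h1 /eqP h2].
    by case: c'.
  have gE (d : 'I_k -> R) : lin_comb d (fun l => lin_comb (X l) e) =
      lin_comb (fun i => \sum_l d l * X l i) e by exact: lin_comb_comp.
  have gD l : Dd (lin_comb (X l) e) by apply: bDd => c'; rewrite fu_lc XP.
  suff /dirichlet_family_lt : nonpos_family Dd B G (lamD n) (fun l => lin_comb (X l) e).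
    by move: kn; rewrite cardI card_ord card_bool; lia.
  split=> // d [l dl]; rewrite gE; split; last exact: ele.
  rewrite lt_neqAle (Gform_ge0 (eD _)) andbT eq_sym.
  by apply: contraNneq dl => /eindep/Xind ->.
(* Both parts at both ends: four real conditions on [2 n + 6] coefficients, so [k] is at least
   [2 n + 2]. *)
have [k [X [kn XP Xind]]] := @exists_kernel_family R ('I_n.+3 * bool)%type (bool * bool)%type
  (fun i j => fu (e i) j.1 (if j.2 then b else a)).
pose h (j : 'I_k + bool) := match j with inl l => lin_comb (X l) e | inr c => F n c end.
have FD c : Dd (F n c) by have [] := FP.1 n c.
have gD l : Dd (lin_comb (X l) e).
  by apply: eDd => c; split; rewrite fu_lc; [exact: XP l (c, false)|exact: XP l (c, true)].
have hD j : Dd (h j) by case: j.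
have symB := Bform_sym S Hdir; have symG := Gform_sym S dir.
suff /dirichlet_family_lt : nonpos_family Dd B G (lamD n) h.
  by move: kn; rewrite cardI card_sum card_prod card_ord card_bool; lia.
split=> // d [j dj].
set v := lin_comb (fun i => \sum_l d (inl l) * X l i) e.
set u := lin_comb (fun c => d (inr c)) (F n).
have -> : lin_comb d h = v + u.
  by rewrite {1}/lin_comb big_sumType /=; congr (_ + _); rewrite /v -lin_comb_comp.
have vDd : Dd v.
  by rewrite /v -lin_comb_comp; exact: (@D_lin_comb R _ Dd (Dform0 S Hdir) (DformP Hdir)).
have uE : eig_elt S dir nu u by apply: (eig_elt_lc Hdir) => c _; exact: FP.1.
have uDd : Dd u by case: uE.
(* Adding an eigenelement at [nu] does not change the form [B - nu G], so the inequality for [v]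
   extends to [v + u]. *)
have Ble : B (v + u) (v + u) - nu * G (v + u) (v + u) = B v v - nu * G v v.
  rewrite !(form_sqrD (DformP Hdir) symB)// !(form_sqrD (DformP Hdir) symG)//.
  rewrite (symB.2 v u)// (symG.2 v u)// !(eig_weak uE)//; ring.
have fD : Dd (v + u) by have := DformP Hdir 1 vDd uDd; rewrite scale1r.
have vle : B v v <= nu * G v v by exact: ele.
split; first last.
  by rewrite -subr_le0 -/nu Ble subr_le0.
rewrite lt_neqAle (Gform_ge0 fD) andbT eq_sym; apply: contraNneq dj => G0.
(* If [v + u] is null for [G], the lower bound makes [B] nonnegative at it, so equality holds in
   [vle] and [v] is an eigenelement of both problems, which [no_common] excludes unless it
   vanishes. *)
have vE : eig_elt S L nu v.
  apply: (eigenfamily_form_eq HL EP lamP le); apply/eqP.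
  rewrite eq_le -/e -/v vle /=.
  have [C /(_ _ fD)] := Bform_lower S Hdir.
  by rewrite -[in X in _ -> X]subr_ge0 -Ble G0 !mulr0 !subr0.
have v0 := no_common v vE vDd.
have /eindep/Xind d1 := Gform_eq0 v0.
case: j => [l|c]; first by rewrite d1.
have u0 : G u u = 0.
  apply: Gform_eq0 => c' t tab; have := Gform_null fD G0 c' tab.
  by rewrite -[v]scale1r fuP v0// mulr0 add0r.
(* Independence is stated for initial segments of the family, so the coefficients of [u] are padded
   by zeros below index [n]. *)
pose C (i : 'I_n.+1 * bool) := if i.1 == ord_max then d (inr i.2) else 0.
have CE : lin_comb C (fun i => F i.1 i.2) = u.
  transitivity (\sum_(i < n.+1) \sum_c' C (i, c') *: F i c').
    by rewrite pair_bigA; apply: eq_bigr => -[].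
  rewrite (bigD1 ord_max)//= [X in _ + X]big1 ?addr0 => [|i /negbTE ni].
    by apply: eq_bigr => c' _; rewrite /C eqxx.
  by apply: big1 => c' _; rewrite /C /= ni scale0r.
have C0 (i : 'I_n.+1 * bool) : lamD i.1 != nu -> C i = 0.
  by rewrite /C; have [->|//] := eqVneq i.1 ord_max; rewrite eqxx.
have := FP.2 n.+1 nu C C0; rewrite CE => /(_ u0 (ord_max, c)).
by rewrite /C eqxx => ->.
Qed.

End Comparison.

Theorem theorem4p2 (R : realType) (a b : R) (p q r s : R -> R)
    (A B : 'M[R[i]]_2) (lamD lam : nat -> R)
    (hab : a < b)
    (hp : in_L1 a b (fun x => (p x)^-1)) (hq : in_L1 a b q)
    (hr : in_L1 a b r) (hs : in_L1 a b s)
    (p_gt0 : {ae @lebesgue_measure R, forall x, x \in `]a, b[ -> 0 < p x})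
    (r_gt0 : {ae @lebesgue_measure R, forall x, x \in `]a, b[ -> 0 < r x})
    (hAB : self_adjoint_bc A B)
    (hlamD : eigenvalue_sequence a b p q r s dirichlet_bc lamD)
    (hlam : eigenvalue_sequence a b p q r s (matrix_bc A B) lam) :
  (lam 0%N <= lamD 0%N /\ lam 1%N <= lamD 1%N) /\
  (forall n : nat, (2 <= n)%N -> lamD (n - 2)%N < lam n <= lamD n).
Proof.
have [S [Sa Sb coef]] := sl_data_exists hab hp hq hr hs p_gt0 r_gt0.
move: hlamD hlam coef; rewrite -Sa -Sb => hlamD hlam coef.
have HL := matrix_bc_lagrangian hAB.
have le_dirichlet := eigenvalue_le_dirichlet HL coef hlam hlamD.
split=> [//|[|[|n]]//= _].
by rewrite subn2 /= (dirichlet_lt_eigenvalue HL coef hlam hlamD) le_dirichlet.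
Qed.
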